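(* Let $J$ be a semi-infinite Jacobi matrix whose Jacobi parameters $\{a_n,b_n\}_{n=1}^\infty$ ($a_n>0$, $b_n\in\mathbb{R}$) satisfy $\limsup_{n\to\infty}(|b_n|+|a_n-1|)^{1/n}<1$, and let $u$ be its Jost function. Then the Jacobi parameters have a complete asymptotic series if and only if $u$ is an entire meromorphic function (that is, $u$ extends to a meromorphic function on all of $\mathbb{C}$). Equivalently, the function $$B(z)=1-\sum_{n=0}^\infty\left[b_{n+1}z^{2n+1}+(a_{n+1}^2-1)z^{2n+2}\right]$$ is entire meromorphic if and only if $u$ is entire meromorphic.
   Context: Jacobi matrix: $J$ is the tridiagonal matrix on $\ell^2(\{1,2,\dots\})$ with diagonal entries $b_1,b_2,\dots$ and off-diagonal entries $a_1,a_2,\dots$ ($a_n>0$, $b_n\in\mathbb{R}$). Its spectral measure $\gamma$ is the spectral measure of $J$ for the vector $\delta_1=(1,0,0,\dots)^t$. $\mathbb{D}=\{z:|z|<1\}$. Jost function: when $\limsup_n(|b_n|+|a_n-1|)^{1/n}<1$, the Jost function $u$ is the function analytic in a neighborhood of $\overline{\mathbb{D}}$ determined by: (i) for $z\in\mathbb{D}$, $u(z)=0$ iff $z+z^{-1}$ is an eigenvalue of $J$ (these zeros are simple); (ii) the singular part of $\gamma$ is supported on a finite set of eigenvalues in $\mathbb{R}\setminus[-2,2]$, and $d\gamma\restriction[-2,2]=f(x)\,dx$ with $f(2\cos\theta)=\frac1\pi\,\frac{\sin\theta}{|u(e^{i\theta})|^2}$ for $\theta\in[0,\pi]$; (iii)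 $u(0)>0$. Equivalently, for $z\in\mathbb{D}$, $u(z)=\left(\prod_{j=1}^\infty a_j\right)^{-1}\det\left(1+\delta J\,(J_0-(z+z^{-1}))^{-1}\right)$, where $J_0$ is the Jacobi matrix with $a_n\equiv1,b_n\equiv0$ and $\delta J=J-J_0$. Asymptotic series: a complex sequence $(x_0,x_1,\dots)$ has an asymptotic series up to $R>1$ if there exist finitely many $\mu_1,\dots,\mu_{K(R)}\in\{z:1<|z|<R\}$ and polynomials $p_1,\dots,p_{K(R)}$ with $\limsup_{n\to\infty}\left|x_n-\sum_{j=1}^{K(R)}p_j(n)\mu_j^{-n}\right|^{1/n}\le R^{-1}$. It has a complete asymptotic series if it has one up to $R$ for each $R>1$. The Jacobi parameters are said to have a complete asymptotic series if the sequence $(1,-b_1,1-a_1^2,-b_2,1-a_2^2,\dots)$ does. *)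

(* Defs.v *)
(* Complex numbers are R[i], with R : realType; they are written R[i]^o where
   their topology is needed. *)
From mathcomp Require Export all_boot all_order all_algebra.
From mathcomp Require Export all_classical all_reals all_analysis.
From mathcomp Require Export complex.
Set Implicit Arguments.
Unset Strict Implicit.
Unset Printing Implicit Defensive.
Import Order.TTheory GRing.Theory Num.Theory.
Import numFieldNormedType.Exports.
Local Open Scope classical_set_scope.
Local Open Scope ring_scope.
Local Open Scope complex_scope.

(* The modulus with values in R (`|z| is valued in R[i]). *)
Notation normc := ComplexField.Normc.normc.

Section Meromorphic.
Variable R : realType.
Implicit Types F f : R[i]^o -> R[i]^o.

(* On a punctured neighborhood of z0, (z - z0) ^+ m * F z is the sum of a power
   series in z - z0; the value F z0 is irrelevant, as z0 may be a pole. *)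
Definition meromorphic_at F (z0 : R[i]^o) : Prop :=
  exists (m : nat) (c : nat -> R[i]^o),
    \forall z \near z0^',
      series (fun k => c k * (z - z0) ^+ k) @ \oo --> (z - z0) ^+ m * F z.

(* Only the values of f on the open unit disk matter. *)
Definition entire_meromorphic f : Prop :=
  exists F : R[i]^o -> R[i]^o,
    (forall z0, meromorphic_at F z0) /\ (forall z, normc z < 1 -> F z = f z).

End Meromorphic.

Section AsymptoticSeries.
Variable R : realType.
Implicit Type x : nat -> R[i].

Definition asymptotic_series_upto x (rho : R) : Prop :=
  exists (K : nat) (mu : 'I_K -> R[i]) (p : 'I_K -> {poly R[i]}),
    (forall j, 1 < normc (mu j) < rho) /\
    (limn_esup (fun n : nat =>
       (normc (x n - \sum_(j < K) (p j).[n%:R] * mu j ^- n)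
          `^ (n%:R^-1))%:E) <= (rho^-1)%:E)%E.

Definition complete_asymptotic_series x : Prop :=
  forall rho : R, 1 < rho -> asymptotic_series_upto x rho.

End AsymptoticSeries.

(* Operators on l^2({1,2,...}) are given by infinite matrices indexed from 0:
   index i stands for the site i + 1. *)
Section InfiniteMatrices.
Variable R : realType.
Implicit Types (v : nat -> R[i]) (A T G : nat -> nat -> R[i]).

Definition is_l2 v : Prop :=
  cvgn (series (fun k : nat => normc (v k) ^+ 2)).

(* T is meant to be tridiagonal, so that row i of T is supported on k < i + 2
   and the sum defining (T v)_i is finite. *)
Definition tridiag_app T v (i : nat) : R[i] := \sum_(k < i.+2) T i k * v k.

Definition tridiag_mul T G (i j : nat) : R[i] := tridiag_app T (G^~ j) i.

(* The matrix of T^-1, for T tridiagonal and invertible on l^2: its j-th column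
   is the unique x in l^2 such that T x is the j-th basis vector. *)
Definition l2_inverse T : nat -> nat -> R[i] :=
  get [set G : nat -> nat -> R[i]^o |
    forall j, is_l2 (G^~ j) /\
      forall i, tridiag_app T (G^~ j) i = (i == j)%:R].

(* Fredholm determinant det(1 + A) of a trace class A, as the limit of the
   determinants of the finite sections of 1 + A. *)
Definition fredholm_det1D A : R[i]^o :=
  limn (fun N : nat =>
    (\det (1%:M + \matrix_(i < N, j < N) A i j) : R[i]^o)).

End InfiniteMatrices.

(* Jacobi parameters a, b : nat -> R are indexed from 1; a 0 and b 0 are
   unused. *)
Section Jacobi.
Variable R : realType.
Implicit Types (a b : nat -> R) (z : R[i]^o).

Definition jacobi_mx a b (i j : nat) : R[i] :=
  if i == j then (b i.+1)%:C
  else if j == i.+1 then (a i.+1)%:C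
  else if i == j.+1 then (a j.+1)%:C
  else 0.

Definition free_jacobi_mx : nat -> nat -> R[i] :=
  jacobi_mx (fun=> 1) (fun=> 0).

Definition delta_jacobi a b (i j : nat) : R[i] :=
  jacobi_mx a b i j - free_jacobi_mx i j.

(* (J_0 - (z + z^-1))^-1; at z = 0, where z + z^-1 is the point at infinity,
   the resolvent is 0. *)
Definition free_resolvent z : nat -> nat -> R[i] :=
  if z == 0 then fun _ _ => 0
  else l2_inverse (fun i j => free_jacobi_mx i j - (z + z^-1) *+ (i == j)).

(* The Jost function on the open unit disk, as a perturbation determinant:
   (prod_j a_j)^-1 * det(1 + delta J * (J_0 - (z + z^-1))^-1). *)
Definition jost a b z : R[i]^o :=
  ((limn (fun N : nat => \prod_(j < N) a j.+1))^-1)%:C *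
  fredholm_det1D (tridiag_mul (delta_jacobi a b) (free_resolvent z)).

Definition jacobi_seq a b (n : nat) : R[i] :=
  if n == 0%N then 1
  else if odd n then (- b (n.+1)./2)%:C
  else (1 - a n./2 ^+ 2)%:C.

Definition jacobi_B a b z : R[i]^o :=
  1 - limn (series (fun n : nat =>
        ((b n.+1)%:C * z ^+ (2 * n + 1) +
         (a n.+1 ^+ 2 - 1)%:C * z ^+ (2 * n + 2) : R[i]^o))).

End Jacobi.

(* Main.v *)
Require Import Defs.
From mathcomp Require Import all_boot all_order all_algebra.
From mathcomp Require Import all_classical all_reals all_analysis.
From mathcomp Require Import complex ring lra zify.
From mathcomp Require cyclic separable cyclotomic finmap.

(** Write xo_n = - b_(n+1), xe_n = 1 - a_(n+1)^2, and let T be the shift on sequences.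
By the decay hypothesis both sequences have generating functions analytic in a disc |z|
< s0^2 with s0 > 1.

A function that is analytic near 0 continues to a meromorphic function on the plane if
and only if, for every radius r, finitely many factors T - l turn its Taylor sequence
into one with radius of convergence at least r. The inductive class [merom] records this
property; the equivalence is [merom_entire_meromorphic] and [entire_meromorphic_merom].
One direction glues the values obtained by clearing poles; the other one bounds the
poles in a disc by compactness, clears them, and uses that a function analytic in a disc
has a Taylor series converging there. Among the geometrically decaying sequences, the
same class describes those with an asymptotic series up to r, because T - l lowers the
degree of the polynomial in p(n) l^n and is onto on exponential polynomials
([asymptotic_merom], [merom_asymptotic]). As the Taylor sequence of B is the sequence 1,
-b_1, 1 - a_1^2, -b_2, ..., it remains to show that the coefficients of u are in [merom]
for all radii if and only if those of xo and xe are.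

Put c_n(z) = z^n P_n(z + 1/z) with P_n the monic orthogonal polynomials. Expanding
tridiagonal determinants identifies the finite sections of the perturbation determinant
with c_(n+1) - a_(n+1) z^2 c_n, so that, up to a nonzero constant, the Jost function is
the limit u of g_n = c_n - a_n^2 z^2 c_(n-1) ([det_section_cvg], [prod_a_cvg]). The
recursion for the g_n gives T^2 u = T S[xo] + S[xe] on coefficients, where S[h] is the
sum of the h_n c_n. Summation by parts in S[h] yields the shift identity [gS_sub_shl]:
T^2 - l acts on S[h] as T - l on h, up to terms S[x y] with x one of xo, xe and y a tail
sum built from h. Such a product decays faster than y, by a factor s0^2 in the radius.

If xo, xe and h are in the class, then so is S[h], by clearing the poles of h with the
shift identity and by descending induction on the decay of h ([merom_gS]); hence so is
u. As c_n has degree 2 n, radii q^2 for h become radii q for S[h].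

Conversely, suppose u is in the class and that xo and xe are meromorphic up to some
radius p^2. The shift identity clears their poles, its quadratic terms being meromorphic
up to p s0. What is left is the linear map that sends a pair (yo, ye) without poles to T
S[yo] + S[ye]. Since c_n is its own reciprocal and tends to v = u / (1 - z^2), this map
is the Toeplitz operator v(T) on the interleaved pair, up to terms of radius p s0
([gS_toeplitz]). The operator u(T) can be inverted because 1/u is meromorphic in the
unit disc ([merom_opT_inv]), so that xo and xe are meromorphic up to (p s0)^2
([merom_linear_part]). Iterating gives all radii ([gU_merom]). *)

Set Implicit Arguments.
Unset Strict Implicit.
Unset Printing Implicit Defensive.
Import Order.TTheory GRing.Theory Num.Theory.
Import numFieldNormedType.Exports.
Local Open Scope ring_scope.
Local Open Scope complex_scope.
Local Notation Re := complex.Re.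
Local Notation Im := complex.Im.

(** * The modulus *)

Section Modulus.
Variable R : realType.
Local Notation C := R[i].
Implicit Types (x y z : C).

Lemma normc_ge0 z : 0 <= normc z.
Proof. by case: z => a b /=; rewrite sqrtr_ge0. Qed.

Lemma normc_eq0 z : (normc z == 0) = (z == 0).
Proof.
apply/eqP/eqP => [/ComplexField.Normc.eq0_normc //|->].
exact: ComplexField.Normc.normc0.
Qed.

Lemma normc0E : normc (0 : C) = 0.
Proof. exact: ComplexField.Normc.normc0. Qed.

Lemma normc1E : normc (1 : C) = 1.
Proof. exact: ComplexField.Normc.normc1. Qed.

Lemma normcME x y : normc (x * y) = normc x * normc y.
Proof. exact: ComplexField.Normc.normcM. Qed.

Lemma normcNE x : normc (- x) = normc x.
Proof. exact: normcN. Qed.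

Lemma normcVE x : normc x^-1 = (normc x)^-1.
Proof. exact: ComplexField.Normc.normcV. Qed.

Lemma normcDle x y : normc (x + y) <= normc x + normc y.
Proof. exact: le_normcD. Qed.

Lemma normcBle x y : normc (x - y) <= normc x + normc y.
Proof. by rewrite (le_trans (normcDle _ _))// normcNE. Qed.

Lemma normc_distC x y : normc (x - y) = normc (y - x).
Proof. by rewrite -normcNE opprB. Qed.

Lemma normcXE x n : normc (x ^+ n) = normc x ^+ n.
Proof.
by elim: n => [|n IH]; rewrite ?expr0 ?normc1E// !exprS normcME IH.
Qed.

Lemma normc_gt0 z : (0 < normc z) = (z != 0).
Proof. by rewrite lt_def normc_ge0 andbT normc_eq0. Qed.

Lemma normc_sum I (r : seq I) (P : pred I) (F : I -> C) :
  normc (\sum_(i <- r | P i) F i) <= \sum_(i <- r | P i) normc (F i).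
Proof.
elim/big_rec2 : _ => [|i y x _ le_xy]; first by rewrite normc0E.
by rewrite (le_trans (normcDle _ _))// lerD2l.
Qed.

Lemma normc_real (a : R) : normc a%:C = `|a|.
Proof. by rewrite /= expr0n addr0 sqrtr_sqr. Qed.

Lemma normc_Re z : `|Re z| <= normc z.
Proof. by have := normc_ge_Re z; rewrite lecR. Qed.

Lemma normc_Im z : `|Im z| <= normc z.
Proof.
case: z => a b /=; rewrite -sqrtr_sqr ler_wsqrtr//.
by rewrite lerDr sqr_ge0.
Qed.

Lemma normc_ReIm z : normc z <= `|Re z| + `|Im z|.
Proof.
have zE : z = (Re z)%:C + (0 +i* Im z) by case: z => a b /=; simpc.
rewrite {1}zE (le_trans (normcDle _ _))// normc_real lerD2l.
by rewrite /= expr0n add0r sqrtr_sqr.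
Qed.

Lemma normc_ge_dist x y : normc x - normc y <= normc (x - y).
Proof.
by rewrite lerBlDr (le_trans _ (normcDle _ _))// subrK.
Qed.

Lemma normc_nat n : normc (n%:R : C) = n%:R.
Proof. by rewrite -[n%:R]/((n%:R : C)) -(rmorph_nat (real_complex R)) normc_real normr_nat. Qed.

(** Convergence in the topology of the complex numbers, read off the real-valued
modulus. *)
Lemma cvgCP (u : nat -> C) (l : C) :
  ((u : nat -> C^o) @ \oo --> (l : C^o))%classic <->
  forall e : R, 0 < e -> exists N, forall n, (N <= n)%N -> normc (u n - l) < e.
Proof.
split=> [/cvgrPdist_lt h e e0|h].
  have /h : (0 : C) < e%:C by rewrite ltcR.
  case=> N _ hN; exists N => n Nn.
  by have := hN n Nn; rewrite -ltcR /= distrC.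
apply/cvgrPdist_lt => e e0.
have [e' e'0 ->] : exists2 e' : R, 0 < e' & e = e'%:C.
  move: e0; case: e => a b; rewrite ltcE /= => /andP[/eqP -> a0].
  by exists a.
have [N hN] := h _ e'0.
exists N => // n /= Nn; rewrite distrC.
by have := hN n Nn; rewrite -ltcR.
Qed.

Lemma nbhsCP (p : C) (A : set C) :
  nbhs (p : C^o) A <->
  exists2 d : R, 0 < d & forall z, normc (z - p) < d -> A z.
Proof.
split=> [/nbhs_ballP[e /= e0 h]|[d d0 h]].
  have [d d0 eE] : exists2 e' : R, 0 < e' & e = e'%:C.
    move: e0; case: e {h} => a b; rewrite ltcE /= => /andP[/eqP -> a0].
    by exists a.
  exists d => // z zd; apply: h; rewrite /ball /= eE distrC.
  by rewrite -[`|_|]/(normc (z - p))%:C ltcR.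
apply/nbhs_ballP; exists d%:C => /=; first by rewrite ltcR.
move=> z; rewrite /ball /= distrC => zd; apply: h.
by rewrite -ltcR.
Qed.

Lemma dnbhsCP (p : C) (A : set C) :
  dnbhs (p : C^o) A <->
  exists2 d : R, 0 < d & forall z, z != p -> normc (z - p) < d -> A z.
Proof.
rewrite /dnbhs /within /= -/(nbhs _ _); split=> [/nbhsCP[d d0 h]|[d d0 h]].
  by exists d => // z zp zd; apply: h.
by apply/nbhsCP; exists d => // z zd /= zp; apply: h.
Qed.

End Modulus.

(** * Geometrically dominated series *)

Section GeometricSums.
Variable R : realType.
Local Notation C := R[i].
Implicit Types (f g : nat -> C) (K q : R).

Definition geo K q f := forall n, normc (f n) <= K * q ^+ n.

(** Geometric domination is stable under the manipulations of series below and bounds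
their tails explicitly. *)
Definition geometric_dominated f := exists K q, [/\ 0 <= q, q < 1 & geo K q f].

Definition csum f : C := limn (series (f : nat -> C^o)).

Lemma geo_ge0 K q f : geo K q f -> 0 <= K.
Proof. by move=> /(_ 0%N); rewrite expr0 mulr1; apply: le_trans; exact: normc_ge0. Qed.

Lemma geometric_sum_le q n : 0 <= q -> q < 1 ->
  \sum_(i < n) q ^+ i <= (1 - q)^-1.
Proof.
move=> q0 q1; have q1' : 0 < 1 - q by rewrite subr_gt0.
rewrite -[leRHS]mul1r ler_pdivlMr//.
have -> : (\sum_(i < n) q ^+ i) * (1 - q) = 1 - q ^+ n.
  by rewrite -opprB mulrN mulrC -subrX1 opprB.
by rewrite gerBl exprn_ge0.
Qed.

Lemma real_geo_cvg K q (u : nat -> R) : 0 <= q -> q < 1 -> 0 <= K ->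
  (forall n, `|u n| <= K * q ^+ n) -> cvgn (series u).
Proof.
move=> q0 q1 K0 uq; apply: normed_cvg.
apply: (@series_le_cvg _ _ (fun n => K * q ^+ n)) => [n|n|n|] //=.
- by rewrite mulr_ge0// exprn_ge0.
- by apply: is_cvg_geometric_series; rewrite ger0_norm.
Qed.

Lemma csum_cvg f : geometric_dominated f ->
  (series (f : nat -> C^o) @ \oo --> (csum f : C^o))%classic.
Proof.
move=> [K [q [q0 q1 fq]]]; have K0 := geo_ge0 fq.
have cRe : cvgn (series (fun n => Re (f n))).
  apply: (@real_geo_cvg K q) => // n.
  exact: le_trans (normc_Re _) (fq n).
have cIm : cvgn (series (fun n => Im (f n))).
  apply: (@real_geo_cvg K q) => // n.
  exact: le_trans (normc_Im _) (fq n).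
have sE n : series (f : nat -> C^o) n =
    (series (fun n => Re (f n)) n) +i* (series (fun n => Im (f n)) n).
  rewrite /series /=; elim: n => [|n IH]; first by rewrite !big_geq.
  rewrite !big_nat_recr//= IH.
  by case: (f n) => a b; simpc.
set l : C := limn (series (fun n => Re (f n))) +i* limn (series (fun n => Im (f n))).
suff h : (series (f : nat -> C^o) @ \oo --> (l : C^o))%classic.
  by rewrite /csum (cvg_lim _ h)//.
apply/cvgCP => e e0.
have e2 : 0 < e / 2 by rewrite divr_gt0.
have [N1 _ h1] := (cvgrPdist_lt _ _).1 cRe _ e2.
have [N2 _ h2] := (cvgrPdist_lt _ _).1 cIm _ e2.
exists (maxn N1 N2) => n; rewrite geq_max => /andP[n1 n2].
rewrite (le_lt_trans (normc_ReIm _))// [ltRHS]splitr sE /l; simpc => /=.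
by rewrite ltrD// distrC; [exact: h1|exact: h2].
Qed.

Lemma csum_tail K q f N : 0 <= q -> q < 1 -> geo K q f ->
  normc (csum f - \sum_(i < N) f i) <= K / (1 - q) * q ^+ N.
Proof.
move=> q0 q1 fq; have K0 := geo_ge0 fq.
apply/ler_addgt0Pl => e e0.
have /cvgCP/(_ e e0)[M hM] : (series (f : nat -> C^o) @ \oo --> (csum f : C^o))%classic.
  by apply: csum_cvg; exists K, q.
have := hM (M + N)%N (leq_addr _ _); rewrite /series /= big_mkord.
set S := \sum_(i < _) _ => SM.
rewrite (_ : _ - _ = (S - \sum_(i < N) f i) - (S - csum f)); last by ring.
rewrite (le_trans (normcBle _ _))// addrC lerD ?(ltW SM)//.
rewrite /S addnC big_split_ord /= addrAC subrr add0r.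
rewrite (le_trans (normc_sum _ _ _))//.
apply: (@le_trans _ _ (\sum_(i < M) K * q ^+ N * q ^+ i)).
  by apply: ler_sum => i _; rewrite -mulrA -exprD; exact: fq.
rewrite -mulr_sumr mulrAC ler_wpM2r ?exprn_ge0//.
by rewrite ler_wpM2l// geometric_sum_le.
Qed.

Lemma geometric_small q (e : R) : 0 <= q -> q < 1 -> 0 < e -> exists N, q ^+ N < e.
Proof.
move=> q0 q1 e0.
have /cvgrPdist_lt/(_ e e0) [N _ hN] : (GRing.exp q @ \oo --> (0 : R))%classic.
  by apply: cvg_expr; rewrite ger0_norm.
exists N; have := hN N (leqnn _); rewrite sub0r normrN ger0_norm// exprn_ge0//.
Qed.

Lemma geo_zero K q (z : C) : 0 <= q -> q < 1 ->
  (forall n, normc z <= K * q ^+ n) -> z = 0.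
Proof.
move=> q0 q1 h; apply/eqP; rewrite -normc_eq0 eq_le normc_ge0 andbT.
have K0 : 0 <= K by have := h 0%N; rewrite expr0 mulr1; apply: le_trans; exact: normc_ge0.
apply/ler_addgt0Pl => e e0; rewrite addr0.
have [|N hN] := @geometric_small q (e / (K + 1)) q0 q1.
  by rewrite divr_gt0// ltr_wpDl.
rewrite (le_trans (h N))//.
apply: (@le_trans _ _ ((K + 1) * (e / (K + 1)))).
  by rewrite ler_pM ?exprn_ge0 ?ler_wpDr// ltW.
by rewrite mulrC divfK// gt_eqF// ltr_wpDl.
Qed.

(** A sum is recognized by the geometric rate at which the partial sums approach it. *)
Lemma csum_unique K q f (l : C) : geometric_dominated f -> 0 <= q -> q < 1 ->
  (forall N, normc (l - \sum_(i < N) f i) <= K * q ^+ N) -> csum f = l.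
Proof.
move=> [K' [q' [q'0 q'1 fq]]] q0 q1 h; apply/subr0_eq.
have m0 : 0 <= Num.max q q' by rewrite le_max q0.
have m1 : Num.max q q' < 1 by rewrite gt_max q1.
have K0 : 0 <= K.
  by have := h 0%N; rewrite expr0 mulr1; apply: le_trans; exact: normc_ge0.
have K'0 : 0 <= K' / (1 - q').
  by rewrite divr_ge0 ?(geo_ge0 fq)// subr_ge0 ltW.
apply: (@geo_zero (K' / (1 - q') + K) (Num.max q q')) => // N.
rewrite (_ : _ - _ = (csum f - \sum_(i < N) f i) - (l - \sum_(i < N) f i)); last by ring.
rewrite (le_trans (normcBle _ _))// mulrDl lerD//.
  rewrite (le_trans (csum_tail N q'0 q'1 fq))// ler_wpM2l//.
  by rewrite lerXn2r ?nnegrE// le_max lexx orbT.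
rewrite (le_trans (h N))// ler_wpM2l//.
by rewrite lerXn2r ?nnegrE// le_max lexx.
Qed.

Lemma normc_csum K q f : 0 <= q -> q < 1 -> geo K q f ->
  normc (csum f) <= K / (1 - q).
Proof.
move=> q0 q1 fq; have := csum_tail 0 q0 q1 fq.
by rewrite big_ord0 subr0 expr0 mulr1.
Qed.

Lemma geometric_dominatedD f g : geometric_dominated f -> geometric_dominated g ->
  geometric_dominated (fun n => f n + g n).
Proof.
move=> [K [q [q0 q1 fq]]] [K' [q' [q'0 q'1 gq]]].
exists (K + K'), (Num.max q q'); split.
- by rewrite le_max q0.
- by rewrite gt_max q1.
move=> n; rewrite (le_trans (normcDle _ _))// mulrDl lerD//.
  rewrite (le_trans (fq n))// ler_wpM2l ?(geo_ge0 fq)//.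
  by rewrite lerXn2r ?nnegrE// le_max ?lexx ?q0.
rewrite (le_trans (gq n))// ler_wpM2l ?(geo_ge0 gq)//.
by rewrite lerXn2r ?nnegrE// le_max ?lexx ?q0 ?orbT.
Qed.

Lemma geometric_dominatedZ a f : geometric_dominated f ->
  geometric_dominated (fun n => a * f n).
Proof.
move=> [K [q [q0 q1 fq]]]; exists (normc a * K), q; split=> // n.
by rewrite normcME -mulrA ler_wpM2l ?normc_ge0.
Qed.

Lemma geometric_dominatedS f : geometric_dominated f ->
  geometric_dominated (fun n => f n.+1).
Proof.
move=> [K [q [q0 q1 fq]]]; exists (K * q), q; split=> // n.
by rewrite -mulrA -exprS.
Qed.

Lemma csumD f g : geometric_dominated f -> geometric_dominated g ->
  csum (fun n => f n + g n) = csum f + csum g.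
Proof.
move=> df dg; have [K [q [q0 q1 fq]]] := df; have [K' [q' [q'0 q'1 gq]]] := dg.
have m0 : 0 <= Num.max q q' by rewrite le_max q0.
apply: (@csum_unique (K / (1 - q) + K' / (1 - q')) (Num.max q q')) => //.
- exact: geometric_dominatedD.
- by rewrite gt_max q1.
move=> N; rewrite big_split /=.
rewrite (_ : _ - _ = (csum f - \sum_(i < N) f i) + (csum g - \sum_(i < N) g i)); last by ring.
rewrite (le_trans (normcDle _ _))// mulrDl lerD//.
  rewrite (le_trans (csum_tail N q0 q1 fq))// ler_wpM2l//.
    by rewrite divr_ge0 ?(geo_ge0 fq)// subr_ge0 ltW.
  by rewrite lerXn2r ?nnegrE// le_max lexx.
rewrite (le_trans (csum_tail N q'0 q'1 gq))// ler_wpM2l//.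
  by rewrite divr_ge0 ?(geo_ge0 gq)// subr_ge0 ltW.
by rewrite lerXn2r ?nnegrE// le_max lexx orbT.
Qed.

Lemma csumZ a f : geometric_dominated f -> csum (fun n => a * f n) = a * csum f.
Proof.
move=> df; have [K [q [q0 q1 fq]]] := df.
apply: (@csum_unique (normc a * (K / (1 - q))) q) => //.
  exact: geometric_dominatedZ.
move=> N; rewrite -mulr_sumr -mulrBr normcME -mulrA ler_wpM2l ?normc_ge0//.
exact: csum_tail.
Qed.

Lemma csum_recl f : geometric_dominated f -> csum f = f 0%N + csum (fun n => f n.+1).
Proof.
move=> df; have [K [q [q0 q1 fq]]] := df.
suff -> : csum (fun n => f n.+1) = csum f - f 0%N by rewrite addrC subrK.
apply: (@csum_unique (K / (1 - q) * q) q) => //; first exact: geometric_dominatedS.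
move=> N; have := csum_tail N.+1 q0 q1 fq.
rewrite big_ord_recl exprS mulrA => h; rewrite (le_trans _ h)//.
by rewrite opprD addrA.
Qed.

Lemma csum_split N f : geometric_dominated f ->
  csum f = \sum_(i < N) f i + csum (fun n => f (N + n)%N).
Proof.
elim: N f => [|N IH] f df; first by rewrite big_ord0 add0r.
rewrite csum_recl// IH; last exact: geometric_dominatedS.
by rewrite big_ord_recl addrA.
Qed.

Lemma finite_geometric_dominated N f : (forall n, (N <= n)%N -> f n = 0) ->
  geometric_dominated f.
Proof.
move=> f0; exists (\sum_(i < N) normc (f i) * 2 ^+ i), (2^-1); split.
- by rewrite invr_ge0.
- by rewrite invf_lt1// ltr1n.
move=> n; have [/f0 ->|nN] := leqP N n.
  rewrite normc0E mulr_ge0// ?exprn_ge0 ?invr_ge0//.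
  by apply: sumr_ge0 => i _; rewrite mulr_ge0 ?normc_ge0 ?exprn_ge0.
rewrite exprVn ler_pdivlMr ?exprn_gt0//.
rewrite (bigD1 (Ordinal nN))//= lerDl.
by apply: sumr_ge0 => i _; rewrite mulr_ge0 ?normc_ge0 ?exprn_ge0.
Qed.

Lemma csum0 : csum (fun=> 0) = 0.
Proof.
apply: (@csum_unique 0 0) => //; first exact: (@finite_geometric_dominated 0).
by move=> N; rewrite big1// subr0 normc0E mul0r.
Qed.

Lemma csum_fin N f : (forall n, (N <= n)%N -> f n = 0) ->
  csum f = \sum_(i < N) f i.
Proof.
move=> f0; rewrite (csum_split N); last exact: finite_geometric_dominated f0.
rewrite (_ : (fun n => f (N + n)%N) = fun=> 0) ?csum0 ?addr0//.
by apply/funext => n; rewrite f0// leq_addr.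
Qed.

Lemma csumN f : geometric_dominated f -> csum (fun n => - f n) = - csum f.
Proof.
move=> df; rewrite -mulN1r -csumZ//; congr csum.
by apply/funext => n; rewrite mulN1r.
Qed.

Lemma geometric_dominatedN f : geometric_dominated f -> geometric_dominated (fun n => - f n).
Proof. by move=> [K [q [q0 q1 fq]]]; exists K, q; split=> // n; rewrite normcNE. Qed.

(** The sum over the squares [0, N[ x [0, N[ determines both iterated sums, so
they agree. *)
Lemma csum_swap K p q (a : nat -> nat -> C) : 0 <= p -> p < 1 -> 0 <= q -> q < 1 ->
  (forall i j, normc (a i j) <= K * p ^+ i * q ^+ j) ->
  csum (fun i => csum (a i)) = csum (fun j => csum (fun i => a i j)).
Proof.
move=> p0 p1 q0 q1 aK.
have K0 : 0 <= K.
  have := aK 0%N 0%N; rewrite !expr0 !mulr1; apply: le_trans; exact: normc_ge0.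
have m0 : 0 <= Num.max p q by rewrite le_max p0.
have m1 : Num.max p q < 1 by rewrite gt_max p1.
have pN N : p ^+ N <= Num.max p q ^+ N by rewrite lerXn2r ?nnegrE// le_max lexx.
have qN N : q ^+ N <= Num.max p q ^+ N by rewrite lerXn2r ?nnegrE// le_max lexx orbT.
have half K' p' q' (b : nat -> nat -> C) : 0 <= K' -> 0 <= p' -> p' < 1 -> 0 <= q' -> q' < 1 ->
    (forall i j, normc (b i j) <= K' * p' ^+ i * q' ^+ j) -> forall N,
    normc (csum (fun i => csum (b i)) - \sum_(i < N) \sum_(j < N) b i j) <=
      K' / (1 - q') / (1 - p') * (p' ^+ N + q' ^+ N).
  move=> K'0 p'0 p'1 q'0 q'1 bK N.
  have ip : 0 < 1 - p' by rewrite subr_gt0.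
  have iq : 0 < 1 - q' by rewrite subr_gt0.
  have gb i : geo (K' * p' ^+ i) q' (b i) by move=> j; exact: bK.
  have gs : geo (K' / (1 - q')) p' (fun i => csum (b i)).
    by move=> i; rewrite mulrAC; exact: normc_csum.
  rewrite (_ : _ - _ = (csum (fun i => csum (b i)) - \sum_(i < N) csum (b i)) +
     \sum_(i < N) (csum (b i) - \sum_(j < N) b i j)); last by rewrite sumrB; ring.
  rewrite (le_trans (normcDle _ _))// mulrDr lerD//; first exact: csum_tail.
  rewrite (le_trans (normc_sum _ _ _))//.
  apply: (@le_trans _ _ (\sum_(i < N) K' / (1 - q') * q' ^+ N * p' ^+ i)).
    apply: ler_sum => i _; rewrite (le_trans (csum_tail N q'0 q'1 (gb i)))//.
    by rewrite le_eqVlt; apply/orP; left; apply/eqP; ring.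
  rewrite -mulr_sumr -[leRHS]mulrA [_^-1 * _]mulrC mulrA ler_wpM2l//.
    by rewrite !mulr_ge0 ?exprn_ge0// invr_ge0 (ltW iq).
  exact: geometric_sum_le.
have h1 := half K p q a K0 p0 p1 q0 q1 aK.
have h2 := half K q p (fun j i => a i j) K0 q0 q1 p0 p1
  (fun j i => eq_ind_r (fun x => _ <= x) (aK i j) (mulrAC K (q ^+ j) (p ^+ i))).
have ip : 0 <= (1 - p)^-1 by rewrite invr_ge0 subr_ge0 ltW.
have iq : 0 <= (1 - q)^-1 by rewrite invr_ge0 subr_ge0 ltW.
apply/subr0_eq.
apply: (@geo_zero (K / (1 - q) / (1 - p) * 2 + K / (1 - p) / (1 - q) * 2) (Num.max p q)) => // N.
have {}h1 := h1 N; have {}h2 := h2 N.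
rewrite exchange_big /= in h2.
set S := \sum_(i < N) _ in h1 h2.
rewrite (_ : _ - _ = (csum (fun i => csum (a i)) - S) -
   (csum (fun j => csum (fun i => a i j)) - S)); last by ring.
rewrite (le_trans (normcBle _ _))// mulrDl lerD//.
  rewrite (le_trans h1)// -[leRHS]mulrA ler_wpM2l//.
    by rewrite !mulr_ge0.
  by rewrite mulr_natl mulr2n lerD.
rewrite (le_trans h2)// -[leRHS]mulrA ler_wpM2l//.
  by rewrite !mulr_ge0.
by rewrite mulr_natl mulr2n lerD.
Qed.

(** Raising q above p makes the antidiagonal array again geometrically dominated
in both indices. *)
Lemma csum_antidiagonal K p q (a : nat -> nat -> C) :
  0 <= p -> p < 1 -> 0 <= q -> q < 1 ->
  (forall i j, normc (a i j) <= K * p ^+ i * q ^+ j) ->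
  csum (fun i => csum (a i)) = csum (fun m => \sum_(i < m.+1) a i (m - i)%N).
Proof.
move=> p0 p1 q0 q1 aK.
have K0 : 0 <= K.
  have := aK 0%N 0%N; rewrite !expr0 !mulr1; apply: le_trans; exact: normc_ge0.
have [q' [pq' qq' q'1]] : exists q', [/\ p < q', q < q' & q' < 1].
  have m1 : Num.max p q < 1 by rewrite gt_max p1.
  exists ((Num.max p q + 1) / 2); split; last by lra.
    by apply: (@le_lt_trans _ _ (Num.max p q)); [rewrite le_max lexx|lra].
  by apply: (@le_lt_trans _ _ (Num.max p q)); [rewrite le_max lexx orbT|lra].
have q'0 : 0 < q' by exact: le_lt_trans p0 pq'.
have q'0w := ltW q'0.
pose b i m := if (i <= m)%N then a i (m - i)%N else 0.
have aS i : csum (a i) = csum (b i).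
  rewrite [RHS](csum_split i); last first.
    exists (K * p ^+ i / q' ^+ i), q'; split=> //.
    move=> m; rewrite /b; case: leqP => im.
      rewrite (le_trans (aK _ _))//.
      rewrite -!mulrA ler_wpM2l// ler_wpM2l ?exprn_ge0//.
      rewrite -{2}(subnK im) exprD mulrCA [_^-1 * _]mulrC divff ?mulr1 ?gt_eqF ?exprn_gt0//.
      by rewrite lerXn2r ?nnegrE//; apply: ltW.
    by rewrite normc0E !mulr_ge0 ?invr_ge0 ?exprn_ge0// ltW.
  rewrite big1 ?add0r.
    by congr csum; apply/funext => j; rewrite /b leq_addr addKn.
  by move=> j _; rewrite /b leqNgt ltn_ord.
rewrite (_ : (fun i => csum (a i)) = fun i => csum (b i)); last by apply/funext.
rewrite (@csum_swap K (p / q') q').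
- congr csum; apply/funext => m; rewrite (@csum_fin m.+1).
    by apply: eq_bigr => i _; rewrite /b -ltnS ltn_ord.
  by move=> i mi; rewrite /b leqNgt mi.
- by rewrite divr_ge0// ltW.
- by rewrite ltr_pdivrMr ?mul1r.
- exact: ltW.
- by [].
move=> i m; rewrite /b; case: leqP => im; last first.
  by rewrite normc0E !mulr_ge0 ?exprn_ge0 ?mulr_ge0 ?invr_ge0.
rewrite (le_trans (aK _ _))// -!mulrA ler_wpM2l// exprMn -mulrA ler_wpM2l ?exprn_ge0//.
rewrite exprVn -{2}(subnK im) exprD mulrCA [_^-1 * _]mulrC divff ?mulr1 ?gt_eqF ?exprn_gt0//.
by rewrite lerXn2r ?nnegrE//; apply: ltW.
Qed.

End GeometricSums.

(** * Sequences whose generating function is meromorphic in a disc *)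

Section MeromorphicSequences.
Variable R : realType.
Local Notation C := R[i].
Implicit Types (h k v u : nat -> C) (r s t K : R).

Definition radius_ge r h := forall s, 0 < s -> s < r -> exists K, geo K s^-1 h.

Definition shl h : nat -> C := fun n => h n.+1.
Definition scal a h : nat -> C := fun n => a * h n.
Definition add h k : nat -> C := fun n => h n + k n.
Definition mul h k : nat -> C := fun n => h n * k n.
Definition sub_shl l h : nat -> C := fun n => h n.+1 - l * h n.

(** The sequences h whose generating function F(z) = h_0 + h_1 z + ... is meromorphic in
|z| < r with all poles in |z| >= s. Writing T for the shift shl, the sequence (T - l) h
has the generating function ((1 - l z) F(z) - h_0) / z, so each step clears a pole at
1 / l, and the bound on l keeps this pole out of |z| < s. The value s = 0 leaves the
poles unrestricted. *)
Inductive merom s r : (nat -> C) -> Prop :=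
| merom_base h of radius_ge r h : merom s r h
| merom_step l h of normc l * s <= 1 & merom s r (sub_shl l h) : merom s r h.

(** The power series v in the shift, v(T) = v_0 + v_1 T + v_2 T^2 + ..., applied to h. *)
Definition opT v h : nat -> C := fun n => csum (fun j => v j * h (n + j)%N).
Definition conv v u : nat -> C := fun m => \sum_(i < m.+1) v i * u (m - i)%N.

Lemma geo_le K s t h : 0 < t -> t <= s -> geo K s^-1 h -> geo K t^-1 h.
Proof.
move=> t0 ts hK n; have s0 := lt_le_trans t0 ts.
rewrite (le_trans (hK n))// ler_wpM2l ?(geo_ge0 hK)//.
by rewrite lerXn2r ?nnegrE ?invr_ge0 ?(ltW t0) ?(ltW s0)// lef_pV2.
Qed.

Lemma radius_ge_near s0 r h :
  (forall s, 0 < s -> s0 < s -> s < r -> exists K, geo K s^-1 h) -> s0 < r -> radius_ge r h.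
Proof.
move=> H s0r s sgt0 sr.
have [||| K hK] := H ((Num.max s s0 + r) / 2).
- by rewrite divr_gt0// addr_gt0// ?lt_max ?sgt0// (lt_trans sgt0).
- have : s0 <= Num.max s s0 by rewrite le_max lexx orbT.
  have : Num.max s s0 < r by rewrite gt_max sr.
  lra.
- have : Num.max s s0 < r by rewrite gt_max sr.
  lra.
exists K; apply: geo_le hK => //.
have : s <= Num.max s s0 by rewrite le_max lexx.
have : Num.max s s0 < r by rewrite gt_max sr.
lra.
Qed.

Lemma radius_ge_le r r' h : r <= r' -> radius_ge r' h -> radius_ge r h.
Proof. by move=> rr H s s0 sr; apply: H => //; exact: lt_le_trans rr. Qed.

Lemma geoD K K' q h k : geo K q h -> geo K' q k -> geo (K + K') q (add h k).
Proof.
move=> hK kK n; rewrite mulrDl (le_trans (normcDle _ _))// lerD//.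
Qed.

Lemma geoZ K q a h : geo K q h -> geo (normc a * K) q (scal a h).
Proof.
by move=> hK n; rewrite normcME -mulrA ler_wpM2l ?normc_ge0//; exact: hK.
Qed.

Lemma radius_geD r h k : radius_ge r h -> radius_ge r k -> radius_ge r (add h k).
Proof.
move=> H H' s s0 sr; have [K hK] := H s s0 sr; have [K' kK] := H' s s0 sr.
by exists (K + K'); exact: geoD.
Qed.

Lemma radius_geZ r a h : radius_ge r h -> radius_ge r (scal a h).
Proof.
move=> H s s0 sr; have [K hK] := H s s0 sr.
by exists (normc a * K); exact: geoZ.
Qed.

Lemma radius_ge_shl r h : radius_ge r h -> radius_ge r (shl h).
Proof.
move=> H s s0 sr; have [K hK] := H s s0 sr; exists (K / s) => n.
by rewrite -mulrA -exprS; exact: hK.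
Qed.

Lemma radius_ge_unshl r h : radius_ge r (shl h) -> radius_ge r h.
Proof.
move=> H s s0 sr; have [K hK] := H s s0 sr.
have K0 := geo_ge0 hK.
exists (normc (h 0%N) + K * s) => -[|n].
  by rewrite expr0 mulr1 lerDl mulr_ge0// ltW.
rewrite (le_trans (hK n))// exprS mulrA ler_wpM2r ?exprn_ge0 ?invr_ge0 ?(ltW s0)//.
by rewrite mulrDl mulfK ?gt_eqF// lerDr mulr_ge0 ?normc_ge0// invr_ge0 ltW.
Qed.

Lemma sub_shlE l h : sub_shl l h = add (shl h) (scal (- l) h).
Proof. by apply/funext => n; rewrite /sub_shl /add /scal mulNr. Qed.

Lemma radius_ge_sub_shl r l h : radius_ge r h -> radius_ge r (sub_shl l h).
Proof.
by move=> H; rewrite sub_shlE; apply: radius_geD; [exact: radius_ge_shl|exact: radius_geZ].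
Qed.

Lemma split_radius t s s0 x : 0 < t -> 0 < s -> 0 <= x -> x < t * s -> s0 < s ->
  exists t' s', [/\ 0 < t', t' < t, 0 < s' & s' < s] /\ s0 < s' /\ x < t' * s'.
Proof.
move=> t0 s_gt0 x0 xts s0s.
have xt : x / t < s by rewrite ltr_pdivrMr// mulrC.
have [s' [s's s0s' xs']] : exists s', [/\ s' < s, s0 < s' & x / t < s'].
  have m : Num.max s0 (x / t) < s by rewrite gt_max s0s.
  have m1 : s0 <= Num.max s0 (x / t) by rewrite le_max lexx.
  have m2 : x / t <= Num.max s0 (x / t) by rewrite le_max lexx orbT.
  by exists ((Num.max s0 (x / t) + s) / 2); split; lra.
have s'0 : 0 < s' by apply: le_lt_trans xs'; rewrite divr_ge0// ltW.
have xs : x / s' < t by rewrite ltr_pdivrMr// mulrC -ltr_pdivrMr.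
have xs0 : 0 <= x / s' by rewrite divr_ge0// ltW.
exists ((x / s' + t) / 2), s'; split; first by split=> //; lra.
by split=> //; rewrite -ltr_pdivrMr//; lra.
Qed.

Lemma radius_ge_mul r s h k : 0 < r -> 0 < s ->
  radius_ge r h -> radius_ge s k -> radius_ge (r * s) (mul h k).
Proof.
move=> r0 s0 H H' x x0 xrs.
have [r' [s' [[r'0 r'r s'0 s's] [_ xr's']]]] := split_radius r0 s0 (ltW x0) xrs s0.
have [K hK] := H r' r'0 r'r; have [K' kK] := H' s' s'0 s's.
exists (K * K'); apply: (@geo_le _ (r' * s')) => //; first exact: ltW.
move=> n; rewrite /mul normcME invfM exprMn mulrACA.
by rewrite ler_pM ?normc_ge0//.
Qed.

Lemma opT_geo K K' t s v h n : 0 < t -> 0 < s ->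
  geo K t^-1 v -> geo K' s^-1 h ->
  geo (K * K' * s^-1 ^+ n) (t * s)^-1 (fun j => v j * h (n + j)%N).
Proof.
move=> t0 s0 vK hK j; rewrite normcME.
apply: (@le_trans _ _ ((K * t^-1 ^+ j) * (K' * s^-1 ^+ (n + j)))).
  by rewrite ler_pM ?normc_ge0//.
by rewrite le_eqVlt invfM exprMn exprD; apply/orP; left; apply/eqP; ring.
Qed.

Lemma opT_dominated t s v h n : 0 < t -> 0 < s -> 1 < t * s ->
  radius_ge t v -> radius_ge s h ->
  geometric_dominated (fun j => v j * h (n + j)%N).
Proof.
move=> t0 s0 ts V H.
have [t' [s' [[t'0 t't s'0 s's] [_ ts']]]] := split_radius t0 s0 ler01 ts s0.
have [K vK] := V t' t'0 t't; have [K' hK] := H s' s'0 s's.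
exists (K * K' * s'^-1 ^+ n), (t' * s')^-1; split.
- by rewrite invr_ge0 mulr_ge0// ltW.
- by rewrite invf_lt1// mulr_gt0.
- exact: opT_geo.
Qed.

Lemma radius_ge_opT t s v h : 0 < t -> 0 < s -> 1 < t * s ->
  radius_ge t v -> radius_ge s h -> radius_ge s (opT v h).
Proof.
move=> t0 s_gt0 ts V H x x0 xs.
have [t' [s' [[t'0 t't s'0 s's] [xs' ts']]]] := split_radius t0 s_gt0 ler01 ts xs.
have [K vK] := V t' t'0 t't; have [K' hK] := H s' s'0 s's.
exists (K * K' / (1 - (t' * s')^-1)); apply: (@geo_le _ s') => //; first exact: ltW.
move=> n; rewrite mulrAC; apply: normc_csum.
- by rewrite invr_ge0 mulr_ge0// ltW.
- by rewrite invf_lt1// mulr_gt0.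
- exact: opT_geo.
Qed.

Lemma opTDr t s v h k : 0 < t -> 0 < s -> 1 < t * s ->
  radius_ge t v -> radius_ge s h -> radius_ge s k ->
  opT v (add h k) = add (opT v h) (opT v k).
Proof.
move=> t0 s0 ts V H H'; apply/funext => n; rewrite /opT /add.
rewrite -csumD; [|exact: opT_dominated V H|exact: opT_dominated V H'].
by congr csum; apply/funext => j; rewrite mulrDr.
Qed.

Lemma opTDl t s v u h : 0 < t -> 0 < s -> 1 < t * s ->
  radius_ge t v -> radius_ge t u -> radius_ge s h ->
  opT (add v u) h = add (opT v h) (opT u h).
Proof.
move=> t0 s0 ts V U H; apply/funext => n; rewrite /opT /add.
rewrite -csumD; [|exact: opT_dominated V H|exact: opT_dominated U H].
by congr csum; apply/funext => j; rewrite mulrDl.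
Qed.

Lemma opTZr t s v a h : 0 < t -> 0 < s -> 1 < t * s ->
  radius_ge t v -> radius_ge s h -> opT v (scal a h) = scal a (opT v h).
Proof.
move=> t0 s0 ts V H; apply/funext => n; rewrite /opT /scal.
rewrite -csumZ; last exact: opT_dominated V H.
by congr csum; apply/funext => j; rewrite mulrCA.
Qed.

Lemma opTZl t s v a h : 0 < t -> 0 < s -> 1 < t * s ->
  radius_ge t v -> radius_ge s h -> opT (scal a v) h = scal a (opT v h).
Proof.
move=> t0 s0 ts V H; apply/funext => n; rewrite /opT /scal.
rewrite -csumZ; last exact: opT_dominated V H.
by congr csum; apply/funext => j; rewrite mulrA.
Qed.

Lemma opT_shl v h : opT v (shl h) = shl (opT v h).
Proof. by []. Qed.

Lemma opT_sub_shl t s v l h : 0 < t -> 0 < s -> 1 < t * s ->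
  radius_ge t v -> radius_ge s h -> opT v (sub_shl l h) = sub_shl l (opT v h).
Proof.
move=> t0 s0 ts V H; rewrite !sub_shlE (opTDr t0 s0 ts V).
- by rewrite (opTZr _ t0 s0 ts V H).
- exact: radius_ge_shl.
- exact: radius_geZ.
Qed.

Lemma opT_recl t s v h : 0 < t -> 0 < s -> 1 < t * s ->
  radius_ge t v -> radius_ge s h ->
  opT v h = add (scal (v 0%N) h) (opT (shl v) (shl h)).
Proof.
move=> t0 s0 ts V H; apply/funext => n; rewrite /opT /add /scal.
rewrite csum_recl; last exact: opT_dominated V H.
rewrite addn0; congr (_ + csum _).
by apply/funext => j; rewrite /shl addnS.
Qed.

(** Products of power series in T become Cauchy products after summing along the
antidiagonals. *)
Lemma opT_conv t s v u h : 0 < t -> 0 < s -> 1 < t * s ->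
  radius_ge t v -> radius_ge t u -> radius_ge s h ->
  opT v (opT u h) = opT (conv v u) h.
Proof.
move=> t0 s0 ts V U H.
have [t' [s' [[t'0 t't s'0 s's] [_ ts']]]] := split_radius t0 s0 ler01 ts s0.
have [K vK] := V t' t'0 t't; have [K' uK] := U t' t'0 t't.
have [K'' hK] := H s' s'0 s's.
have q0 : 0 <= (t' * s')^-1 by rewrite invr_ge0 mulr_ge0// ltW.
have q1 : (t' * s')^-1 < 1 by rewrite invf_lt1// mulr_gt0.
apply/funext => n; rewrite /opT.
pose a i j := v i * u j * h (n + (i + j))%N.
transitivity (csum (fun i => csum (a i))).
  congr csum; apply/funext => i; rewrite /a -csumZ.
    by congr csum; apply/funext => j; rewrite -addnA mulrA.
  exact: opT_dominated U H.
rewrite (@csum_antidiagonal _ (K * K' * K'' * s'^-1 ^+ n) (t' * s')^-1 (t' * s')^-1)//.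
  congr csum; apply/funext => m; rewrite /conv mulr_suml.
  by apply: eq_bigr => i _; rewrite /a subnKC// -ltnS.
move=> i j; rewrite /a !normcME.
apply: (@le_trans _ _ ((K * t'^-1 ^+ i) * (K' * t'^-1 ^+ j) * (K'' * s'^-1 ^+ (n + (i + j))))).
  rewrite ler_pM ?mulr_ge0 ?normc_ge0//.
  by rewrite ler_pM ?normc_ge0//.
by rewrite le_eqVlt invfM !exprMn !exprD; apply/orP; left; apply/eqP; ring.
Qed.

Lemma merom_le s s' r r' h : s' <= s -> r' <= r -> merom s r h -> merom s' r' h.
Proof.
move=> ss rr; elim=> [{}h H|l {}h ls _ IH].
  by apply: merom_base; exact: radius_ge_le H.
by apply: merom_step IH; rewrite (le_trans _ ls)// ler_wpM2l ?normc_ge0.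
Qed.

(** Solving h_(n+1) = l h_n + k_n for h costs a geometric series of ratio |l| x, which
is less than 1 for x < s. *)
Lemma merom_radius s r h : 0 < s -> s <= r -> merom s r h -> radius_ge s h.
Proof.
move=> s0 sr; elim=> [{}h|l {}h ls _ IH]; first exact: radius_ge_le.
move=> x x0 xs; have [K hK] := IH x x0 xs.
have K0 := geo_ge0 hK.
have lx1 : normc l * x < 1.
  have [l0|l0] := eqVneq (normc l) 0; first by rewrite l0 mul0r.
  by rewrite (lt_le_trans _ ls)// ltr_pM2l// lt_def l0 normc_ge0.
have d0 : 0 < 1 - normc l * x by rewrite subr_gt0.
pose A := normc (h 0%N) + K * x / (1 - normc l * x).
have A0 : 0 <= A.
  by rewrite addr_ge0 ?normc_ge0// divr_ge0 ?mulr_ge0// ltW.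
exists A; elim=> [|n IHn].
  by rewrite expr0 mulr1 lerDl divr_ge0 ?mulr_ge0// ltW.
have -> : h n.+1 = sub_shl l h n + l * h n by rewrite /sub_shl subrK.
rewrite (le_trans (normcDle _ _))// normcME.
apply: (@le_trans _ _ (K * x^-1 ^+ n + normc l * (A * x^-1 ^+ n))).
  by rewrite lerD// ler_wpM2l ?normc_ge0.
rewrite exprS [leLHS](_ : _ = x^-1 ^+ n * (K + normc l * A)); last by ring.
have xn : 0 <= x^-1 ^+ n by rewrite exprn_ge0// invr_ge0 ltW.
rewrite [leRHS](_ : _ = x^-1 ^+ n * (x^-1 * A)); last by ring.
rewrite ler_wpM2l// ler_pdivlMl//.
have : K * x <= A * (1 - normc l * x).
  by rewrite /A mulrDl divfK ?gt_eqF// lerDr mulr_ge0 ?normc_ge0// ltW.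
lra.
Qed.

Lemma merom_sub_shl s r l h : merom s r h -> merom s r (sub_shl l h).
Proof.
elim=> [{}h H|l' {}h ls _ IH]; first by apply: merom_base; exact: radius_ge_sub_shl.
apply: (merom_step ls); rewrite (_ : sub_shl l' _ = sub_shl l (sub_shl l' h))//.
by apply/funext => n; rewrite /sub_shl; ring.
Qed.

Lemma meromD s r h k : merom s r h -> merom s r k -> merom s r (add h k).
Proof.
have sD l h' k' : sub_shl l (add h' k') = add (sub_shl l h') (sub_shl l k').
  by apply/funext => n; rewrite /sub_shl /add; ring.
move=> H; elim: H k => [{}h H|l {}h ls _ IH] k K.
  elim: K h H => [{}k H'|l {}k ls _ IH] h H.
    by apply: merom_base; exact: radius_geD.
  by apply: (merom_step ls); rewrite sD; apply: IH; exact: radius_ge_sub_shl.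
by apply: (merom_step ls); rewrite sD; apply: IH; exact: merom_sub_shl.
Qed.

Lemma meromZ s r a h : merom s r h -> merom s r (scal a h).
Proof.
elim=> [{}h H|l {}h ls _ IH]; first by apply: merom_base; exact: radius_geZ.
apply: (merom_step ls); rewrite (_ : sub_shl l _ = scal a (sub_shl l h))//.
by apply/funext => n; rewrite /sub_shl /scal; ring.
Qed.

Lemma merom_shl s r h : merom s r h -> merom s r (shl h).
Proof.
move=> /(merom_sub_shl 0); rewrite (_ : sub_shl 0 h = shl h)//.
by apply/funext => n; rewrite /sub_shl mul0r subr0.
Qed.

Lemma merom_unshl s r h : merom s r (shl h) -> merom s r h.
Proof.
move=> H; apply: (@merom_step _ _ 0); first by rewrite normc0E mul0r.
by rewrite (_ : sub_shl 0 h = shl h)//; apply/funext => n; rewrite /sub_shl mul0r subr0.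
Qed.

(** The product rule is (T - l m) (h k) = (T - l) h . T k + l h . (T - m) k. The cross terms
pair a factor without poles with one that has them, so their radius is at least the radius
of the first times the radius of the poles of the second. *)
Lemma merom_mul s1 r1 s2 r2 r h k : 0 < s1 -> s1 <= r1 -> 0 < s2 -> s2 <= r2 ->
  r <= s1 * r2 -> r <= r1 * s2 ->
  merom s1 r1 h -> merom s2 r2 k -> merom (s1 * s2) r (mul h k).
Proof.
move=> s10 sr1 s20 sr2 rl rr H.
have r10 : 0 < r1 by exact: lt_le_trans sr1.
have r20 : 0 < r2 by exact: lt_le_trans sr2.
elim: H k => [{}h H|l {}h ls Hl IH] k.
  move=> Kk; apply: merom_base; apply: (radius_ge_le rr).
  by apply: radius_ge_mul => //; exact: merom_radius Kk.
elim=> [{}k Kk|m {}k ms Kl IHk].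
  apply: merom_base; apply: (radius_ge_le rl); apply: radius_ge_mul => //.
  by apply: (merom_radius s10 sr1); exact: merom_step Hl.
apply: (@merom_step _ _ (l * m)).
  by rewrite normcME mulrACA mulr_ile1 ?mulr_ge0 ?normc_ge0// ltW.
rewrite (_ : sub_shl _ _ = add (mul (sub_shl l h) (shl k)) (scal l (mul h (sub_shl m k)))).
  apply: meromD; first by apply: IH; apply: merom_shl; exact: merom_step Kl.
  exact: meromZ.
by apply/funext => n; rewrite /sub_shl /add /mul /scal /shl; ring.
Qed.

(** The operator v(T) commutes with the factors T - l. *)
Lemma merom_opT t s r v h : 0 < t -> 0 < s -> s <= r -> 1 < t * s ->
  radius_ge t v -> merom s r h -> merom s r (opT v h).
Proof.
move=> t0 s0 sr ts V; have r0 := lt_le_trans s0 sr.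
have tr : 1 < t * r by rewrite (lt_le_trans ts)// ler_wpM2l// ltW.
elim=> [{}h H|l {}h ls Hl IH]; first by apply: merom_base; exact: radius_ge_opT V H.
apply: (merom_step ls); rewrite -(opT_sub_shl _ t0 s0 ts)//.
by apply: (merom_radius s0 sr); exact: merom_step Hl.
Qed.

Lemma radius_ge_geom l : l != 0 -> radius_ge (normc l) (fun j => l^-1 ^+ j.+1).
Proof.
move=> l0 x x0 xl; exists (normc l)^-1; apply: (@geo_le _ (normc l)) => //; first exact: ltW.
by move=> n; rewrite normcXE normcVE exprS.
Qed.

(** A decaying sequence has no poles inside its disc of convergence: there the
operator T - l is inverted by its Neumann series. *)
Lemma merom_prune s r h : 0 < s -> s <= r -> radius_ge s h -> merom 0 r h -> merom s r h.
Proof.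
move=> s0 sr + H; elim: H => [{}h H _|l {}h _ _ IH H]; first exact: merom_base.
have {}IH := IH (radius_ge_sub_shl l H).
have [ls|ls] := leP (normc l * s) 1; first exact: merom_step IH.
have l0 : l != 0.
  by apply/eqP => l0; move: ls; rewrite l0 normc0E mul0r ltr10.
have nl0 : 0 < normc l by rewrite normc_gt0.
have V := radius_ge_geom l0.
have -> : h = scal (-1) (opT (fun j => l^-1 ^+ j.+1) (sub_shl l h)).
  rewrite (opT_sub_shl _ nl0 s0 ls)// sub_shlE -opT_shl.
  rewrite (opT_recl nl0 s0 ls V H).
  apply/funext => n; rewrite /add /scal expr1.
  have -> : shl (fun j => l^-1 ^+ j.+1) = scal l^-1 (fun j => l^-1 ^+ j.+1).
    by apply/funext => j; rewrite /shl /scal exprS.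
  rewrite (opTZl _ nl0 s0 ls V); last exact: radius_ge_shl.
  by rewrite /scal; field.
by apply: meromZ; exact: (merom_opT nl0 s0 sr ls V IH).
Qed.

(** T^2 - l = (T - w) (T + w) with w^2 = l. *)
Lemma merom_sqr r l h : merom 0 r (fun n => h n.+2 - l * h n) -> merom 0 r h.
Proof.
move=> H; pose w := sqrtc l.
apply: (@merom_step _ _ w); first by rewrite mulr0.
apply: (@merom_step _ _ (- w)); first by rewrite mulr0.
rewrite (_ : sub_shl _ _ = fun n => h n.+2 - l * h n)//.
apply/funext => n; rewrite /sub_shl -[in RHS](sqr_sqrtc l) -/w; ring.
Qed.

Lemma radius_ge1 : radius_ge 1 (fun=> 1 : C).
Proof.
move=> s s0 s1; exists 1 => n; rewrite normc1E mul1r exprn_ege1//.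
by rewrite invf_ge1// ltW.
Qed.

(** The tail sums h_n + h_(n+1) + ..., that is, (1 - T)^-1 h. *)
Definition tau h : nat -> C := opT (fun=> 1) h.

Lemma merom_tau s r h : 1 < s -> s <= r -> merom s r h -> merom s r (tau h).
Proof.
move=> s1 sr; apply: (@merom_opT 1) => //; rewrite ?mul1r//.
  exact: lt_trans s1.
exact: radius_ge1.
Qed.

End MeromorphicSequences.

(** * Power series *)

Section PowerSeries.
Variable R : realType.
Local Notation C := R[i].
Implicit Types (c d e u v : nat -> C) (p z : C) (r s t K : R).

Definition ps c z : C := csum (fun n => c n * z ^+ n).

Lemma ps_geo K s c z : 0 < s -> geo K s^-1 c -> geo K (normc z / s) (fun n => c n * z ^+ n).
Proof.
move=> s0 cK n; rewrite normcME normcXE exprMn mulrCA [leLHS]mulrC.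
by rewrite ler_wpM2l ?exprn_ge0 ?normc_ge0.
Qed.

Lemma mid_radius r x : 0 <= x -> x < r -> exists s, [/\ 0 < s, s < r & x < s].
Proof. by move=> x0 xr; exists ((x + r) / 2); split; lra. Qed.

Lemma ps_dominated r c z : radius_ge r c -> normc z < r ->
  geometric_dominated (fun n => c n * z ^+ n).
Proof.
move=> H zr; have [s [s0 sr zs]] := mid_radius (normc_ge0 z) zr.
have [K cK] := H s s0 sr; exists K, (normc z / s); split.
- by rewrite divr_ge0 ?normc_ge0// ltW.
- by rewrite ltr_pdivrMr// mul1r.
- exact: ps_geo.
Qed.

Lemma ps_recl r c z : radius_ge r c -> normc z < r -> ps c z = c 0%N + z * ps (shl c) z.
Proof.
move=> H zr; rewrite /ps csum_recl; last exact: ps_dominated H zr.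
rewrite expr0 mulr1 -csumZ; last by apply: ps_dominated zr; exact: radius_ge_shl.
by congr (_ + csum _); apply/funext => n; rewrite exprS mulrCA.
Qed.

Lemma psD r c d z : radius_ge r c -> radius_ge r d -> normc z < r ->
  ps (add c d) z = ps c z + ps d z.
Proof.
move=> H H' zr; rewrite /ps -csumD; [|exact: ps_dominated H zr|exact: ps_dominated H' zr].
by congr csum; apply/funext => n; rewrite mulrDl.
Qed.

Lemma psZ r a c z : radius_ge r c -> normc z < r -> ps (scal a c) z = a * ps c z.
Proof.
move=> H zr; rewrite /ps -csumZ; last exact: ps_dominated H zr.
by congr csum; apply/funext => n; rewrite mulrA.
Qed.

Lemma ps0 r c : 0 < r -> radius_ge r c -> ps c 0 = c 0%N.
Proof. by move=> r0 H; rewrite (ps_recl H) ?normc0E// mul0r addr0. Qed.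

Lemma ps_conv r c d z : radius_ge r c -> radius_ge r d -> normc z < r ->
  ps (conv c d) z = ps c z * ps d z.
Proof.
move=> H H' zr; have [s [s0 sr zs]] := mid_radius (normc_ge0 z) zr.
have [K cK] := H s s0 sr; have [K' dK] := H' s s0 sr.
have q0 : 0 <= normc z / s by rewrite divr_ge0 ?normc_ge0// ltW.
have q1 : normc z / s < 1 by rewrite ltr_pdivrMr// mul1r.
pose a i j := c i * z ^+ i * (d j * z ^+ j).
transitivity (csum (fun i => csum (a i))); last first.
  have aE i : csum (a i) = ps d z * (c i * z ^+ i).
    by rewrite [RHS]mulrC; exact: (csumZ (c i * z ^+ i) (ps_dominated H' zr)).
  rewrite (_ : (fun i => csum (a i)) = fun i => ps d z * (c i * z ^+ i)); last exact/funext.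
  by rewrite (csumZ (ps d z) (ps_dominated H zr)) [RHS]mulrC.
rewrite (@csum_antidiagonal _ (K * K') (normc z / s) (normc z / s))//.
  congr csum; apply/funext => m; rewrite /conv mulr_suml; apply: eq_bigr => i _.
  by rewrite /a mulrACA -exprD subnKC// -ltnS.
move=> i j; rewrite /a normcME.
apply: (@le_trans _ _ ((K * (normc z / s) ^+ i) * (K' * (normc z / s) ^+ j))).
  by apply: ler_pM; rewrite ?normc_ge0//; exact: ps_geo.
by rewrite le_eqVlt; apply/orP; left; apply/eqP; ring.
Qed.

(** Near 0 the tail z * (c_1 + c_2 z + ...) is too small to cancel c_0, and a
vanishing c_0 can be divided out. *)
Lemma ps_eq0 r c : 0 < r -> radius_ge r c ->
  (forall z, z != 0 -> normc z < r -> ps c z = 0) -> c = fun=> 0.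
Proof.
move=> r0 H c0.
suff h n : c n = 0 /\ radius_ge r (fun m => c (n + m)%N) /\
    (forall z, z != 0 -> normc z < r -> ps (fun m => c (n + m)%N) z = 0).
  by apply/funext => n; have [] := h n.
have key d : radius_ge r d -> (forall z, z != 0 -> normc z < r -> ps d z = 0) -> d 0%N = 0.
  move=> D d0; apply/eqP; rewrite -normc_eq0; apply/negPn/negP => dn0.
  have [s [s0 sr _]] := mid_radius (lexx 0) r0.
  have [K dK] := radius_ge_shl D s0 sr.
  have K0 := geo_ge0 dK.
  pose x := Num.min (s / 2) (normc (d 0%N) / (4 * (K + 1))).
  have d00 : 0 < normc (d 0%N) by rewrite lt_def dn0 normc_ge0.
  have x0 : 0 < x.
    by rewrite /x lt_min !divr_gt0// mulr_gt0// ltr_wpDl.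
  have xs : x <= s / 2 by rewrite /x ge_min lexx.
  have xd : x <= normc (d 0%N) / (4 * (K + 1)) by rewrite /x ge_min lexx orbT.
  have nx : normc (x%:C : C) = x by rewrite normc_real gtr0_norm.
  have xr : normc (x%:C : C) < r by rewrite nx; lra.
  have xn : x%:C != 0 :> C by rewrite -normc_eq0 nx gt_eqF.
  have := d0 _ xn xr; rewrite (ps_recl D xr) => /eqP; rewrite addr_eq0 => /eqP dE.
  have : normc (d 0%N) <= x * (K / (1 - x / s)).
    rewrite dE normcNE normcME nx ler_wpM2l ?(ltW x0)//.
    rewrite -{2}nx; apply: normc_csum; last exact: ps_geo.
    - by rewrite nx divr_ge0// ltW.
    - by rewrite nx ltr_pdivrMr// mul1r; lra.
  have : K / (1 - x / s) <= 2 * K.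
    have xs2 : x / s <= 1 / 2 by rewrite ler_pdivrMr//; lra.
    rewrite ler_pdivrMr; last by lra.
    have : 0 <= K * (1 / 2 - x / s) by rewrite mulr_ge0// subr_ge0.
    lra.
  move=> h1 h2.
  have : normc (d 0%N) <= x * (2 * K) by rewrite (le_trans h2)// ler_wpM2l// ltW.
  have : x * (4 * (K + 1)) <= normc (d 0%N) by rewrite -ler_pdivlMr// mulr_gt0// ltr_wpDl.
  have : 0 <= x * K by rewrite mulr_ge0// ltW.
  lra.
elim: n => [|n [cn [Hn c0n]]]; first by split; [exact: (key c H c0)|].
have E : (fun m => c (n.+1 + m)%N) = shl (fun m => c (n + m)%N).
  by apply/funext => m; rewrite /shl addSnnS.
have Hn1 : radius_ge r (fun m => c (n.+1 + m)%N) by rewrite E; exact: radius_ge_shl.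
have c0n1 z : z != 0 -> normc z < r -> ps (fun m => c (n.+1 + m)%N) z = 0.
  move=> z0 zr; have := c0n z z0 zr; rewrite (ps_recl Hn zr) addn0 cn add0r -E.
  by move/eqP; rewrite mulf_eq0 (negbTE z0) => /eqP.
split; last by [].
by have := key _ Hn1 c0n1; rewrite addn0.
Qed.

Lemma ps_inj r c d : 0 < r -> radius_ge r c -> radius_ge r d ->
  (forall z, z != 0 -> normc z < r -> ps c z = ps d z) -> c = d.
Proof.
move=> r0 H H' cd.
have H'' := radius_geZ (-1) H'.
have : add c (scal (-1) d) = fun=> 0.
  apply: (@ps_eq0 r) => // [|z z0 zr]; first exact: radius_geD.
  by rewrite (psD H H'' zr) (psZ _ H' zr) cd// mulN1r subrr.
move=> E; apply/funext => n; have := congr1 (fun f => f n) E.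
by rewrite /add /scal mulN1r => /subr0_eq.
Qed.

(** The Taylor coefficients at p of the function with Taylor series c at 0. *)
Definition recenter c p : nat -> C :=
  fun k => ps (fun m => 'C(m + k, k)%:R * c (m + k)%N) p.

Lemma bin_le_exp x y m k : 0 <= x -> 0 <= y ->
  'C(m + k, k)%:R * x ^+ m * y ^+ k <= (x + y) ^+ (m + k) :> R.
Proof.
move=> x0 y0; rewrite exprDn.
have km : (k < (m + k).+1)%N by rewrite ltnS leq_addl.
rewrite (bigD1 (Ordinal km))//= addnK -mulrA mulr_natl lerDl.
by apply: sumr_ge0 => i _; rewrite mulrn_wge0// mulr_ge0 ?exprn_ge0.
Qed.

Lemma recenter_term K s c x y m k : geo K s^-1 c -> 0 <= x -> 0 <= y -> x + y <= s -> 0 < s ->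
  normc ('C(m + k, k)%:R * c (m + k)%N) * x ^+ m * y ^+ k <= K.
Proof.
move=> cK x0 y0 xys s0; have K0 := geo_ge0 cK.
rewrite normcME normc_nat.
apply: (@le_trans _ _ (K * s^-1 ^+ (m + k) * s ^+ (m + k))); last first.
  by rewrite -mulrA -exprMn mulVf ?gt_eqF// expr1n mulr1.
rewrite -!mulrA mulrCA !mulrA [X in X <= _](_ : _ = normc (c (m + k)%N) *
   ('C(m + k, k)%:R * x ^+ m * y ^+ k)); last by ring.
rewrite ler_pM ?normc_ge0 ?mulr_ge0 ?exprn_ge0//.
rewrite (le_trans (bin_le_exp _ _ x0 y0))// lerXn2r ?nnegrE ?addr_ge0//.
exact: ltW.
Qed.

Lemma radius_ge_recenter_coef r c k : radius_ge r c ->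
  radius_ge r (fun m => 'C(m + k, k)%:R * c (m + k)%N).
Proof.
move=> H x x0 xr; have [s [s0 sr xs]] := mid_radius (ltW x0) xr.
have [K cK] := H s s0 sr; exists (K / (s - x) ^+ k) => m.
have y0 : 0 < s - x by rewrite subr_gt0.
have h := recenter_term m k cK (ltW x0) (ltW y0) _ s0.
rewrite exprVn ler_pdivlMr ?exprn_gt0// ler_pdivlMr ?exprn_gt0//.
by apply: h; rewrite addrC subrK.
Qed.

Lemma recenter_split r c p y : radius_ge r c -> normc p + y < r -> 0 <= y ->
  exists K (p' y' : R), [/\ normc p < p', y < y', 0 <= K &
    forall k m, normc ('C(m + k, k)%:R * c (m + k)%N) * p' ^+ m * y' ^+ k <= K].
Proof.
move=> H pyr y0.
have py0 : 0 <= normc p + y by rewrite addr_ge0 ?normc_ge0.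
have [s [s0 sr pys]] := mid_radius py0 pyr.
have [K cK] := H s s0 sr.
exists K, (normc p + (s - (normc p + y)) / 2), (y + (s - (normc p + y)) / 2).
have p0 := normc_ge0 p.
split; [lra|lra|exact: geo_ge0 cK|move=> k m].
by apply: recenter_term => //; lra.
Qed.

Lemma recenter_bound K (p' y' a y : R) p m k : normc p < p' -> y < y' -> 0 <= y ->
  a * p' ^+ m * y' ^+ k <= K -> 0 <= a ->
  a * normc p ^+ m * y ^+ k <= K * (y / y') ^+ k * (normc p / p') ^+ m.
Proof.
move=> pp' yy' y0 aK a0.
have p'0 : 0 < p' by exact: le_lt_trans (normc_ge0 p) pp'.
have y'0 : 0 < y' by exact: le_lt_trans y0 yy'.
rewrite !exprMn !exprVn.
rewrite [leRHS](_ : _ = K * (y ^+ k * normc p ^+ m) / (p' ^+ m * y' ^+ k)); last first.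
  by field; rewrite !expf_neq0 ?gt_eqF.
rewrite ler_pdivlMr ?mulr_gt0 ?exprn_gt0//.
rewrite [leLHS](_ : _ = a * p' ^+ m * y' ^+ k * (y ^+ k * normc p ^+ m)); last by ring.
by rewrite ler_wpM2r// mulr_ge0 ?exprn_ge0 ?normc_ge0.
Qed.

Lemma radius_ge_recenter r c p : radius_ge r c -> radius_ge (r - normc p) (recenter c p).
Proof.
move=> H y y0 yr.
have pyr : normc p + y < r by rewrite addrC -ltrBrDr.
have [K [p' [y' [pp' yy' K0 h]]]] := recenter_split H pyr (ltW y0).
have p'0 : 0 < p' by exact: le_lt_trans (normc_ge0 p) pp'.
have y'0 : 0 < y' by exact: lt_trans y0 yy'.
have q1 : normc p / p' < 1 by rewrite ltr_pdivrMr// mul1r.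
exists (K / (1 - normc p / p')) => k.
rewrite exprVn ler_pdivlMr ?exprn_gt0//.
have g : geo (K * y^-1 ^+ k) (normc p / p') (fun m => 'C(m + k, k)%:R * c (m + k)%N * p ^+ m).
  move=> m; have := recenter_bound pp' yy' (ltW y0) (h k m) (normc_ge0 _).
  rewrite -normcXE -normcME -ler_pdivlMr ?exprn_gt0// => /le_trans; apply.
  set q := normc p / p' in q1 *.
  have qm : 0 <= q ^+ m by rewrite exprn_ge0// divr_ge0 ?normc_ge0// ltW.
  rewrite [leLHS](_ : _ = K * y'^-1 ^+ k * q ^+ m); last first.
    by rewrite exprMn !exprVn; field; rewrite !expf_neq0 ?gt_eqF.
  rewrite ler_wpM2r// ler_wpM2l//.
  by rewrite lerXn2r ?nnegrE ?invr_ge0 ?(ltW y0) ?(ltW y'0)// lef_pV2 ?posrE// ltW.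
have := normc_csum _ q1 g => /(_ (divr_ge0 (normc_ge0 _) (ltW p'0))).
rewrite -ler_pdivlMr ?exprn_gt0// => /le_trans; apply.
by rewrite -exprVn mulrAC.
Qed.

(** The powers of p + (z - p) are expanded by the binomial theorem, and the resulting
double series, which is absolutely dominated, is summed in the other order. *)
Lemma ps_recenter r c p z : radius_ge r c -> normc p + normc (z - p) < r ->
  ps c z = ps (recenter c p) (z - p).
Proof.
move=> H pyr; set y := z - p in pyr *.
have -> : z = p + y by rewrite /y addrC subrK.
have [K [p' [y' [pp' yy' K0 h]]]] := recenter_split H pyr (normc_ge0 _).
have p'0 : 0 < p' by exact: le_lt_trans (normc_ge0 p) pp'.
have y'0 : 0 < y' by exact: le_lt_trans (normc_ge0 y) yy'.
pose a k m := 'C(m + k, k)%:R * c (m + k)%N * p ^+ m * y ^+ k.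
have E k : recenter c p k * y ^+ k = csum (a k).
  rewrite mulrC -csumZ.
    by congr csum; apply/funext => m; rewrite mulrC.
  apply: (@ps_dominated r); first exact: radius_ge_recenter_coef.
  by apply: le_lt_trans pyr; rewrite lerDl normc_ge0.
rewrite /ps (_ : (fun n => recenter c p n * y ^+ n) = fun k => csum (a k)); last exact/funext.
rewrite (@csum_antidiagonal _ K (normc y / y') (normc p / p')).
- congr csum; apply/funext => n; rewrite exprDn mulr_sumr; apply: eq_bigr => i _.
  by rewrite /a subnK -1?ltnS// -mulr_natl; ring.
- by rewrite divr_ge0 ?normc_ge0// ltW.
- by rewrite ltr_pdivrMr// mul1r.
- by rewrite divr_ge0 ?normc_ge0// ltW.
- by rewrite ltr_pdivrMr// mul1r.
move=> k m; rewrite /a normcME normcXE normcME normcXE.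
exact: (recenter_bound pp' yy' (normc_ge0 y) (h k m) (normc_ge0 _)).
Qed.

(** * Cauchy estimates *)

Lemma unity_root_norm N (w : C) : (0 < N)%N -> w ^+ N = 1 -> normc w = 1.
Proof.
move=> N0 wN; have := congr1 (@normc R) wN; rewrite normcXE normc1E => /eqP.
by rewrite pexpr_eq1 ?normc_ge0// => /eqP.
Qed.

Lemma complex_prim_root N : (0 < N)%N -> exists w : C, N.-primitive_root w.
Proof.
move=> N0; pose p : {poly C} := 'X^N - 1.
have [r Dp] := closed_field_poly_normal p.
move: Dp; rewrite /p (monicP _) ?monicXnsubC// scale1r => Dp.
have rN : all N.-unity_root r by apply/allP => z; rewrite -root_prod_XsubC -Dp.
have sz_r : (N < (size r).+1)%N.
  by rewrite -(size_prod_XsubC r id) -Dp size_XnsubC.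
have [|z] := hasP (cyclic.has_prim_root N0 rN _ sz_r); last by exists z.
by rewrite -separable.separable_prod_XsubC -Dp cyclotomic.separable_Xn_sub_1// pnatr_eq0 -lt0n.
Qed.

Lemma unity_root_sum N (w : C) k m : N.-primitive_root w -> (k < N)%N -> (m < N)%N ->
  \sum_(j < N) (w ^+ j) ^+ m * (w ^+ j) ^- k = if m == k then N%:R else 0.
Proof.
move=> wN kN mN; have N0 : (0 < N)%N by exact: leq_ltn_trans kN.
have w0 : w != 0.
  by rewrite -normc_eq0 (unity_root_norm N0 (prim_expr_order wN)) oner_eq0.
have [->|mk] := eqVneq m k.
  rewrite (eq_bigr (fun=> 1)) ?sumr_const ?card_ord// => j _.
  by rewrite divff// !expf_neq0.
pose x := w ^+ m / w ^+ k.
have xN : x ^+ N = 1.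
  by rewrite exprMn exprVn -!exprM ![(_ * N)%N]mulnC !exprM (prim_expr_order wN) !expr1n divr1.
have x1 : x != 1.
  apply: contra mk => /eqP x1; apply/eqP.
  have : w ^+ m = w ^+ k by rewrite -[RHS]mul1r -x1 divfK// expf_neq0.
  by move/eqP; rewrite (eq_prim_root_expr wN) !modn_small// => /eqP.
rewrite (eq_bigr (fun j : 'I_N => x ^+ j)); last first.
  by move=> j _; rewrite /x exprMn exprVn -!exprM ![(j * _)%N]mulnC.
apply/eqP; have := subrX1 x N; rewrite xN subrr => /esym/eqP.
by rewrite mulf_eq0 subr_eq0 (negbTE x1).
Qed.

(** Averaging over the N-th roots of unity isolates the k-th coefficient of the
part of degree less than N; the rest tends to 0 with N. *)
Lemma cauchy_estimate t c M : radius_ge t c ->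
  (forall z, normc z < t -> normc (ps c z) <= M) ->
  forall s k, 0 < s -> s < t -> normc (c k) * s ^+ k <= M.
Proof.
move=> H cM s k s_gt0 st.
have [s' [s'0 s't ss']] := mid_radius (ltW s_gt0) st.
have [K cK] := H s' s'0 s't.
have q0 : 0 <= s / s' by rewrite divr_ge0 ?ltW.
have q1 : s / s' < 1 by rewrite ltr_pdivrMr// mul1r.
have K0 := geo_ge0 cK.
apply/ler_addgt0Pl => e e0.
have L0 : 0 < K / (1 - s / s') + 1 by rewrite ltr_wpDl// divr_ge0// subr_ge0 ltW.
have [N0 hN0] : exists N, (s / s') ^+ N < e / (K / (1 - s / s') + 1).
  by apply: geometric_small => //; rewrite divr_gt0.
pose N := (N0 + k.+1)%N.
have kN : (k < N)%N by rewrite /N addnS ltnS leq_addl.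
have N_gt0 : (0 < N)%N by exact: leq_ltn_trans kN.
have [w wN] := complex_prim_root N_gt0.
have nw j : normc (w ^+ j) = 1.
  by rewrite normcXE (unity_root_norm N_gt0 (prim_expr_order wN)) expr1n.
pose z j : C := s%:C * w ^+ j.
have nz j : normc (z j) = s by rewrite normcME nw mulr1 normc_real gtr0_norm.
pose P j : C := \sum_(m < N) c m * z j ^+ m.
have tailN : (s / s') ^+ N * (K / (1 - s / s')) <= e.
  apply: (@le_trans _ _ (e / (K / (1 - s / s') + 1) * (K / (1 - s / s') + 1))).
    apply: ler_pM; rewrite ?exprn_ge0// ?divr_ge0// ?subr_ge0 ?(ltW q1)//.
      rewrite (le_trans _ (ltW hN0))// /N exprD ler_piMr ?exprn_ge0//.
      by rewrite exprn_ile1// ltW.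
    by rewrite lerDl.
  by rewrite divfK// gt_eqF.
have PM j : normc (P j) <= e + M.
  have hz : normc (z j) < t by rewrite nz.
  have g := ps_geo (z j) s'0 cK; rewrite nz in g.
  have := csum_tail N q0 q1 g; rewrite -/(ps c (z j)) -/(P j) mulrC => tj.
  have -> : P j = ps c (z j) - (ps c (z j) - P j) by ring.
  rewrite (le_trans (normcBle _ _))// addrC lerD//; last exact: cM.
  exact: le_trans tailN.
have avg : N%:R * (c k * s%:C ^+ k) = \sum_(j < N) P j * (w ^+ j) ^- k.
  under eq_bigr => j _ do rewrite /P mulr_suml.
  rewrite exchange_big /= (bigD1 (Ordinal kN))//= [X in _ + X]big1 ?addr0; last first.
    move=> m mk; rewrite (eq_bigr (fun j : 'I_N => c m * s%:C ^+ m * ((w ^+ j) ^+ m * (w ^+ j) ^- k))).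
      rewrite -mulr_sumr unity_root_sum// ifF ?mulr0//.
      by apply/negbTE; apply: contra mk => /eqP mk; apply/eqP/val_inj.
    by move=> j _; rewrite /z exprMn; ring.
  rewrite (eq_bigr (fun j : 'I_N => c k * s%:C ^+ k * ((w ^+ j) ^+ k * (w ^+ j) ^- k))).
    by rewrite -mulr_sumr unity_root_sum// eqxx mulrC.
  by move=> j _; rewrite /z exprMn; ring.
have NR : 0 < N%:R :> R by rewrite ltr0n.
rewrite -(ler_pM2l NR) -{1}(normc_nat R N) -[s](gtr0_norm s_gt0) -normc_real -normcXE -!normcME avg.
rewrite (le_trans (normc_sum _ _ _))// mulr_natl -[X in _ *+ X](card_ord N) -sumr_const.
apply: ler_sum => j _; rewrite normcME normcVE normcXE nw expr1n invr1 mulr1.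
exact: PM.
Qed.

Lemma linear_geometric_bounded q : 0 <= q -> q < 1 ->
  exists K, forall n, n.+1%:R * q ^+ n <= K :> R.
Proof.
move=> q0 q1; have [->|q_neq0] := eqVneq q 0.
  by exists 1 => -[|n]; rewrite ?expr0 ?mulr1// exprS mul0r mulr0 ler01.
have q_gt0 : 0 < q by rewrite lt_def q_neq0.
pose e := q^-1 - 1.
have e0 : 0 < e by rewrite /e subr_gt0 invf_gt1.
exists (1 + e^-1) => n.
rewrite -[q]invrK exprVn ler_pdivrMr ?exprn_gt0 ?invr_gt0//.
have -> : q^-1 = 1 + e by rewrite /e addrC subrK.
have bern : 1 + n%:R * e <= (1 + e) ^+ n.
  elim: n => [|n IHn]; first by rewrite expr0 mul0r addr0.
  rewrite exprS; apply: (@le_trans _ _ ((1 + e) * (1 + n%:R * e))).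
    have : 0 <= n%:R * e * e by rewrite !mulr_ge0// ltW.
    rewrite -natr1; lra.
  by rewrite ler_wpM2l// addr_ge0// ltW.
apply: (@le_trans _ _ ((1 + e^-1) * (1 + n%:R * e))).
  have : 0 <= n%:R * e by rewrite mulr_ge0// ltW.
  have : 0 < e^-1 by rewrite invr_gt0.
  have -> : (1 + e^-1) * (1 + n%:R * e) = 1 + n%:R * e + e^-1 + n%:R * (e^-1 * e) by ring.
  rewrite mulVf ?gt_eqF// -natr1; lra.
by rewrite ler_wpM2l// addr_ge0// ltW// invr_gt0.
Qed.

(** Every Taylor coefficient at every p with |p| < t is a power series in p to
which Cauchy's estimate applies; by the binomial theorem these estimates add up to
convergence beyond t. *)
Lemma radius_extend t del M c : 0 < t -> 0 < del -> radius_ge t c ->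
  (forall p k, normc p < t -> normc (recenter c p k) <= M * del^-1 ^+ k) ->
  radius_ge (t + del) c.
Proof.
move=> t0 d0 H cM; apply: (@radius_ge_near _ del) => [x x0 dx xtd|]; last by rewrite ltrDr.
have [t1 [t10 t1t xt1]] : exists t1, [/\ 0 < t1, t1 < t & x < t1 + del].
  by exists ((x - del + t) / 2); split; lra.
have M0 : 0 <= M.
  have := cM 0 0%N; rewrite normc0E expr0 mulr1 => /(_ t0); apply: le_trans.
  exact: normc_ge0.
have est n : normc (c n) * (t1 + del) ^+ n <= n.+1%:R * M.
  have -> : n.+1%:R * M = \sum_(k < n.+1) M by rewrite sumr_const card_ord mulr_natl.
  rewrite exprDn mulr_sumr.
  apply: ler_sum => k _; have kn : (k <= n)%N by rewrite -ltnS.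
  have := cauchy_estimate (radius_ge_recenter_coef k H)
    (fun z zt => cM z k zt) (n - k)%N t10 t1t.
  rewrite subnK// normcME normc_nat exprVn ler_pdivlMr ?exprn_gt0//.
  by apply: le_trans; rewrite -mulr_natl le_eqVlt; apply/orP; left; apply/eqP; ring.
have td : 0 < t1 + del by rewrite addr_gt0.
have [||K hK] := @linear_geometric_bounded (x / (t1 + del)).
- by rewrite divr_ge0// ltW.
- by rewrite ltr_pdivrMr// mul1r.
exists (K * M) => n; rewrite exprVn ler_pdivlMr ?exprn_gt0//.
have h := est n; rewrite -ler_pdivlMr ?exprn_gt0// in h.
apply: (@le_trans _ _ (n.+1%:R * M / (t1 + del) ^+ n * x ^+ n)).
  by rewrite ler_wpM2r// exprn_ge0// ltW.
rewrite [leLHS](_ : _ = n.+1%:R * (x / (t1 + del)) ^+ n * M); last first.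
  by rewrite exprMn exprVn; ring.
by rewrite ler_wpM2r.
Qed.

End PowerSeries.

(** * Meromorphic functions and their Taylor coefficients *)

Section Continuation.
Variable R : realType.
Local Notation C := R[i].
Implicit Types (c d e u v : nat -> C) (p q z : C) (r s t K : R) (F G : C -> C).

Definition analytic_at G p := exists d (del : R), [/\ 0 < del, radius_ge del d &
  forall z, normc (z - p) < del -> G z = ps d (z - p)].

Definition punctured_analytic_at G p := exists d (del : R), [/\ 0 < del, radius_ge del d &
  forall z, z != p -> normc (z - p) < del -> G z = ps d (z - p)].

Lemma disc_compact s : compact ([set z : C^o | normc z <= s])%classic.
Proof.
pose f (xy : R * R) : C^o := xy.1 +i* xy.2.
have cf : continuous f.
  move=> [x y]; apply/cvgrPdist_lt => e e0.
  have [d d0 ->] : exists2 e' : R, 0 < e' & e = e'%:C.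
    by move: e0; case: e => a b; rewrite ltcE /= => /andP[/eqP -> a0]; exists a.
  have d2 : 0 < d / 2 by rewrite divr_gt0.
  exists (ball x (d / 2), ball y (d / 2)); first by split; exact: nbhsx_ballx.
  move=> [x' y'] [/= xx' yy'].
  rewrite -[`|_|]/(normc (f (x, y) - f (x', y')))%:C ltcR.
  rewrite (le_lt_trans (normc_ReIm _))// /f; simpc => /=.
  by rewrite [ltRHS]splitr ltrD.
have cK : compact (f @` (`[- s, s] `*` `[- s, s]))%classic.
  apply: continuous_compact; first exact: continuous_subspaceT.
  by apply: compact_setX; exact: segment_compact.
apply: subclosed_compact cK _.
  rewrite -openC openE => z /= /negP; rewrite -ltNge => sz.
  apply/nbhsCP; exists (normc z - s); first by rewrite subr_gt0.
  move=> w wz; apply/negP; rewrite -ltNge.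
  have := normc_ge_dist z w; rewrite normc_distC; lra.
move=> z /= zs; exists (Re z, Im z) => /=; last by case: z zs.
rewrite !in_itv /= -!ler_norml.
by split; apply: le_trans zs; [exact: normc_Re|exact: normc_Im].
Qed.

(** Compactness: a directed family of properties that holds locally near each
point of a closed disc holds uniformly on the disc. *)
Lemma disc_uniform (I : choiceType) (P : I -> C -> Prop) (join : I -> I -> I) (i0 : I) s :
  (forall i j q, P i q -> P (join i j) q) -> (forall i j q, P j q -> P (join i j) q) ->
  (forall p, normc p <= s -> exists i (d : R), 0 < d /\ forall q, normc (q - p) < d -> P i q) ->
  exists i, forall q, normc q <= s -> P i q.
Proof.
move=> Pl Pr loc; have := @disc_compact s; rewrite compact_cover.
pose f (i : I) : set C^o := interior ([set q : C^o | P i q])%classic.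
move=> /(_ I setT f) [||D _ Dcov].
- by move=> i _; exact: open_interior.
- move=> p /= ps; have [i [d [d0 Pi]]] := loc p ps.
  by exists i => //; apply/nbhsCP; exists d.
exists (foldr join i0 (finmap.enum_fset D)) => q qs.
have [i /= iD fi] := Dcov q qs.
have Piq : P i q by exact: (interior_subset fi).
have {}iD : i \in finmap.enum_fset D by [].
elim: (finmap.enum_fset D) iD => //= j l IH; rewrite inE => /orP[/eqP <-|/IH].
  exact: Pl.
exact: Pr.
Qed.

(** A single n bounds the size and the growth rate of all the local expansions and the
inverse of their radii; expansions at nearby centers come from recentering. *)
Lemma analytic_uniform G s : (forall p, normc p <= s -> analytic_at G p) ->
  exists n : nat, forall q, normc q <= s -> exists d, geo n%:R n.+1%:R d /\
    forall z, normc (z - q) < n.+1%:R^-1 -> G z = ps d (z - q).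
Proof.
move=> an.
pose P n q := exists d, geo n%:R n.+1%:R d /\
    forall z, normc (z - q) < n.+1%:R^-1 -> G z = ps d (z - q).
have mono n m q : (n <= m)%N -> P n q -> P m q.
  move=> nm [d [dn Gd]]; exists d; split=> [k|z zq].
    rewrite (le_trans (dn k))// ler_pM ?ler0n ?exprn_ge0 ?ler0n//; first by rewrite ler_nat.
    by rewrite lerXn2r ?nnegrE ?ler0n// ler_nat.
  apply: Gd; apply: (lt_le_trans zq).
  by rewrite lef_pV2 ?posrE ?ltr0n// ler_nat.
apply: (@disc_uniform _ P maxn 0%N) => [i j q|i j q|p ps0].
- by apply: mono; exact: leq_maxl.
- by apply: mono; exact: leq_maxr.
have [d [del [del0 H Gd]]] := an p ps0.
have s0 : 0 < 3 * del / 4 by rewrite divr_gt0// mulr_gt0.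
have sd : 3 * del / 4 < del by lra.
have [K dK] := H _ s0 sd; have K0 := geo_ge0 dK.
have K2 : 0 <= 2 * K + 4 / del by rewrite addr_ge0 ?mulr_ge0 ?invr_ge0 ?(ltW del0).
have := archi_boundP K2; set n := Num.bound _; set X := 4 / del => nK.
have X0 : 0 <= X by rewrite mulr_ge0 ?invr_ge0 ?(ltW del0).
have nK1 : 2 * K <= n%:R by lra.
have nK2 : X <= n.+1%:R by rewrite -natr1; lra.
have nK3 : n.+1%:R^-1 <= del / 4.
  by rewrite -[leRHS]invrK invf_div lef_pV2 ?posrE ?ltr0n// divr_gt0.
exists n, (del / 4); split=> [|q qp]; first by rewrite divr_gt0.
exists (recenter d (q - p)); split=> [k|z zq].
  have q1 : (2^-1 : R) < 1 by rewrite invf_lt1// ltr1n.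
  have q0 : (0 : R) <= 2^-1 by rewrite invr_ge0.
  apply: (@le_trans _ _ (2 * K * (4 / del) ^+ k)); last first.
    rewrite ler_pM ?mulr_ge0 ?exprn_ge0 ?divr_ge0 ?(ltW del0)//.
    by rewrite lerXn2r ?nnegrE ?ler0n// divr_ge0// ltW.
  rewrite [leRHS](_ : _ = K * (4 / del) ^+ k / (1 - 2^-1)); last by field.
  apply: normc_csum => // m.
  have d2 : 0 <= del / 2 by rewrite divr_ge0// ltW.
  have d4 : 0 <= del / 4 by rewrite divr_ge0// ltW.
  have d24 : del / 2 + del / 4 <= 3 * del / 4 by lra.
  have := recenter_term m k dK d2 d4 d24 s0.
  rewrite -ler_pdivlMr ?exprn_gt0 ?divr_gt0// -exprVn invf_div => h.
  rewrite normcME normcXE; apply: le_trans (ler_wpM2r _ h); last by rewrite exprn_ge0.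
  rewrite -mulrA ler_wpM2l ?normc_ge0// -exprMn.
  by rewrite lerXn2r ?nnegrE ?normc_ge0//; move: (ltW qp); lra.
have {}zq := lt_le_trans zq nK3.
rewrite (Gd z); last first.
  have -> : z - p = (z - q) + (q - p) by ring.
  by rewrite (le_lt_trans (normcDle _ _))//; lra.
have zE : z - q = (z - p) - (q - p) by ring.
rewrite zE; apply: ps_recenter H _.
by rewrite -zE; lra.
Qed.

(** The Taylor series at 0 of a function that is analytic in a disc converges in
the whole disc: by compactness the local expansions have a common radius and a
common bound, so that the radius of convergence grows by a fixed amount as long as
it has not reached the boundary. *)
Lemma taylor_radius G rho r0 c : 0 < r0 -> radius_ge r0 c ->
  (forall z, normc z < r0 -> G z = ps c z) ->
  (forall p, normc p < rho -> analytic_at G p) -> radius_ge rho c.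
Proof.
move=> r00 H Gc an.
suff h s : 0 < s -> s < rho -> radius_ge s c.
  move=> x x0 xr; have [s [s0 sr xs]] := mid_radius (ltW x0) xr.
  exact: h xs.
move=> s0 srho.
have [|n hn] := @analytic_uniform G s.
  by move=> p ps0; apply: an; exact: le_lt_trans srho.
pose del : R := n.+1%:R^-1.
have del0 : 0 < del by rewrite invr_gt0 ltr0n.
suff ext j : radius_ge (Num.min (r0 + j%:R * del) s) c /\
    (forall z, normc z < Num.min (r0 + j%:R * del) s -> G z = ps c z).
  have sd0 : 0 <= s / del by rewrite divr_ge0 ?ltW.
  have := archi_boundP sd0; set j := Num.bound _ => sj.
  have [+ _] := ext j; rewrite min_r//.
  apply: (@le_trans _ _ (j%:R * del)); last by rewrite lerDr ltW.
  by rewrite -ler_pdivrMr// ltW.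
elim: j => [|j [IH1 IH2]].
  rewrite mul0r addr0; split; first by apply: radius_ge_le H; rewrite ge_min lexx.
  by move=> z zr; apply: Gc; rewrite (lt_le_trans zr)// ge_min lexx.
set t := Num.min (r0 + j%:R * del) s in IH1 IH2.
have t0 : 0 < t by rewrite lt_min s0 andbT ltr_wpDr// mulr_ge0// ltW.
have ts : t <= s by rewrite ge_min lexx orbT.
have expand p : normc p < t -> geo n%:R del^-1 (recenter c p) /\
    forall z, normc (z - p) < del -> G z = ps (recenter c p) (z - p).
  move=> pt; have [d [dn Gd]] := hn p (le_trans (ltW pt) ts).
  suff -> : recenter c p = d by rewrite /del invrK.
  have m0 : 0 < Num.min del (t - normc p) by rewrite lt_min del0 subr_gt0.
  have D : radius_ge del d.
    move=> x x0 xd; exists n%:R; apply: (@geo_le _ _ del) => //; first exact: ltW.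
    by rewrite /del invrK.
  apply: (ps_inj m0).
  - apply: (radius_ge_le _ (radius_ge_recenter IH1)).
    by rewrite ge_min lexx orbT.
  - by apply: radius_ge_le D; rewrite ge_min lexx.
  move=> y _; rewrite lt_min => /andP[yd yt].
  have yE : y = (y + p) - p by rewrite addrK.
  rewrite {1}yE -(ps_recenter IH1); last by rewrite -yE; lra.
  rewrite -IH2; first by rewrite Gd -yE.
  by rewrite (le_lt_trans (normcDle _ _))//; lra.
have Ht : radius_ge (t + del) c.
  apply: (@radius_extend _ t del n%:R) => // p k pt.
  by have [g _] := expand p pt; exact: g.
have tj : Num.min (r0 + j.+1%:R * del) s <= t + del.
  rewrite /t addr_minl le_min !ge_min; apply/andP; split.
    by rewrite -natr1 mulrDl mul1r addrA lexx.
  by rewrite lerDl (ltW del0) orbT.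
split=> [|z zj]; first exact: radius_ge_le Ht.
have zt : normc z < t + del by exact: lt_le_trans tj.
have [/IH2//|tz] := ltP (normc z) t.
have z0 : 0 < normc z by exact: lt_le_trans tz.
pose m := (Num.max 0 (normc z - del) + t) / 2.
have mx : Num.max 0 (normc z - del) < t by rewrite gt_max t0 ltrBlDr.
have m1 : 0 <= Num.max 0 (normc z - del) by rewrite le_max lexx.
have m2 : normc z - del <= Num.max 0 (normc z - del) by rewrite le_max lexx orbT.
have mt : m < t by rewrite /m; lra.
have m0 : 0 <= m by rewrite /m; lra.
have mz : normc z - m < del by rewrite /m; lra.
clearbody m.
pose p := (m / normc z)%:C * z.
have np : normc p = m.
  by rewrite normcME normc_real ger0_norm ?divr_ge0 ?normc_ge0// divfK ?gt_eqF.
have nzp : normc (z - p) = normc z - m.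
  have -> : z - p = (1 - m / normc z)%:C * z by rewrite rmorphB rmorph1 mulrBl mul1r.
  rewrite normcME normc_real ger0_norm.
    by rewrite mulrBl mul1r divfK ?gt_eqF.
  by rewrite subr_ge0 ler_pdivrMr// mul1r ltW// (lt_le_trans mt).
have pt : normc p < t by rewrite np.
have [_ Gp] := expand p pt; rewrite (Gp z); last by rewrite nzp.
by rewrite -(ps_recenter Ht)// np nzp addrC subrK.
Qed.

(** The values of the analytic function that agrees with G off its removable
singularities. *)
Definition regularize G : C -> C := fun z =>
  get ([set w : C^o | exists d (del : R), [/\ 0 < del, radius_ge del d &
    forall z', z' != z -> normc (z' - z) < del -> G z' = ps d (z' - z)] /\ w = d 0%N])%classic.

Lemma regularizeE G p d del : 0 < del -> radius_ge del d ->
  (forall z, z != p -> normc (z - p) < del -> G z = ps d (z - p)) ->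
  forall z, normc (z - p) < del -> regularize G z = ps d (z - p).
Proof.
move=> del0 H Gd z zp.
have zp0 : 0 < del - normc (z - p) by rewrite subr_gt0.
pose e := recenter d (z - p).
have He : radius_ge (del - normc (z - p)) e by exact: radius_ge_recenter.
have eE z' : normc (z' - z) < del - normc (z - p) -> ps e (z' - z) = ps d (z' - p).
  move=> z'z; have E : z' - z = (z' - p) - (z - p) by ring.
  by rewrite E -(ps_recenter H)// -E; lra.
have e0 : e 0%N = ps d (z - p).
  rewrite -eE ?subrr ?normc0E//.
  by rewrite (ps0 zp0 He).
have [del' del'0 del'P] : exists2 del', 0 < del' & del' <= del - normc (z - p) /\
    (z != p -> del' <= normc (z - p)).
  have [->|zp'] := eqVneq z p; first by exists del; rewrite // subrr normc0E subr0.
  exists (Num.min (normc (z - p)) (del - normc (z - p))).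
    by rewrite lt_min zp0 andbT normc_gt0 subr_eq0.
  by split; rewrite ?ge_min lexx ?orbT.
have [del'1 del'2] := del'P.
have He' : radius_ge del' e by exact: radius_ge_le He.
have Ge z' : z' != z -> normc (z' - z) < del' -> G z' = ps e (z' - z).
  move=> z'z z'd; have z'd' : normc (z' - z) < del - normc (z - p) by exact: lt_le_trans del'1.
  rewrite (eE _ z'd'); apply: Gd.
    have [zE|zp'] := eqVneq z p; first by rewrite -zE.
    apply/eqP => z'p; have := del'2 zp'.
    by rewrite leNgt normc_distC -z'p z'd.
  have -> : z' - p = (z' - z) + (z - p) by ring.
  by rewrite (le_lt_trans (normcDle _ _))//; lra.
rewrite -e0 /regularize; apply: (@get_unique C^o); first by exists e, del'.
move=> w [e' [del'' [[del''0 He'' Ge''] ->]]].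
have m0 : 0 < Num.min del' del'' by rewrite lt_min del'0.
congr (_ 0%N); apply: (ps_inj m0).
- by apply: radius_ge_le He''; rewrite ge_min lexx orbT.
- by apply: radius_ge_le He'; rewrite ge_min lexx.
move=> y y0; rewrite lt_min => /andP[y1 y2].
have yz : y + z != z by rewrite -subr_eq0 addrK.
have := Ge'' (y + z) yz; rewrite addrK => /(_ y2) <-.
by have := Ge (y + z) yz; rewrite addrK => /(_ y1) <-.
Qed.

Lemma punctured_taylor_radius G rho r0 c : 0 < r0 -> radius_ge r0 c ->
  (forall z, normc z < r0 -> G z = ps c z) ->
  (forall p, normc p < rho -> punctured_analytic_at G p) -> radius_ge rho c.
Proof.
move=> r00 H Gc an; apply: (@taylor_radius (regularize G) rho r0) => //.
  move=> z zr; rewrite -[z in RHS]subr0.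
  apply: (@regularizeE G 0 c r0) => //; last by rewrite subr0.
  by move=> z' _; rewrite subr0; exact: Gc.
move=> p pr; have [d [del [del0 D Gd]]] := an p pr.
by exists d, del; split=> // z zp; exact: regularizeE Gd z zp.
Qed.

Lemma punctured_analytic_near G p d del q : 0 < del -> radius_ge del d ->
  (forall z, z != p -> normc (z - p) < del -> G z = ps d (z - p)) ->
  normc (q - p) < del -> punctured_analytic_at G q.
Proof.
move=> del0 D Gd qp; have [->|qp'] := eqVneq q p; first by exists d, del.
have m0 : 0 < Num.min (normc (q - p)) (del - normc (q - p)).
  by rewrite lt_min subr_gt0 qp andbT normc_gt0 subr_eq0.
exists (recenter d (q - p)), (Num.min (normc (q - p)) (del - normc (q - p))); split=> //.
  by apply: (radius_ge_le _ (radius_ge_recenter D)); rewrite ge_min lexx orbT.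
move=> z zq; rewrite lt_min => /andP[z1 z2].
have zE : z - q = (z - p) - (q - p) by ring.
rewrite Gd.
- by rewrite zE; apply: ps_recenter D _; rewrite -zE; lra.
- by apply/eqP => zp; move: z1; rewrite zp normc_distC ltxx.
have -> : z - p = (z - q) + (q - p) by ring.
by rewrite (le_lt_trans (normcDle _ _))//; lra.
Qed.

(** The coefficients of z c(z) and of (z - a) c(z). *)
Definition mulz c : nat -> C := fun n => if n is m.+1 then c m else 0.
Definition mul_lin a c : nat -> C := add (mulz c) (scal (- a) c).

Lemma radius_ge_mulz r c : radius_ge r c -> radius_ge r (mulz c).
Proof. by move=> H; apply: radius_ge_unshl. Qed.

Lemma radius_ge_mul_lin r a c : radius_ge r c -> radius_ge r (mul_lin a c).
Proof. by move=> H; apply: radius_geD; [exact: radius_ge_mulz|exact: radius_geZ]. Qed.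

Lemma ps_mulz r c z : radius_ge r c -> normc z < r -> ps (mulz c) z = z * ps c z.
Proof. by move=> H zr; rewrite (ps_recl (radius_ge_mulz H) zr) add0r. Qed.

Lemma ps_mul_lin r a c z : radius_ge r c -> normc z < r ->
  ps (mul_lin a c) z = (z - a) * ps c z.
Proof.
move=> H zr; rewrite (psD (radius_ge_mulz H) (radius_geZ _ H) zr).
by rewrite (ps_mulz H zr) (psZ _ H zr) mulrBl mulNr.
Qed.

Lemma punctured_analytic_mul_lin a G p : punctured_analytic_at G p ->
  punctured_analytic_at (fun z => (z - a) * G z) p.
Proof.
move=> [d [del [del0 D Gd]]]; exists (mul_lin (a - p) d), del; split=> //.
  exact: radius_ge_mul_lin.
move=> z zp zd; rewrite (ps_mul_lin _ D zd) Gd//; congr (_ * _); ring.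
Qed.

Lemma merom_mul_lin r a c : merom 0 r (mul_lin a c) -> merom 0 r c.
Proof.
move=> /merom_shl H; have [a0|a0] := eqVneq a 0.
  rewrite (_ : c = shl (mul_lin a c))//.
  by apply/funext => n; rewrite /shl /mul_lin /add /scal /= a0 oppr0 mul0r addr0.
apply: (@merom_step _ _ _ a^-1); first by rewrite mulr0.
rewrite (_ : sub_shl _ _ = scal (- a^-1) (shl (mul_lin a c))); first exact: meromZ.
by apply/funext => n; rewrite /sub_shl /shl /scal /mul_lin /add /scal /=; field.
Qed.

(** A series that converges at points of every modulus less than del has radius of
convergence at least del. *)
Lemma meromorphic_atP (F : C^o -> C^o) p : meromorphic_at F p <->
  exists m, punctured_analytic_at (fun z => (z - p) ^+ m * F z) p.
Proof.
split=> [[m [c /dnbhsCP[del del0 h]]]|[m [d [del [del0 D Gd]]]]]; exists m; last first.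
  exists d; apply/dnbhsCP; exists del => // z zp zd.
  by rewrite Gd//; apply: csum_cvg; exact: ps_dominated D zd.
have H : radius_ge del c.
  apply: (@radius_ge_near _ 0) => // s s0 _ sd.
  have zE : (s%:C + p) - p = s%:C :> C by rewrite addrK.
  have : cvgn (series (fun k => c k * s%:C ^+ k) : nat -> C^o).
    apply/cvg_ex; exists (s%:C ^+ m * F (s%:C + p)).
    have := h (s%:C + p); rewrite zE normc_real gtr0_norm//; apply=> //.
    by rewrite -subr_eq0 zE -normc_eq0 normc_real normr_eq0 gt_eqF.
  move/cvg_series_cvg_0/cvgCP/(_ _ ltr01) => [N hN].
  exists (1 + \sum_(k < N) normc (c k * s%:C ^+ k)) => n.
  rewrite exprVn ler_pdivlMr ?exprn_gt0//.
  have -> : normc (c n) * s ^+ n = normc (c n * s%:C ^+ n).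
    by rewrite normcME normcXE normc_real gtr0_norm.
  have [Nn|nN] := leqP N n.
    have := hN n Nn; rewrite subr0 => /ltW/le_trans; apply.
    by rewrite lerDl sumr_ge0// => k _; exact: normc_ge0.
  rewrite (bigD1 (Ordinal nN))//= addrCA lerDl addr_ge0// sumr_ge0// => k _.
  exact: normc_ge0.
exists c, del; split=> // z zp zd.
by rewrite /ps /csum (cvg_lim _ (h z zp zd)).
Qed.

End Continuation.

Section MeromorphicTaylor.
Variable R : realType.
Local Notation C := R[i].
Implicit Types (c d e u v : nat -> C) (p q z : C) (r s t K : R) (F G : C -> C).

Lemma foldr_mul_lin r c l : radius_ge r c ->
  radius_ge r (foldr (@mul_lin R) c l) /\
  forall z, normc z < r -> ps (foldr (@mul_lin R) c l) z = \prod_(a <- l) (z - a) * ps c z.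
Proof.
move=> H; elim: l => [|a l [IH1 IH2]] /=.
  by split=> // z _; rewrite big_nil mul1r.
split=> [|z zr]; first exact: radius_ge_mul_lin.
by rewrite big_cons (ps_mul_lin _ IH1 zr) IH2// mulrA.
Qed.

Lemma merom_foldr_mul_lin r c l : merom 0 r (foldr (@mul_lin R) c l) -> merom 0 r c.
Proof. by elim: l => //= a l IH /merom_mul_lin. Qed.

(** Compactness bounds the poles in a smaller closed disc, with multiplicity, by a
finite list; clearing them leaves a function that is analytic there. *)
Lemma meromorphic_merom (F : C^o -> C^o) rho r0 c s : 0 < r0 -> radius_ge r0 c ->
  (forall z, normc z < r0 -> F z = ps c z) ->
  (forall p, normc p < rho -> meromorphic_at F p) -> s < rho -> merom 0 s c.
Proof.
move=> r00 H Fc mer srho.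
pose G l : C -> C := fun z => \prod_(a <- l) (z - a) * F z.
have Gr i j q : punctured_analytic_at (G j) q -> punctured_analytic_at (G (i ++ j)) q.
  move=> Gj; elim: i => //= a i IH.
  rewrite (_ : G (a :: _) = fun z => (z - a) * G (i ++ j) z); first exact: punctured_analytic_mul_lin.
  by apply/funext => z; rewrite /G big_cons mulrA.
have [|||l Gl] := @disc_uniform R (seq C) (fun l q => punctured_analytic_at (G l) q) cat [::] s.
- move=> i j q /(Gr j); rewrite (_ : G (j ++ i) = G (i ++ j))//.
  by apply/funext => z; rewrite /G !big_cat /= [X in X * _]mulrC.
- exact: Gr.
- move=> p ps0; have /meromorphic_atP[m [d [del [del0 D Fd]]]] := mer p (le_lt_trans ps0 srho).
  exists (nseq m p), del; split=> // q qp.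
  apply: punctured_analytic_near del0 D _ qp => z zp zd.
  by rewrite -(Fd z zp zd) /G big_nseq iter_mulr_1.
have [H1 H2] := foldr_mul_lin l H.
apply: (@merom_foldr_mul_lin _ _ l); apply: merom_base.
apply: (@punctured_taylor_radius R (G l) s r0) => //.
  by move=> z zr; rewrite (H2 z zr) /G Fc.
by move=> p ps0; apply: Gl; exact: ltW.
Qed.

(** * Reciprocals of power series *)

(** The coefficients of 1 / c up to degree n, kept as a list because the recursion uses
all the earlier ones. *)
Fixpoint inv_coefs c (n : nat) : seq C :=
  if n is m.+1 then
    rcons (inv_coefs c m)
      (- (c 0%N)^-1 * \sum_(i < m.+1) c i.+1 * (inv_coefs c m)`_(m - i))
  else [:: (c 0%N)^-1].

Definition inv_series c n : C := (inv_coefs c n)`_n.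

Lemma inv_series0 c : inv_series c 0 = (c 0%N)^-1.
Proof. by []. Qed.

Lemma inv_seriesS c n : inv_series c n.+1 =
  - (c 0%N)^-1 * \sum_(i < n.+1) c i.+1 * inv_series c (n - i)%N.
Proof.
have sz m : size (inv_coefs c m) = m.+1 by elim: m => //= m IH; rewrite size_rcons IH.
have st m i : (i <= m)%N -> (inv_coefs c m)`_i = inv_series c i.
  elim: m => [|m IH]; first by rewrite leqn0 => /eqP ->.
  rewrite leq_eqVlt => /orP[/eqP -> //|im].
  by rewrite /= nth_rcons sz im IH.
rewrite /inv_series /= nth_rcons sz ltnn eqxx; congr (_ * _).
by apply: eq_bigr => i _; rewrite st// leq_subr.
Qed.

Lemma conv_inv_series c : c 0%N != 0 -> conv c (inv_series c) = fun n => (n == 0%N)%:R.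
Proof.
move=> c0; apply/funext => -[|n]; rewrite /conv.
  by rewrite big_ord_recl big_ord0 addr0 inv_series0 divff.
rewrite big_ord_recl subn0 inv_seriesS mulNr mulrN mulrA divff// mul1r.
by rewrite [X in _ + X](_ : _ = \sum_(i < n.+1) c i.+1 * inv_series c (n - i)%N) ?addNr.
Qed.

(** Cauchy's majorant: with x = 1 / (1 + A K) the geometric series of the x^(i+1)
sums to 1 / (A K), which reproduces the bound A B^n through the recursion. *)
Lemma radius_ge_inv_series r c : 0 < r -> radius_ge r c -> c 0%N != 0 ->
  exists2 r', 0 < r' & radius_ge r' (inv_series c).
Proof.
move=> r0 H c0; have [s [s0 sr _]] := mid_radius (lexx 0) r0.
have [K cK] := H s s0 sr.
have K0 : 0 < K.
  have := cK 0%N; rewrite expr0 mulr1; apply: lt_le_trans.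
  by rewrite normc_gt0.
pose A := normc (c 0%N)^-1.
have A0 : 0 < A by rewrite normc_gt0 invr_eq0.
have AK : 0 < A * K by rewrite mulr_gt0.
pose x := (1 + A * K)^-1.
have x0 : 0 < x by rewrite invr_gt0 addr_gt0.
have x1 : x < 1 by rewrite invf_lt1 ?addr_gt0// ltrDl.
have xAK : A * K * (x * (1 - x)^-1) = 1.
  have xE : x * (1 + A * K) = 1 by rewrite mulVf// gt_eqF// addr_gt0.
  have -> : 1 - x = A * K * x by rewrite -[X in X - _]xE; ring.
  by rewrite mulrA divff// gt_eqF// mulr_gt0.
clearbody x; have B0 : 0 < s * x by rewrite mulr_gt0.
have bound n : normc (inv_series c n) <= A * (s * x)^-1 ^+ n.
  elim/ltn_ind: n => -[_|n IH]; first by rewrite inv_series0 expr0 mulr1.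
  rewrite inv_seriesS normcME normcNE -/A ler_wpM2l ?(ltW A0)//.
  rewrite (le_trans (normc_sum _ _ _))//.
  apply: (@le_trans _ _ (\sum_(i < n.+1) A * K * x * (s * x)^-1 ^+ n.+1 * x ^+ i)).
    apply: ler_sum => i _; rewrite normcME.
    have ni : (n - i < n.+1)%N by rewrite ltnS leq_subr.
    apply: (@le_trans _ _ (K * s^-1 ^+ i.+1 * (A * (s * x)^-1 ^+ (n - i)))).
      by rewrite ler_pM ?normc_ge0//; exact: IH.
    have -> : (s * x)^-1 ^+ n.+1 = (s * x)^-1 ^+ i.+1 * (s * x)^-1 ^+ (n - i).
      by rewrite -exprD addSn subnKC// -ltnS.
    rewrite !invfM !exprMn.
    rewrite le_eqVlt; apply/orP; left; apply/eqP.
    rewrite [x^-1 ^+ i.+1]exprVn [x ^+ i.+1]exprS.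
    move: (s^-1 ^+ (n - i)) (x^-1 ^+ (n - i)) (s^-1 ^+ i.+1) => P Q S.
    by field; rewrite expf_neq0 ?gt_eqF.
  rewrite -mulr_sumr.
  apply: (@le_trans _ _ (A * K * x * (s * x)^-1 ^+ n.+1 * (1 - x)^-1)).
    rewrite ler_wpM2l ?geometric_sum_le ?(ltW x0)//.
    by rewrite !mulr_ge0 ?exprn_ge0 ?invr_ge0 ?mulr_ge0 ?(ltW x0) ?(ltW s0) ?(ltW A0) ?(ltW K0).
  rewrite [leLHS](_ : _ = A * K * (x * (1 - x)^-1) * (s * x)^-1 ^+ n.+1); last by ring.
  by rewrite xAK mul1r.
exists (s * x) => // y y0 yx; exists A; apply: geo_le bound => //.
exact: ltW.
Qed.

Lemma seq0_or_lead c : c = (fun=> 0) \/ exists m, c m != 0 /\ forall i, (i < m)%N -> c i = 0.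
Proof.
have [h|h] := pselect (exists m, c m != 0); last first.
  left; apply/funext => n; apply/eqP/negPn/negP => cn; apply: h; by exists n.
right; exists (ex_minn h); case: ex_minnP => m cm min; split=> // i im.
by apply/eqP/negPn/negP => /min; rewrite leqNgt im.
Qed.

Lemma ps_lead r c m z : radius_ge r c -> normc z < r -> (forall i, (i < m)%N -> c i = 0) ->
  radius_ge r (fun n => c (m + n)%N) /\ ps c z = z ^+ m * ps (fun n => c (m + n)%N) z.
Proof.
move=> H zr; elim: m => [|m IH] c0; first by rewrite expr0 mul1r.
have [|Hm ->] := IH; first by move=> i im; exact: c0 (ltnW _).
have -> : (fun n => c (m.+1 + n)%N) = shl (fun n => c (m + n)%N).
  by apply/funext => n; rewrite /shl addSnnS.
split; first exact: radius_ge_shl.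
by rewrite (ps_recl Hm zr) addn0 c0// add0r exprSr mulrA.
Qed.

Lemma ps_delta z : ps (fun n => (n == 0%N)%:R) z = 1.
Proof. by rewrite /ps (@csum_fin _ 1) ?big_ord_recl ?big_ord0 ?expr0 ?mulr1 ?addr0// => -[|n]; rewrite ?mul0r. Qed.

(** Around p the series is (z - p)^m times one with a nonzero constant term, which has a
reciprocal power series. If it vanishes identically, so does its pointwise inverse. *)
Lemma meromorphic_at_inv_ps r c p : radius_ge r c -> normc p < r ->
  meromorphic_at (fun z : C^o => (ps c z)^-1 : C^o) p.
Proof.
move=> H pr; have D := radius_ge_recenter H (p := p).
set d := recenter c p in D *.
have rp : 0 < r - normc p by rewrite subr_gt0.
have cd z : normc (z - p) < r - normc p -> ps c z = ps d (z - p).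
  by move=> zp; apply: ps_recenter H _; lra.
apply/meromorphic_atP; have [d0|[m [dm d0]]] := seq0_or_lead d.
  exists 0%N, (fun=> 0), (r - normc p); split=> //.
    by rewrite -d0.
  move=> z _ zp; rewrite cd// d0 mulrC.
  suff -> : ps (fun=> 0 : C) (z - p) = 0 by rewrite invr0 mul0r.
  by rewrite /ps (_ : (fun n => 0 * _) = fun=> 0) ?csum0//; apply/funext => n; rewrite mul0r.
have [Hm _] := ps_lead D (z := 0) (eq_ind_r (fun x => x < _) rp (normc0E R)) d0.
pose dm' n := d (m + n)%N.
have dm0 : dm' 0%N != 0 by rewrite /dm' addn0.
have [r' r'0 He] := radius_ge_inv_series rp Hm dm0.
pose del := Num.min r' (r - normc p).
have del0 : 0 < del by rewrite lt_min r'0.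
exists m, (inv_series dm'), del; split=> //.
  by apply: radius_ge_le He; rewrite ge_min lexx.
move=> z zp zd.
have zr : normc (z - p) < r - normc p by rewrite (lt_le_trans zd)// ge_min lexx orbT.
have [_ E] := ps_lead D zr d0.
have del1 : del <= r - normc p by rewrite ge_min lexx orbT.
have del2 : del <= r' by rewrite ge_min lexx.
have := ps_conv (radius_ge_le del1 Hm) (radius_ge_le del2 He) zd.
rewrite (conv_inv_series dm0) ps_delta -/dm' => /esym one.
have n0 : ps dm' (z - p) != 0.
  by apply/eqP => n0; move: one; rewrite n0 mul0r => /eqP; rewrite eq_sym oner_eq0.
rewrite cd// E invfM mulrA divff ?mul1r; last by rewrite expf_neq0// subr_eq0.
by apply: (mulfI n0); rewrite divff.
Qed.

(** * Continuation of a power series past its poles *)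

(** L is the value at z of the function with Taylor series c at 0, obtained by clearing
finitely many factors 1 - l z, none of which vanishes at z. *)
Inductive continued_value z : (nat -> C) -> C -> Prop :=
| continued_base s c of normc z < s & radius_ge s c : continued_value z c (ps c z)
| continued_step l c L of 1 - l * z != 0 & continued_value z (sub_shl l c) L :
    continued_value z c ((c 0%N + z * L) / (1 - l * z)).

Lemma ps_sub_shl s c l z : radius_ge s c -> normc z < s ->
  (1 - l * z) * ps c z = c 0%N + z * ps (sub_shl l c) z.
Proof.
move=> H zs; rewrite sub_shlE (psD (radius_ge_shl H) (radius_geZ _ H) zs) (psZ _ H zs).
by rewrite mulrBl mul1r {1}(ps_recl H zs); ring.
Qed.

Lemma continued_sub_shl z c L l : z != 0 -> continued_value z c L ->
  continued_value z (sub_shl l c) (((1 - l * z) * L - c 0%N) / z).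
Proof.
move=> z0; elim=> [s {}c zs H|m {}c {}L mz _ IH].
  rewrite (ps_sub_shl l H zs) addrAC subrr add0r mulrC mulKf//.
  by apply: continued_base zs _; exact: radius_ge_sub_shl.
have comm : sub_shl l (sub_shl m c) = sub_shl m (sub_shl l c).
  by apply/funext => n; rewrite /sub_shl; ring.
rewrite comm in IH; have := continued_step mz IH.
congr continued_value; rewrite /sub_shl; field.
by rewrite ?z0 ?mz.
Qed.

Lemma continued_unique z c L L' : z != 0 -> continued_value z c L ->
  continued_value z c L' -> L = L'.
Proof.
move=> z0 H; elim: H L' => [s {}c zs H|l {}c {}L lz _ IH] L' H'.
  elim: H' zs H => // l {}c {}L lz _ IH zs H.
  rewrite -IH//; last exact: radius_ge_sub_shl.
  by rewrite -(ps_sub_shl _ H zs) mulrC mulKf.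
rewrite (IH _ (continued_sub_shl l z0 H')).
by field; rewrite ?z0 ?lz.
Qed.

Lemma radius_ge_conv r c d : radius_ge r c -> radius_ge r d -> radius_ge r (conv c d).
Proof.
move=> H H' x x0 xr; have [s [s0 sr xs]] := mid_radius (ltW x0) xr.
have [K cK] := H s s0 sr; have [K' dK] := H' s s0 sr.
have K0 := geo_ge0 cK; have K'0 := geo_ge0 dK.
have [||M hM] := @linear_geometric_bounded R (x / s).
- by rewrite divr_ge0 ?ltW.
- by rewrite ltr_pdivrMr// mul1r.
exists (K * K' * M) => n; rewrite exprVn ler_pdivlMr ?exprn_gt0//.
apply: (@le_trans _ _ (\sum_(i < n.+1) K * K' * (x / s) ^+ n)).
  rewrite -ler_pdivlMr ?exprn_gt0// (le_trans (normc_sum _ _ _))// mulr_suml.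
  apply: ler_sum => i _; rewrite normcME.
  apply: (@le_trans _ _ (K * s^-1 ^+ i * (K' * s^-1 ^+ (n - i)))).
    by rewrite ler_pM ?normc_ge0.
  rewrite mulrACA -exprD subnKC -1?ltnS// exprMn -!mulrA.
  by rewrite [x ^+ n * _]mulrCA divff ?mulr1// expf_neq0// gt_eqF.
rewrite sumr_const card_ord -mulr_natl.
rewrite [leLHS](_ : _ = K * K' * (n.+1%:R * (x / s) ^+ n)); last by ring.
by rewrite ler_wpM2l// mulr_ge0.
Qed.

Lemma ps_monomial a m z : ps (fun n => if n == m then a else 0) z = a * z ^+ m.
Proof.
rewrite /ps (@csum_fin _ m.+1) => [|n mn]; last by rewrite gtn_eqF// mul0r.
rewrite big_ord_recr /= eqxx big1 ?add0r// => i _.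
by rewrite ltn_eqF ?mul0r.
Qed.

Lemma radius_ge_monomial r a m : radius_ge r (fun n : nat => if n == m then a else 0 : C).
Proof.
move=> s s0 _; exists (normc a * s ^+ m) => n; case: eqVneq => [->|_].
  by rewrite exprVn mulfK// expf_neq0// gt_eqF.
by rewrite normc0E !mulr_ge0 ?normc_ge0 ?exprn_ge0 ?invr_ge0 ?(ltW s0).
Qed.

Lemma ps_geometric a z : normc a * normc z < 1 ->
  exists r, [/\ normc z < r, radius_ge r (fun n => a ^+ n) & ps (fun n => a ^+ n) z = (1 - a * z)^-1].
Proof.
move=> az; have [r zr ar] : exists2 r, normc z < r & normc a * r <= 1.
  have [a0|a0] := eqVneq (normc a) 0.
    by exists (normc z + 1); rewrite ?ltrDl ?ltr01// a0 mul0r ler01.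
  have a0' : 0 < normc a by rewrite lt_def a0 normc_ge0.
  by exists (normc a)^-1; rewrite ?mulfV// -[ltRHS]mul1r ltr_pdivlMr// mulrC.
have H : radius_ge r (fun n => a ^+ n).
  move=> s s0 sr; exists 1 => n; rewrite mul1r normcXE.
  rewrite lerXn2r ?nnegrE ?normc_ge0 ?invr_ge0 ?(ltW s0)//.
  rewrite -[leRHS]mul1r ler_pdivlMr// (le_trans _ ar)// ler_wpM2l ?normc_ge0//.
  exact: ltW.
have n0 : 1 - a * z != 0.
  apply/eqP => /subr0_eq/(congr1 (@normc R)); rewrite normc1E normcME => E.
  by move: az; rewrite -E ltxx.
exists r; split=> //; have := ps_sub_shl a H zr.
rewrite (_ : sub_shl a _ = fun=> 0).
  rewrite /ps (_ : (fun n => 0 * _) = fun=> 0) ?csum0 ?mulr0 ?addr0 ?expr0 => [E|].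
    by apply: (mulfI n0); rewrite divff.
  by apply/funext => n; rewrite mul0r.
by apply/funext => n; rewrite /sub_shl exprS subrr.
Qed.

(** A step divides by 1 - l z: at p = 1 / l this raises the order of the pole by one, and
elsewhere 1 / (1 - l z) is a multiple of a geometric series in z - p. *)
Lemma continued_local rho c p : merom 0 rho c -> normc p < rho ->
  exists m e (del : R), [/\ 0 < del, radius_ge del e & forall z, z != p -> normc (z - p) < del ->
    exists2 L, continued_value z c L & (z - p) ^+ m * L = ps e (z - p)].
Proof.
move=> H pr; elim: H => [{}c H|l {}c _ _ [m [e [del [del0 E cv]]]]].
  have rp : 0 < rho - normc p by rewrite subr_gt0.
  exists 0%N, (recenter c p), (rho - normc p); split=> //; first exact: radius_ge_recenter.
  move=> z _ zp; have zr : normc z < rho.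
    have -> : z = (z - p) + p by rewrite subrK.
    by rewrite (le_lt_trans (normcDle _ _))//; lra.
  exists (ps c z); first exact: continued_base zr H.
  by rewrite expr0 mul1r; apply: ps_recenter H _; lra.
pose num := add (fun n => if n == m then c 0%N else 0) (mul_lin (- p) e).
have N : radius_ge del num.
  by apply: radius_geD; [exact: radius_ge_monomial|exact: radius_ge_mul_lin].
have numE z : normc (z - p) < del ->
    ps num (z - p) = (z - p) ^+ m * c 0%N + z * ps e (z - p).
  move=> zp; rewrite (psD (radius_ge_monomial _ _) (radius_ge_mul_lin _ E) zp).
  by rewrite ps_monomial (ps_mul_lin _ E zp) opprK subrK mulrC.
have [lp|lp] := eqVneq (1 - l * p) 0.
  have l0 : l != 0.
    by apply/eqP => l0; move: lp => /eqP; rewrite l0 mul0r subr0 oner_eq0.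
  exists m.+1, (scal (- l^-1) num), del; split=> //; first exact: radius_geZ.
  move=> z zp zd; have [L cL LE] := cv z zp zd.
  have lz : 1 - l * z = - (l * (z - p)).
    have -> : 1 - l * z = (1 - l * p) - l * (z - p) by ring.
    by rewrite lp sub0r.
  have zp0 : z - p != 0 by rewrite subr_eq0.
  have lz0 : 1 - l * z != 0 by rewrite lz oppr_eq0 mulf_neq0.
  exists ((c 0%N + z * L) / (1 - l * z)); first exact: continued_step lz0 cL.
  rewrite (psZ _ N zd) numE// -LE lz exprS; field.
  by rewrite ?l0 ?zp0 ?andbT.
pose a := l / (1 - l * p).
pose del' := Num.min del (normc a + 1)^-1.
have a1 : 0 < normc a + 1 by rewrite ltr_wpDl ?normc_ge0.
have del'0 : 0 < del' by rewrite lt_min del0 invr_gt0.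
have adel z : normc z < del' -> normc a * normc z < 1.
  move=> zd; have : normc z < (normc a + 1)^-1.
    by rewrite (lt_le_trans zd)// ge_min lexx orbT.
  rewrite -[ltRHS]mul1r ltr_pdivlMr// => h.
  by have := normc_ge0 z; move: h; rewrite mulrDr mulr1 mulrC => h1 h2; lra.
have Ga : radius_ge del' (fun n => a ^+ n).
  apply: (@radius_ge_near _ 0) => // s s0 _ sd.
  have /ps_geometric[r [sr Hr _]] : normc a * normc s%:C < 1.
    by apply: adel; rewrite normc_real gtr0_norm.
  by apply: Hr; rewrite // -[s]gtr0_norm// -normc_real.
have N' : radius_ge del' num by apply: radius_ge_le N; rewrite ge_min lexx.
exists m, (scal (1 - l * p)^-1 (conv num (fun n => a ^+ n))), del'; split=> //.
  by apply: radius_geZ; exact: radius_ge_conv.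
move=> z zp zd; have zd' : normc (z - p) < del by rewrite (lt_le_trans zd)// ge_min lexx.
have [L cL LE] := cv z zp zd'.
have [r [_ _ geoE]] := ps_geometric (adel _ zd).
have lzE : 1 - a * (z - p) = (1 - l * z) / (1 - l * p) by rewrite /a; field; rewrite lp.
have lz0 : 1 - l * z != 0.
  apply/eqP => lz0; have : 1 - a * (z - p) = 0 by rewrite lzE lz0 mul0r.
  move/subr0_eq/(congr1 (@normc R)); rewrite normc1E normcME => E1.
  by have := adel _ zd; rewrite -E1 ltxx.
exists ((c 0%N + z * L) / (1 - l * z)); first exact: continued_step lz0 cL.
rewrite (psZ _ (radius_ge_conv N' Ga) zd) (ps_conv N' Ga zd) geoE numE// -LE lzE.
by field; rewrite lz0 lp.
Qed.

(** The continued values do not depend on the factors that are cleared, so that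
they define a single function on the whole plane. *)
Lemma merom_entire_meromorphic c (f : C^o -> C^o) : radius_ge 1 c ->
  (forall z, normc z < 1 -> f z = ps c z) -> (forall rho, merom 0 rho c) ->
  entire_meromorphic f.
Proof.
move=> H fc mer.
pose F : C^o -> C^o := fun z => if z == 0 then c 0%N else
  get ([set L : C^o | continued_value z c L])%classic.
have FE z L : z != 0 -> continued_value z c L -> F z = L.
  move=> z0 cL; rewrite /F (negbTE z0); apply: (@get_unique C^o) => // L' cL'.
  exact: continued_unique z0 cL' cL.
exists F; split=> [p|z z1]; last first.
  rewrite fc//; have [->|z0] := eqVneq z 0; first by rewrite /F eqxx (ps0 ltr01 H).
  by apply: FE => //; exact: continued_base z1 H.
have pr : normc p < normc p + 1 by rewrite ltrDl ltr01.
have [m [e [del [del0 E cv]]]] := continued_local (mer _) pr.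
apply/meromorphic_atP; exists m, e.
have [del' [del'0 del'd z0]] : exists del', [/\ 0 < del', del' <= del &
    forall z, z != p -> normc (z - p) < del' -> z != 0].
  have [->|p0] := eqVneq p 0; first by exists del.
  exists (Num.min del (normc p)); split.
  - by rewrite lt_min del0 normc_gt0.
  - by rewrite ge_min lexx.
  move=> z _; rewrite lt_min => /andP[_ zp]; apply/eqP => z0.
  by move: zp; rewrite z0 sub0r normcNE ltxx.
exists del'; split=> //; first exact: radius_ge_le E.
move=> z zp zd; have [L cL <-] := cv z zp (lt_le_trans zd del'd).
by rewrite (FE z L)//; exact: z0.
Qed.

Lemma entire_meromorphic_merom c (f : C^o -> C^o) : radius_ge 1 c ->
  (forall z, normc z < 1 -> f z = ps c z) -> entire_meromorphic f ->
  forall rho, merom 0 rho c.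
Proof.
move=> H fc [F [mer Ff]] rho.
apply: (@meromorphic_merom F (rho + 1) 1) => //; last by rewrite ltrDl.
by move=> z z1; rewrite Ff// fc.
Qed.

End MeromorphicTaylor.

(** * Asymptotic series *)

Section Asymptotics.
Variable R : realType.
Local Notation C := R[i].
Implicit Types (h x : nat -> C) (r s rho K : R) (l : C).

Lemma limn_esup_lt_geometric (u : nat -> R) q : (forall n, 0 <= u n) ->
  (limn_esup (fun n => (u n `^ n%:R^-1)%:E) < q%:E)%E ->
  exists q' N, [/\ 0 < q', q' < q & forall n, (N <= n)%N -> u n <= q' ^+ n].
Proof.
move=> u0; rewrite /limn_esup limf_esupE => /ereal_inf_lt[_ [V [M _ MV] <-] supV].
set f := (fun n => _) in supV.
have [q' [q'0 q'q fq']] : exists q', [/\ 0 < q', q' < q &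
    forall n, (M <= n)%N -> u n `^ n%:R^-1 <= q'].
  have le n : (M <= n)%N -> ((u n `^ n%:R^-1)%:E <= ereal_sup (f @` V)%classic)%E.
    by move=> Mn; apply: ereal_sup_ubound; exists n => //; exact: MV.
  have q0 : 0 < q.
    rewrite -lte_fin; apply: le_lt_trans supV; apply: le_trans (le M (leqnn _)).
    by rewrite lee_fin powR_ge0.
  case E : (ereal_sup (f @` V)%classic) supV le => [y| |] // yq le.
    rewrite lte_fin in yq.
    have yM : 0 <= y.
      by have := le M (leqnn _); rewrite lee_fin; apply: le_trans; exact: powR_ge0.
    exists ((y + q) / 2); split; [lra|lra|move=> n Mn].
    have := le n Mn; rewrite lee_fin => /le_trans; apply; lra.
  exists (q / 2); split; [lra|lra|move=> n Mn].
  by have := le n Mn; rewrite leeNy_eq.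
exists q', (maxn M 1); split=> // n; rewrite geq_max => /andP[Mn n1].
have n0 : n%:R != 0 :> R by rewrite pnatr_eq0 -lt0n.
have -> : u n = (u n `^ n%:R^-1) ^+ n.
  by rewrite -powR_mulrn ?powR_ge0// -powRrM mulVf// powRr1.
by rewrite lerXn2r ?nnegrE ?powR_ge0 ?(ltW q'0)// fq'.
Qed.

Lemma geometric_limn_esup_le (u : nat -> R) q N : 0 <= q -> (forall n, 0 <= u n) ->
  (forall n, (N <= n)%N -> u n <= q ^+ n) ->
  (limn_esup (fun n => (u n `^ n%:R^-1)%:E) <= q%:E)%E.
Proof.
move=> q0 u0 uq; rewrite /limn_esup limf_esupE; apply: ge_ereal_inf.
exists (ereal_sup ((fun n => (u n `^ n%:R^-1)%:E) @` [set n | (maxn N 1 <= n)%N])%classic).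
  by exists [set n | (maxn N 1 <= n)%N]%classic => //; exists (maxn N 1).
apply: ge_ereal_sup => _ [n /= + <-]; rewrite geq_max lee_fin => /andP[Nn n1].
have n0 : n%:R != 0 :> R by rewrite pnatr_eq0 -lt0n.
apply: (@le_trans _ _ ((q ^+ n) `^ n%:R^-1)).
  by rewrite ge0_ler_powR ?invr_ge0 ?nnegrE ?exprn_ge0// uq.
by rewrite -powR_mulrn// -powRrM mulfV// powRr1.
Qed.

Lemma eventually_geo K s h N : 0 < s -> (forall n, (N <= n)%N -> normc (h n) <= K * s^-1 ^+ n) ->
  exists K', geo K' s^-1 h.
Proof.
move=> s0 hK; exists (`|K| + \sum_(i < N) normc (h i) * s ^+ i) => n.
have S0 : 0 <= \sum_(i < N) normc (h i) * s ^+ i.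
  by apply: sumr_ge0 => i _; rewrite mulr_ge0 ?normc_ge0 ?exprn_ge0 ?(ltW s0).
have x0 : 0 <= s^-1 ^+ n by rewrite exprn_ge0 ?invr_ge0 ?(ltW s0).
have [Nn|nN] := leqP N n.
  by rewrite (le_trans (hK n Nn))// ler_wpM2r// (le_trans (ler_norm K))// lerDl.
rewrite exprVn ler_pdivlMr ?exprn_gt0// (bigD1 (Ordinal nN))//= addrCA lerDl.
rewrite addr_ge0//; apply: sumr_ge0 => i _.
by rewrite mulr_ge0 ?normc_ge0 ?exprn_ge0 ?(ltW s0).
Qed.

Lemma limn_esup_radius rho h : 0 < rho ->
  (limn_esup (fun n => (normc (h n) `^ n%:R^-1)%:E) <= rho^-1%:E)%E <-> radius_ge rho h.
Proof.
move=> rho0; split=> [le s s0 srho|H].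
  have : (limn_esup (fun n => (normc (h n) `^ n%:R^-1)%:E) < s^-1%:E)%E.
    by apply: (le_lt_trans le); rewrite lte_fin ltf_pV2.
  move=> /(limn_esup_lt_geometric (fun n => normc_ge0 _))[q [N [q0 qs hq]]].
  apply: (@eventually_geo 1 s _ N) => // n Nn; rewrite mul1r (le_trans (hq n Nn))//.
  by rewrite lerXn2r ?nnegrE ?invr_ge0 ?(ltW s0) ?(ltW q0)// ltW.
apply/lee_addgt0Pr => e e0; rewrite -EFinD.
set s := (rho^-1 + e)^-1.
have re : 0 < rho^-1 + e by rewrite addr_gt0 ?invr_gt0.
have s0 : 0 < s by rewrite invr_gt0.
have srho : s < rho by rewrite /s -[ltRHS]invrK ltf_pV2 ?posrE ?invr_gt0// ltrDl.
have [s' [s'0 s'rho ss']] := mid_radius (ltW s0) srho.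
have [K hK] := H s' s'0 s'rho; have K0 := geo_ge0 hK.
have [||| N hN] := @geometric_small R (s / s') (K + 1)^-1.
- by rewrite divr_ge0 ?ltW.
- by rewrite ltr_pdivrMr// mul1r.
- by rewrite invr_gt0 ltr_wpDl.
apply: (@geometric_limn_esup_le _ _ N); first exact: ltW.
  by move=> n; exact: normc_ge0.
move=> n Nn; rewrite (le_trans (hK n))//.
have -> : rho^-1 + e = s^-1 by rewrite invrK.
have -> : s'^-1 = s^-1 * (s / s') by rewrite mulrA mulVf ?mul1r// gt_eqF.
rewrite exprMn mulrCA ler_piMr ?exprn_ge0 ?invr_ge0 ?(ltW re)//.
have q0 : 0 <= s / s' by rewrite divr_ge0 ?ltW.
apply: (@le_trans _ _ ((K + 1) * (s / s') ^+ N)).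
  apply: ler_pM => //; rewrite ?exprn_ge0// ?lerDl ?ler01//.
  by apply: ler_wiXn2l => //; rewrite ltW// ltr_pdivrMr// mul1r.
rewrite mulrC -ler_pdivlMr ?mul1r ?ltr_wpDl//.
exact: ltW.
Qed.

(** * Exponential polynomials *)

Lemma size_comp_XD1_sub (p : {poly C}) : p != 0 -> (size (p \Po ('X + 1) - p)%R < size p)%N.
Proof.
move=> p0; have sX : size ('X + 1 : {poly C}) = 2 by rewrite -[1]/(1%:P) size_XaddC.
have sp : size (p \Po ('X + 1)) = size p by exact: size_comp_poly2.
have sp0 : (0 < size p)%N by rewrite lt0n size_poly_eq0.
rewrite -(prednK sp0) ltnS; apply/leq_sizeP => j.
rewrite leq_eqVlt => /orP[/eqP <-|pj].
  rewrite coefB -{1}sp -/(lead_coef _) lead_coef_comp ?sX//.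
  by rewrite -[1]/(1%:P) lead_coefXaddC expr1n mulr1 subrr.
rewrite prednK// in pj.
by rewrite coefB !nth_default ?subrr// sp.
Qed.

(** On p(n) l^n the operator T - l acts by the difference operator on p, which lowers the
degree. *)
Lemma merom_poly_exp rho l (p : {poly C}) : merom 0 rho (fun n => p.[n%:R] * l ^+ n).
Proof.
have [m] := ubnP (size p); elim: m p => // m IH p; rewrite ltnS => pm.
have [->|p0] := eqVneq p 0.
  apply: merom_base => s s0 _; exists 0 => n.
  by rewrite horner0 mul0r normc0E mul0r.
apply: (@merom_step _ _ _ l); first by rewrite mulr0.
have -> : sub_shl l (fun n => p.[n%:R] * l ^+ n) =
    scal l (fun n => (p \Po ('X + 1) - p).[n%:R] * l ^+ n).
  apply/funext => n; rewrite /sub_shl /scal hornerD hornerN horner_comp hornerD hornerX hornerC.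
  by rewrite natr1 exprS; ring.
apply: meromZ; apply: IH; exact: leq_trans (size_comp_XD1_sub p0) pm.
Qed.

Lemma asymptotic_merom x rho : 0 < rho -> asymptotic_series_upto x rho -> merom 0 rho x.
Proof.
move=> rho0 [K [mu [p [_ /(limn_esup_radius _ rho0) H]]]].
set y := (fun n => x n - _) in H.
have -> : x = add y (fun n => \sum_(j < K) (p j).[n%:R] * mu j ^- n).
  by apply/funext => n; rewrite /add /y subrK.
apply: meromD; first exact: merom_base.
suff h (r : seq 'I_K) : merom 0 rho (fun n => \sum_(j <- r) (p j).[n%:R] * mu j ^- n).
  exact: h.
elim: r => [|j r IH].
  apply: merom_base => s s0 _; exists 0 => n.
  by rewrite big_nil normc0E mul0r.
rewrite (_ : (fun n => _) = add (fun n => (p j).[n%:R] * (mu j)^-1 ^+ n)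
   (fun n => \sum_(j <- r) (p j).[n%:R] * mu j ^- n)).
  by apply: meromD => //; exact: merom_poly_exp.
by apply/funext => n; rewrite /add big_cons exprVn.
Qed.

(** The triple (a, m, k) stands for the sequence a C(n,k) m^n. Binomial coefficients are
used instead of powers of n because T - m sends C(n,k) m^n to m C(n,k-1) m^n. *)
Definition bin_exp (t : C * C * nat) (n : nat) : C := t.1.1 * 'C(n, t.2)%:R * t.1.2 ^+ n.
Definition bin_exp_sum (E : seq (C * C * nat)) (n : nat) : C := \sum_(t <- E) bin_exp t n.

Lemma sub_shlD l h k : sub_shl l (add h k) = add (sub_shl l h) (sub_shl l k).
Proof. by apply/funext => n; rewrite /sub_shl /add; ring. Qed.

Lemma bin_exp_sum_cat E E' : bin_exp_sum (E ++ E') = add (bin_exp_sum E) (bin_exp_sum E').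
Proof. by apply/funext => n; rewrite /bin_exp_sum /add big_cat. Qed.

Lemma bin_exp_sum1 t : bin_exp_sum [:: t] = bin_exp t.
Proof. by apply/funext => n; rewrite /bin_exp_sum big_seq1. Qed.

(** The operator T - l is onto on the span of the C(n,k) m^n, k in nat: raising k by
one at resonance l = m, by recursion on k otherwise. *)
Lemma bin_exp_solve l (a m : C) k : m != 0 ->
  exists E, all (fun t => t.1.2 == m) E /\ sub_shl l (bin_exp_sum E) = bin_exp (a, m, k).
Proof.
move=> m0; have [->|lm] := eqVneq l m.
  exists [:: (a / m, m, k.+1)]; rewrite /= eqxx; split=> //.
  apply/funext => n; rewrite bin_exp_sum1 /sub_shl /bin_exp /= binS natrD exprS.
  by field; rewrite m0.
have ml : m - l != 0 by rewrite subr_eq0 eq_sym.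
elim: k a => [|k IH] a.
  exists [:: (a / (m - l), m, 0%N)]; rewrite /= eqxx; split=> //.
  apply/funext => n; rewrite bin_exp_sum1 /sub_shl /bin_exp /= !bin0 exprS.
  by field; rewrite ml.
have [E [Em EE]] := IH (- (a * m / (m - l))).
exists ((a / (m - l), m, k.+1) :: E); rewrite /= eqxx; split=> //.
rewrite -cat1s bin_exp_sum_cat sub_shlD EE bin_exp_sum1.
apply/funext => n; rewrite /add /sub_shl /bin_exp /= binS natrD exprS.
by field; rewrite ml.
Qed.

Lemma bin_exp_sum_solve l (P : pred C) E : all (fun t => (t.1.2 != 0) && P t.1.2) E ->
  exists E', all (fun t => (t.1.2 != 0) && P t.1.2) E' /\
    sub_shl l (bin_exp_sum E') = bin_exp_sum E.
Proof.
elim: E => [_|[[a m] k] E IH /= /andP[/andP[m0 Pm] /IH[E' [PE' EE']]]].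
  by exists [::]; split=> //; apply/funext => n; rewrite /sub_shl /bin_exp_sum !big_nil mulr0 subr0.
have [E'' [mE'' EE'']] := bin_exp_solve l a k m0.
exists (E'' ++ E'); split.
  rewrite all_cat PE' andbT; apply/allP => t /(allP mE'')/eqP ->.
  by rewrite m0.
by rewrite bin_exp_sum_cat sub_shlD EE' EE'' -cat1s bin_exp_sum_cat bin_exp_sum1.
Qed.

(** The principal part of (T - l) h is pulled back through T - l. The remainder is then
of radius rho up to a multiple of l^n, a term of the principal part if |l| rho > 1. *)
Lemma merom_bin_exp s rho h : 0 < s -> 0 < rho -> merom s rho h ->
  exists E, all (fun t => (t.1.2 != 0) && ((normc t.1.2 * s <= 1) && (1 < normc t.1.2 * rho))) E /\
    radius_ge rho (fun n => h n - bin_exp_sum E n).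
Proof.
move=> s0 rho0; elim=> [{}h H|l {}h ls _ [E [PE H]]].
  exists [::]; split=> //; rewrite (_ : (fun n => _) = h)//.
  by apply/funext => n; rewrite /bin_exp_sum big_nil subr0.
have [E' [PE' EE']] := bin_exp_sum_solve l
  (P := fun m => (normc m * s <= 1) && (1 < normc m * rho)) PE.
pose k n := h n - bin_exp_sum E' n.
have kE : sub_shl l k = fun n => sub_shl l h n - bin_exp_sum E n.
  by rewrite -EE'; apply/funext => n; rewrite /sub_shl /k; ring.
rewrite -kE in H.
have [lrho|lrho] := leP (normc l * rho) 1.
  exists E'; split=> //; apply: (@merom_radius _ rho rho) => //.
  by apply: merom_step lrho _; exact: merom_base.
have l0 : l != 0.
  by apply/eqP => l0; move: lrho; rewrite l0 normc0E mul0r ltr10.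
have nl0 : 0 < normc l by rewrite normc_gt0.
have V := radius_ge_geom l0.
pose kp := scal (-1) (opT (fun j => l^-1 ^+ j.+1) (sub_shl l k)).
have Hkp : radius_ge rho kp by apply: radius_geZ; exact: (radius_ge_opT nl0 rho0 lrho V H).
have kpE : sub_shl l kp = sub_shl l k.
  apply/funext => n; rewrite /kp; set w := sub_shl l k.
  have := congr1 (fun f => f n) (opT_recl nl0 rho0 lrho V H); rewrite -/w.
  have -> : shl (fun j => l^-1 ^+ j.+1) = scal l^-1 (fun j => l^-1 ^+ j.+1).
    by apply/funext => j; rewrite /shl /scal exprS.
  rewrite (opTZl _ nl0 rho0 lrho V); last exact: radius_ge_shl.
  rewrite opT_shl /add /scal /sub_shl /shl /= expr1 -/w => ->.
  by field; rewrite l0.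
have kC n : k n - kp n = (k 0%N - kp 0%N) * l ^+ n.
  elim: n => [|n IH]; first by rewrite expr0 mulr1.
  have E1 : kp n.+1 - l * kp n = k n.+1 - l * k n by have := congr1 (fun f => f n) kpE.
  have -> : k n.+1 = kp n.+1 - l * kp n + l * k n by rewrite E1 subrK.
  transitivity (l * (k n - kp n)); first by ring.
  by rewrite IH [l ^+ n.+1]exprS [RHS]mulrCA.
exists ((k 0%N - kp 0%N, l, 0%N) :: E'); split.
  by rewrite /= l0 ls lrho.
rewrite (_ : (fun n => _) = kp)//; apply/funext => n.
rewrite -cat1s bin_exp_sum_cat bin_exp_sum1 /add /bin_exp /= bin0 mulr1 -kC /k.
by ring.
Qed.

Definition bin_poly k : {poly C} := k`!%:R^-1 *: \prod_(i < k) ('X - i%:R%:P).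

Lemma bin_polyE k n : (bin_poly k).[n%:R] = 'C(n, k)%:R.
Proof.
have ff : \prod_(i < k) (n%:R - i%:R) = (n ^_ k)%:R :> C.
  elim: k => [|k IH]; first by rewrite big_ord0 ffactn0.
  rewrite big_ord_recr /= IH ffactnSr natrM.
  have [kn|nk] := leqP k n; first by rewrite natrB.
  by rewrite ffact_small// !mul0r.
rewrite /bin_poly hornerZ horner_prod.
under eq_bigr => i _ do rewrite hornerXsubC.
by rewrite ff -bin_ffact natrM mulrC mulfK// pnatr_eq0 -lt0n fact_gt0.
Qed.

Lemma merom_asymptotic s x rho : 1 < s -> 0 < rho -> merom s rho x -> asymptotic_series_upto x rho.
Proof.
move=> s1 rho0 H; have s0 := lt_trans ltr01 s1.
have [E [PE HE]] := merom_bin_exp s0 rho0 H.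
pose t (j : 'I_(size E)) := nth (0, 0, 0%N) E j.
exists (size E), (fun j => (t j).1.2^-1), (fun j => (t j).1.1 *: bin_poly (t j).2).
have Pt j : ((t j).1.2 != 0) && ((normc (t j).1.2 * s <= 1) && (1 < normc (t j).1.2 * rho)).
  by apply: (allP PE); exact: mem_nth.
split=> [j|].
  have /and3P[m0 ms mrho] := Pt j; have nm0 : 0 < normc (t j).1.2 by rewrite normc_gt0.
  rewrite normcVE; apply/andP; split.
    rewrite invf_gt1//; apply: (@lt_le_trans _ _ (normc (t j).1.2 * s)) => //.
    by rewrite ltr_pMr.
  by rewrite -[X in X < _]mul1r ltr_pdivrMr// mulrC.
apply/limn_esup_radius => //.
rewrite (_ : (fun n => _) = fun n => x n - bin_exp_sum E n)//.
apply/funext => n; congr (_ - _); rewrite /bin_exp_sum (big_nth (0, 0, 0%N)) big_mkord.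
apply: eq_bigr => j _; rewrite hornerZ bin_polyE /bin_exp -/(t j).
by rewrite exprVn invrK.
Qed.

End Asymptotics.

(** * The Geronimo-Case recursion *)

Section GeronimoCase.
Variable R : realType.
Local Notation C := R[i].
Variables (xo xe : nat -> C).
Implicit Types (h k : nat -> C) (r s K th : R).

Local Notation mulz := (@mulz R).

Lemma mulz0 (c : nat -> C) : mulz c 0 = 0. Proof. by []. Qed.
Lemma mulzS (c : nat -> C) j : mulz c j.+1 = c j. Proof. by []. Qed.

Definition one_seq : nat -> C := fun j => (j == 0%N)%:R.

(** With xo_n = - b_(n+1) and xe_n = 1 - a_(n+1)^2 the first component is the polynomial
c_n(z) = z^n P_n(z + 1/z), where P_n is the n-th monic orthogonal polynomial, and the
second one is g_n = c_n - a_n^2 z^2 c_(n-1). Both are given by their coefficients. *)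
Fixpoint gc_pair (n : nat) : (nat -> C) * (nat -> C) :=
  if n is m.+1 then
    let: (c, g) := gc_pair m in
    (add (add (mulz (mulz c)) (scal (xo m) (mulz c))) g,
     add g (add (scal (xo m) (mulz c)) (scal (xe m) (mulz (mulz c)))))
  else (one_seq, one_seq).

Definition gc n := (gc_pair n).1.
Definition gg n := (gc_pair n).2.

Lemma gcS n : gc n.+1 = add (add (mulz (mulz (gc n))) (scal (xo n) (mulz (gc n)))) (gg n).
Proof. by rewrite /gc /gg /=; case: (gc_pair n). Qed.

Lemma ggS n : gg n.+1 =
  add (gg n) (add (scal (xo n) (mulz (gc n))) (scal (xe n) (mulz (mulz (gc n))))).
Proof. by rewrite /gc /gg /=; case: (gc_pair n). Qed.

Lemma gg_sum n j : gg n j = one_seq j +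
  \sum_(i < n) (xo i * mulz (gc i) j + xe i * mulz (mulz (gc i)) j).
Proof.
elim: n => [|n IH]; first by rewrite big_ord0 addr0.
by rewrite ggS big_ord_recr /= addrA -IH.
Qed.

Definition gd n j := gc n.+1 j - gc n j.

(** The differences c_(n+1) - c_n are multiplied by z^2 at each step, up to terms carrying
a decaying parameter; this makes the c_n converge coefficientwise. *)
Lemma gdS n j : gd n.+1 j = mulz (mulz (gd n)) j +
  (xo n.+1 * mulz (gc n.+1) j + xe n * mulz (mulz (gc n)) j).
Proof.
rewrite /gd (gcS n.+1) ggS /add /scal.
case: j => [|[|j]] /=; rewrite gcS /add /scal /=; ring.
Qed.

Lemma gd0 j : gd 0 j = mulz (mulz one_seq) j + xo 0%N * mulz one_seq j.
Proof. by rewrite /gd gcS /add /scal /gc /gg /=; ring. Qed.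

Lemma gc_three_term n j : gc n.+2 j = gc n.+1 j + mulz (mulz (gc n.+1)) j -
  mulz (mulz (gc n)) j + xo n.+1 * mulz (gc n.+1) j + xe n * mulz (mulz (gc n)) j.
Proof.
have := gdS n j; rewrite {1}/gd => /(congr1 (fun x => x + gc n.+1 j)); rewrite subrK => ->.
by case: j => [|[|j]]; rewrite /mulz /= /gd; ring.
Qed.

Lemma gc_support n j : (2 * n < j)%N -> gc n j = 0.
Proof.
suff h : (forall j, (2 * n < j)%N -> gc n j = 0) /\ (forall j, (2 * n < j)%N -> gg n j = 0).
  by case: h => h _; exact: h.
elim: n => {j} [|n [IHc IHg]]; first by split=> -[|j].
rewrite gcS ggS /add /scal; split=> -[|[|j]] jn; try by lia.
  by rewrite /= IHc; last lia; rewrite IHc; [|lia]; rewrite IHg; [ring|lia].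
by rewrite /= IHc; last lia; rewrite IHc; [|lia]; rewrite IHg; [ring|lia].
Qed.

(** P_n(z + 1/z) is invariant under the exchange of z and 1/z. *)
Lemma gc_palindrome n i j : (i + j = 2 * n)%N -> gc n i = gc n j.
Proof.
suff h : (forall i j, (i + j = 2 * n)%N -> gc n i = gc n j) /\
    (forall i j, (i + j = 2 * n.+1)%N -> gc n.+1 i = gc n.+1 j).
  by case: h => h _; exact: h.
elim: n => {i j} [|n [IH1 IH2]].
  split; first by move=> [|i] [|j].
  move=> i j ij; have /orP : (i == 1%N) || (i != 1%N) by case: eqP.
  rewrite gcS /add /scal /gc /gg /=.
  case: i ij => [|[|[|i]]]; case: j => [|[|[|j]]] //= ij _; try lia;
    rewrite /one_seq /=; ring.
split; first exact: IH2.
move=> i j; rewrite !gc_three_term.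
have z1 (k : nat) : (2 * n.+1 < k)%N -> gc n.+1 k = 0 by exact: gc_support.
have z0 (k : nat) : (2 * n < k)%N -> gc n k = 0 by exact: gc_support.
case: i => [|[|i]]; case: j => [|[|j]] ij; rewrite /mulz /=; try lia.
- rewrite (z1 j.+2) ?(z1 j.+1) ?(z0 j); [|lia|lia|lia].
  by rewrite (IH2 0%N j); [ring|lia].
- rewrite (z1 j.+2) ?(z0 j); [|lia|lia].
  by rewrite (IH2 1%N j) ?(IH2 0%N j.+1); [ring|lia|lia].
- rewrite (z1 i.+2) ?(z1 i.+1) ?(z0 i); [|lia|lia|lia].
  by rewrite (IH2 i 0%N); [ring|lia].
- rewrite (z1 i.+2) ?(z0 i); [|lia|lia].
  by rewrite (IH2 i 1%N) ?(IH2 i.+1 0%N); [ring|lia|lia].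
rewrite (IH2 i.+2 j) ?(IH2 i j.+2) ?(IH2 i.+1 j.+1) ?(IH1 i j); [ring|lia..].
Qed.

End GeronimoCase.

Lemma uphalf_bounds (j m : nat) :
  (j <= 2 * (uphalf j + m))%N && (m <= 2 * (uphalf j + m) - j)%N.
Proof. lia. Qed.

Lemma lt_uphalf (j n : nat) : (n < uphalf j)%N -> (2 * n < j)%N.
Proof. lia. Qed.

Section GeronimoCaseBounds.
Variable R : realType.
Local Notation C := R[i].
Variables (xo xe : nat -> C) (s0 : R).
Hypothesis s01 : 1 < s0.
Hypothesis Ho : radius_ge (s0 ^+ 2) xo.
Hypothesis He : radius_ge (s0 ^+ 2) xe.
Implicit Types (h k : nat -> C) (r s K th p : R).

Local Notation mulz := (@mulz R).
Local Notation gc := (gc xo xe).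
Local Notation gg := (gg xo xe).
Local Notation gd := (gd xo xe).

Lemma mulz_bound K th (c : nat -> C) j : 0 <= K -> 0 < th ->
  (forall i, normc (c i) <= K * th ^+ i) -> normc (mulz c j) <= K / th * th ^+ j.
Proof.
move=> K0 th0 cK; case: j => [|j].
  by rewrite mulz0 normc0E mulr_ge0 ?exprn_ge0 ?divr_ge0// ltW.
by rewrite mulzS exprS mulrA divfK ?gt_eqF.
Qed.

(** A Gronwall argument: the majorant M of the differences is multiplied by 1 + a q^n at
step n, and the product of these factors is bounded. *)
Lemma gc_bound th : 1 < th -> th < s0 -> exists2 K, 0 <= K & forall n j,
  normc (gc n j) <= K * th ^+ j /\ normc (gd n j) <= K * th^-2 ^+ n * th ^+ j.
Proof.
move=> th1 ths0; have th0 : 0 < th by exact: lt_trans th1.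
have [sg [thsg sgs sg1]] : exists sg, [/\ th ^+ 2 < sg, sg < s0 ^+ 2 & 1 < sg].
  have h : th ^+ 2 < s0 ^+ 2 by rewrite ltrXn2r ?nnegrE ?(ltW th0) ?(ltW (lt_trans th0 ths0)).
  have h1 : 1 < th ^+ 2 by rewrite exprn_egt1.
  by exists ((th ^+ 2 + s0 ^+ 2) / 2); split; lra.
have sg0 : 0 < sg by exact: lt_trans sg1.
have [Ko hKo] := Ho sg0 sgs; have [Ke hKe] := He sg0 sgs.
have Ko0 := geo_ge0 hKo; have Ke0 := geo_ge0 hKe.
pose q := th ^+ 2 / sg.
have q0 : 0 <= q by rewrite divr_ge0 ?exprn_ge0 ?(ltW th0) ?(ltW sg0).
have q1 : q < 1 by rewrite ltr_pdivrMr// mul1r.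
pose t := th^-2.
have t0 : 0 <= t by rewrite invr_ge0 exprn_ge0// ltW.
have t1 : t < 1 by rewrite invf_lt1 ?exprn_gt0// exprn_egt1.
have tth : t * th ^+ 2 = 1 by rewrite mulVf// expf_neq0// gt_eqF.
pose A := 1 + (1 - t)^-1.
have A0 : 0 <= A by rewrite addr_ge0// invr_ge0 subr_ge0 ltW.
pose a := (Ko * th + Ke) * A.
have a0 : 0 <= a by rewrite mulr_ge0// addr_ge0// mulr_ge0// ltW.
pose M n := (1 + normc (xo 0%N)) * \prod_(i < n) (1 + a * q ^+ i).
have f1 i : 1 <= 1 + a * q ^+ i by rewrite lerDl mulr_ge0// exprn_ge0.
have M0 n : 0 <= M n.
  rewrite mulr_ge0 ?addr_ge0 ?normc_ge0// prodr_ge0// => i _.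
  exact: le_trans (f1 i).
have MS n : M n.+1 = M n * (1 + a * q ^+ n) by rewrite /M big_ord_recr /= mulrA.
have Mle n : M n <= M n.+1 by rewrite MS ler_peMr.
have Mbound n : M n <= (1 + normc (xo 0%N)) * expR (a / (1 - q)).
  rewrite ler_wpM2l ?addr_ge0 ?normc_ge0//.
  apply: (@le_trans _ _ (expR (a * \sum_(i < n) q ^+ i))).
    rewrite mulr_sumr expR_sum; apply: ler_prod => i _.
    by rewrite (le_trans ler01 (f1 i)) expR_ge1Dx.
  by rewrite ler_expR ler_wpM2l// geometric_sum_le.
pose Sg n := 1 + \sum_(i < n) t ^+ i.
have SgA n : Sg n <= A by rewrite lerD2l geometric_sum_le.
have Sg0 n : 0 <= Sg n.
  by rewrite addr_ge0// sumr_ge0// => i _; rewrite exprn_ge0.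
have M00 : M 0%N = 1 + normc (xo 0%N) by rewrite /M big_ord0 mulr1.
have A1 : 1 <= A by rewrite /A lerDl invr_ge0 subr_ge0 ltW.
clearbody M A.
have claim n : (forall j, normc (gd n j) <= M n * t ^+ n * th ^+ j) /\
    (forall j, normc (gc n j) <= M n * Sg n * th ^+ j).
  elim: n => [|n [IHd IHc]].
    have x0 := normc_ge0 (xo 0%N).
    have oS i : one_seq R i.+1 = 0 by [].
    have o0 : one_seq R 0 = 1 by [].
    split=> j.
      rewrite gd0 expr0 mulr1 M00; case: j => [|[|[|j]]]; rewrite ?(mulz0, mulzS, oS, o0).
      - by rewrite mulr0 addr0 normc0E expr0 mulr1 addr_ge0.
      - rewrite add0r mulr1 expr1.
        apply: (@le_trans _ _ (1 + normc (xo 0%N))); first by rewrite lerDr.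
        by rewrite ler_peMr ?addr_ge0// ltW.
      - rewrite mulr0 addr0 normc1E.
        apply: (@le_trans _ _ (1 + normc (xo 0%N))); first by rewrite lerDl.
        by rewrite ler_peMr ?addr_ge0// exprn_ege1// ltW.
      - by rewrite mulr0 addr0 normc0E mulr_ge0 ?addr_ge0 ?exprn_ge0// ltW.
    rewrite /Sg big_ord0 addr0 mulr1 M00; case: j => [|j].
      by rewrite -[gc 0 0%N]/(1 : C) normc1E expr0 mulr1 lerDl.
    by rewrite -[gc 0 j.+1]/(0 : C) normc0E mulr_ge0 ?addr_ge0 ?exprn_ge0// ltW.
  have cn1 j : normc (gc n.+1 j) <= M n * Sg n.+1 * th ^+ j.
    have -> : gc n.+1 j = gc n j + gd n j by rewrite /gd addrC subrK.
    rewrite (le_trans (normcDle _ _))// /Sg big_ord_recr /= addrA -/(Sg n).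
    rewrite mulrDr mulrDl lerD//.
  have MSg m : M n * Sg m <= M n * A by rewrite ler_wpM2l.
  have MA0 : 0 <= M n * A by rewrite mulr_ge0.
  split=> [j|j]; last first.
    rewrite (le_trans (cn1 j))// ler_wpM2r ?exprn_ge0 ?(ltW th0)//.
    by rewrite ler_wpM2r.
  have cA i : normc (gc n.+1 i) <= M n * A * th ^+ i.
    by rewrite (le_trans (cn1 i))// ler_wpM2r ?exprn_ge0 ?(ltW th0).
  have cA' i : normc (gc n i) <= M n * A * th ^+ i.
    by rewrite (le_trans (IHc i))// ler_wpM2r ?exprn_ge0 ?(ltW th0).
  have e1 : normc (mulz (mulz (gd n)) j) <= M n * t ^+ n.+1 * th ^+ j.
    have Mt : 0 <= M n * t ^+ n by rewrite mulr_ge0 ?exprn_ge0.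
    have h1 i := mulz_bound i Mt th0 IHd.
    have Mt' : 0 <= M n * t ^+ n / th by rewrite divr_ge0 ?(ltW th0).
    have := mulz_bound j Mt' th0 h1.
    by rewrite exprSr /t !mulrA -[th^-2]exprVn expr2 !mulrA.
  have e2 : normc (xo n.+1 * mulz (gc n.+1) j) <= Ko * th * A * q ^+ n * M n * t ^+ n.+1 * th ^+ j.
    rewrite normcME.
    apply: (@le_trans _ _ ((Ko * sg^-1 ^+ n.+1) * (M n * A / th * th ^+ j))).
      by rewrite ler_pM ?normc_ge0//; exact: mulz_bound.
    rewrite [leLHS](_ : _ = Ko * th * A * M n * th ^+ j * (sg^-1 ^+ n.+1 * t)); last first.
      by rewrite /t; field; rewrite gt_eqF.
    rewrite [leRHS](_ : _ = Ko * th * A * M n * th ^+ j * (q ^+ n * t ^+ n.+1)); last by ring.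
    rewrite ler_wpM2l ?mulr_ge0 ?exprn_ge0 ?(ltW th0)//.
    rewrite exprSr [t ^+ n.+1]exprSr mulrA ler_wpM2r// -exprMn.
    have -> : q * t = sg^-1 by rewrite /q mulrAC mulrC [th ^+ 2 * t]mulrC tth mulr1.
    by rewrite ler_piMr ?exprn_ge0 ?invr_ge0 ?(ltW sg0)// invf_le1// ltW.
  have e3 : normc (xe n * mulz (mulz (gc n)) j) <= Ke * A * q ^+ n * M n * t ^+ n.+1 * th ^+ j.
    rewrite normcME.
    have h1 i := mulz_bound i MA0 th0 cA'.
    have MA' : 0 <= M n * A / th by rewrite divr_ge0 ?(ltW th0).
    apply: (@le_trans _ _ ((Ke * sg^-1 ^+ n) * (M n * A / th / th * th ^+ j))).
      by rewrite ler_pM ?normc_ge0//; exact: mulz_bound.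
    rewrite [leLHS](_ : _ = Ke * A * M n * th ^+ j * (sg^-1 ^+ n * t)); last first.
      by rewrite /t; field; rewrite gt_eqF.
    rewrite [leRHS](_ : _ = Ke * A * M n * th ^+ j * (q ^+ n * t ^+ n.+1)); last by ring.
    rewrite ler_wpM2l ?mulr_ge0 ?exprn_ge0 ?(ltW th0)//.
    rewrite [t ^+ n.+1]exprSr mulrA ler_wpM2r// -exprMn.
    by have -> : q * t = sg^-1 by rewrite /q mulrAC mulrC [th ^+ 2 * t]mulrC tth mulr1.
  rewrite gdS (le_trans (normcDle _ _))//.
  rewrite MS mulrDr mulr1 !mulrDl lerD// (le_trans (normcDle _ _))//.
  rewrite (le_trans (lerD e2 e3))// le_eqVlt; apply/orP; left; apply/eqP.
  by rewrite /a; ring.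
pose K := (1 + normc (xo 0%N)) * expR (a / (1 - q)) * A.
have K0 : 0 <= K by rewrite !mulr_ge0 ?addr_ge0 ?normc_ge0 ?expR_ge0.
exists K => // n j; have [dn cn] := claim n; split.
  rewrite (le_trans (cn j))// ler_wpM2r ?exprn_ge0 ?(ltW th0)//.
  by rewrite ler_pM.
rewrite (le_trans (dn j))// ler_wpM2r ?exprn_ge0 ?(ltW th0)// ler_wpM2r ?exprn_ge0//.
by rewrite (le_trans (Mbound n))// ler_peMr ?mulr_ge0 ?addr_ge0 ?normc_ge0 ?expR_ge0.
Qed.

(** The limit of c_n; it is u / (1 - z^2). *)
Definition gv (j : nat) : C := gc 0 j + csum (fun n => gd n j).

Lemma gc_sum_gd n j : gc n j = gc 0 j + \sum_(i < n) gd i j.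
Proof.
elim: n => [|n IH]; first by rewrite big_ord0 addr0.
by rewrite big_ord_recr /= addrA -IH /gd addrC subrK.
Qed.

Lemma gc_gv_bound th : 1 < th -> th < s0 -> exists2 K, 0 <= K & forall n j,
  normc (gc n j - gv j) <= K * th^-2 ^+ n * th ^+ j.
Proof.
move=> th1 ths0; have th0 : 0 < th by exact: lt_trans th1.
have [K K0 hK] := gc_bound th1 ths0.
have q0 : 0 <= th^-2 by rewrite invr_ge0 exprn_ge0// ltW.
have q1 : th^-2 < 1 by rewrite invf_lt1 ?exprn_gt0// exprn_egt1.
exists (K / (1 - th^-2)); first by rewrite divr_ge0// subr_ge0 ltW.
move=> n j; have g : geo (K * th ^+ j) (th ^- 2) (fun n => gd n j).
  by move=> m; rewrite mulrAC; have [_ ] := hK m j.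
have := csum_tail n q0 q1 g; rewrite [normc (gc n j - _)]normc_distC gc_sum_gd /gv.
rewrite (_ : gc 0 j + _ - _ = csum (fun n => gd n j) - \sum_(i < n) gd i j); last by ring.
by move/le_trans; apply; rewrite le_eqVlt; apply/orP; left; apply/eqP; ring.
Qed.

Lemma radius_ge_gv : radius_ge 1 gv.
Proof.
move=> s s_gt0 s1; have is1 : 1 < s^-1 by rewrite invf_gt1.
have [th [th1 ths0 ths]] : exists th, [/\ 1 < th, th < s0 & th <= s^-1].
  have h : 1 < Num.min s0 s^-1 by rewrite lt_min s01.
  have m1 : Num.min s0 s^-1 <= s0 by rewrite ge_min lexx.
  have m2 : Num.min s0 s^-1 <= s^-1 by rewrite ge_min lexx orbT.
  by exists ((1 + Num.min s0 s^-1) / 2); split; lra.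
have th0 : 0 < th by exact: lt_trans th1.
have [K K0 hK] := gc_gv_bound th1 ths0.
exists (1 + K) => j; have -> : gv j = gc 0 j - (gc 0 j - gv j) by ring.
have thj : th ^+ j <= s^-1 ^+ j by rewrite lerXn2r ?nnegrE ?(ltW th0)// ltW// (lt_trans ltr01).
rewrite (le_trans (normcBle _ _))// mulrDl lerD//.
  rewrite mul1r; case: j thj => [|j] thj; first by rewrite -[gc 0 0%N]/(1 : C) normc1E expr0.
  by rewrite -[gc 0 j.+1]/(0 : C) normc0E exprn_ge0// invr_ge0 ltW.
by rewrite (le_trans (hK 0%N j))// expr0 mulr1 ler_wpM2l.
Qed.

(** S[h] = sum of the h_n c_n. The recursion for the g_n expresses their limit u through
S[xo] and S[xe], so S carries the dependence of u on the parameters. *)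
Definition gS h (j : nat) : C := csum (fun n => h n * gc n j).

Lemma radius_gt1_geo p h : 1 < p -> radius_ge p h -> exists K q, [/\ 0 <= q, q < 1 & geo K q h].
Proof.
move=> p1 H; have [s [sgt0 sp s1]] := mid_radius ler01 p1.
have [K hK] := H s sgt0 sp; exists K, s^-1; split=> //.
- by rewrite invr_ge0 ltW.
- by rewrite invf_lt1.
Qed.

Lemma gS_dominated p h j : 1 < p -> radius_ge p h -> geometric_dominated (fun n => h n * gc n j).
Proof.
move=> p1 /(radius_gt1_geo p1)[K [q [q0 q1 hK]]].
have [th [th0 ths0 th1]] := mid_radius ler01 s01.
have [K' K'0 hK'] := gc_bound th1 ths0.
exists (K * (K' * th ^+ j)), q; split=> // n.
rewrite normcME mulrAC ler_pM ?normc_ge0//.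
by have [] := hK' n j.
Qed.

(** Abel summation in the recursion of the g_n. *)
Lemma csum_tail_swap K K' q q' (f k : nat -> C) : 0 <= q -> q < 1 -> 0 <= q' -> q' < 1 ->
  geo K q f -> geo K' q' k ->
  csum (fun n => k n * \sum_(i < n) f i) = csum (fun i => f i * csum (fun m => k (i.+1 + m)%N)).
Proof.
move=> q0 q1 q'0 q'1 fK kK; have K0 := geo_ge0 fK; have K'0 := geo_ge0 kK.
pose b i n : C := if (i < n)%N then f i * k n else 0.
transitivity (csum (fun n => csum (fun i => b i n))).
  congr csum; apply/funext => n; rewrite (@csum_fin _ n) => [|i ni].
    by rewrite mulr_sumr; apply: eq_bigr => i _; rewrite /b ltn_ord mulrC.
  by rewrite /b ltnNge ni.
have bb i j : normc (b i j) <= K * K' * q ^+ i * q' ^+ j.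
  rewrite /b; case: ifP => _; last by rewrite normc0E !mulr_ge0 ?exprn_ge0.
  rewrite normcME; apply: (@le_trans _ _ (K * q ^+ i * (K' * q' ^+ j))).
    by rewrite ler_pM ?normc_ge0.
  by rewrite le_eqVlt; apply/orP; left; apply/eqP; ring.
rewrite -(csum_swap q0 q1 q'0 q'1 bb); congr csum; apply/funext => i.
have db : geometric_dominated (b i) by exists (K * K' * q ^+ i), q'; split=> // j; exact: bb.
rewrite (csum_split i.+1 db) big1 ?add0r => [|j _].
  have dk : geometric_dominated (fun m => k (i.+1 + m)%N).
    by exists (K' * q' ^+ i.+1), q'; split=> // m; rewrite -mulrA -exprD.
  rewrite -csumZ//; congr csum; apply/funext => m.
  by rewrite /b leq_addr.
by rewrite /b ltnNge -ltnS ltn_ord.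
Qed.

Lemma gSD p h k : 1 < p -> radius_ge p h -> radius_ge p k -> gS (add h k) = add (gS h) (gS k).
Proof.
move=> p1 H H'; apply/funext => j; rewrite /gS /add -csumD.
- by congr csum; apply/funext => n; rewrite mulrDl.
- exact: gS_dominated p1 H.
- exact: gS_dominated p1 H'.
Qed.

Lemma gSZ p a h : 1 < p -> radius_ge p h -> gS (scal a h) = scal a (gS h).
Proof.
move=> p1 H; apply/funext => j; rewrite /gS /scal -csumZ; last exact: gS_dominated p1 H.
by congr csum; apply/funext => n; rewrite mulrA.
Qed.

Lemma radius_ge_xmul p x h : 1 < p -> radius_ge (s0 ^+ 2) x -> radius_ge p h -> radius_ge p (mul x h).
Proof.
move=> p1 X H; have s2 : 1 < s0 ^+ 2 by rewrite exprn_egt1.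
apply: (@radius_ge_le _ _ (s0 ^+ 2 * p)); first by rewrite ler_peMl ?ltW// (lt_trans ltr01).
by apply: radius_ge_mul => //; apply: lt_trans ltr01 _.
Qed.

Lemma radius_ge_tau p h : 1 < p -> radius_ge p h -> radius_ge p (tau h).
Proof.
move=> p1; apply: (@radius_ge_opT _ 1) => //; rewrite ?mul1r//.
  exact: lt_trans p1.
exact: radius_ge1.
Qed.

Lemma tau_recl p h : 1 < p -> radius_ge p h -> tau h = add h (tau (shl h)).
Proof.
move=> p1 H; have p0 : 0 < p by exact: lt_trans p1.
have p1' : 1 < 1 * p by rewrite mul1r.
rewrite /tau (opT_recl ltr01 p0 p1' (@radius_ge1 R) H).
by apply/funext => n; rewrite /add /scal mul1r.
Qed.

Lemma tauE h i : tau h i = csum (fun m => h (i + m)%N).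
Proof. by rewrite /tau /opT; congr csum; apply/funext => m; rewrite mul1r. Qed.

(** The recursion expresses c_(n+1) through c_n and the sum defining g_n; summed
against k by parts, it shows that T^2 - l acts on S[k] as T - l on k, up to terms
quadratic in the parameters. *)
Lemma gS_shl2 p k : 1 < p -> radius_ge p k ->
  shl (shl (gS k)) = add (gS (shl k))
    (add (shl (gS (mul xo (tau (shl k))))) (gS (mul xe (tau (shl (shl k)))))).
Proof.
move=> p1 H; have Hs := radius_ge_shl H; have Hss := radius_ge_shl Hs.
have Ht := radius_ge_tau p1 Hss.
apply/funext => j; rewrite /shl /add.
have dS := gS_dominated j.+2 p1 H.
have dT := gS_dominated j p1 Hs.
have dxo := gS_dominated j.+1 p1 (radius_ge_xmul p1 Ho Hs).
pose G i := xo i * gc i j.+1 + xe i * gc i j.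
have ggE n : gg n j.+2 = \sum_(i < n) G i by rewrite gg_sum add0r.
have [Kk [q [q0 q1 hk]]] := radius_gt1_geo p1 Hs.
have [th [th0 ths0 th1]] := mid_radius ler01 s01.
have [K K0 hK] := gc_bound th1 ths0.
have s21 : 1 < s0 ^+ 2 by rewrite exprn_egt1.
have [Ko [qo [qo0 qo1 hKo]]] := radius_gt1_geo s21 Ho.
have [Ke [qe [qe0 qe1 hKe]]] := radius_gt1_geo s21 He.
have dG1 : geometric_dominated (fun i => xo i * gc i j.+1) := gS_dominated j.+1 s21 Ho.
have dG2 : geometric_dominated (fun i => xe i * gc i j) := gS_dominated j s21 He.
have [KG [qG [qG0 qG1 hG]]] : geometric_dominated G := geometric_dominatedD dG1 dG2.
have dgg : geometric_dominated (fun n => k n.+1 * gg n j.+2).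
  exists (Kk * (KG / (1 - qG))), q; split=> // n.
  rewrite normcME mulrAC ler_pM ?normc_ge0//; first exact: hk.
  rewrite ggE (le_trans (normc_sum _ _ _))//.
  apply: (@le_trans _ _ (\sum_(i < n) KG * qG ^+ i)); first by apply: ler_sum => i _; exact: hG.
  by rewrite -mulr_sumr ler_wpM2l ?(geo_ge0 hG)// geometric_sum_le.
have E1 : gS k j.+2 = csum (fun n => shl k n * gc n j + (mul xo (shl k) n * gc n j.+1 + k n.+1 * gg n j.+2)).
  rewrite /gS csum_recl// -[gc 0 j.+2]/(0 : C) mulr0 add0r.
  by congr csum; apply/funext => n; rewrite gcS /add /scal /mul /shl !mulzS; ring.
rewrite E1 csumD//; last exact: geometric_dominatedD.
congr (_ + _); rewrite csumD//.
have -> : csum (fun n => k n.+1 * gg n j.+2) = csum (fun i => G i * tau (shl (shl k)) i).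
  rewrite (_ : (fun n => _) = fun n => shl k n * \sum_(i < n) G i); last first.
    by apply/funext => n; rewrite ggE.
  rewrite (csum_tail_swap qG0 qG1 q0 q1 hG hk); congr csum; apply/funext => i.
  by rewrite tauE.
have dxo' := gS_dominated j.+1 p1 (radius_ge_xmul p1 Ho Ht).
have dxe' := gS_dominated j p1 (radius_ge_xmul p1 He Ht).
have -> : csum (fun i => G i * tau (shl (shl k)) i) =
    gS (mul xo (tau (shl (shl k)))) j.+1 + gS (mul xe (tau (shl (shl k)))) j.
  rewrite /gS -csumD//; congr csum; apply/funext => i; rewrite /G /mul; ring.
rewrite addrA; congr (_ + _).
rewrite -[csum _]/(gS (mul xo (shl k)) j.+1) (tau_recl p1 Hs).
rewrite (_ : mul xo (add _ _) = add (mul xo (shl k)) (mul xo (tau (shl (shl k))))).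
  by rewrite (gSD p1 (radius_ge_xmul p1 Ho Hs) (radius_ge_xmul p1 Ho Ht)).
by apply/funext => n; rewrite /mul /add mulrDr.
Qed.

Lemma gS_sub_shl p k l : 1 < p -> radius_ge p k ->
  (fun j => gS k j.+2 - l * gS k j) = add (gS (sub_shl l k))
    (add (shl (gS (mul xo (tau (shl k))))) (gS (mul xe (tau (shl (shl k)))))).
Proof.
move=> p1 H; have := gS_shl2 p1 H => E; apply/funext => j.
have -> : gS k j.+2 = shl (shl (gS k)) j by [].
rewrite E sub_shlE (gSD p1 (radius_ge_shl H) (radius_geZ _ H)) (gSZ _ p1 H).
by rewrite /add /scal; ring.
Qed.

(** As c_n has degree 2 n, only the h_n with n >= j/2 enter the j-th coefficient. *)
Lemma radius_ge_gS p h r : 1 < r -> r ^+ 2 <= p -> radius_ge p h -> radius_ge r (gS h).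
Proof.
move=> r1 rp H; apply: (@radius_ge_near _ 1) => // s s_gt0 s1 sr.
have sp : s ^+ 2 < p.
  by apply: lt_le_trans rp; rewrite ltrXn2r ?nnegrE ?(ltW s_gt0) ?(ltW (lt_trans s_gt0 sr)).
have s20 : 0 < s ^+ 2 by rewrite exprn_gt0.
have [Kh hKh] := H _ s20 sp.
have [th [th1 ths0 ths]] : exists th, [/\ 1 < th, th < s0 & th < s].
  have h1 : 1 < Num.min s0 s by rewrite lt_min s01.
  have m1 : Num.min s0 s <= s0 by rewrite ge_min lexx.
  have m2 : Num.min s0 s <= s by rewrite ge_min lexx orbT.
  by exists ((1 + Num.min s0 s) / 2); split; lra.
have th0 : 0 < th by exact: lt_trans th1.
have [K K0 hK] := gc_bound th1 ths0.
have q0 : 0 <= th / s by rewrite divr_ge0 ?(ltW th0) ?(ltW s_gt0).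
have q1 : th / s < 1 by rewrite ltr_pdivrMr// mul1r.
exists (Kh * K / (1 - th / s)) => j; rewrite /gS.
rewrite (csum_split (uphalf j)); last first.
  apply: (@gS_dominated (s ^+ 2)) => //; first by rewrite exprn_egt1.
  by apply: radius_ge_le H; exact: ltW.
rewrite big1 ?add0r => [|n _]; last first.
  by rewrite gc_support ?mulr0// lt_uphalf.
rewrite mulrAC; apply: normc_csum => // m.
set n := (uphalf j + m)%N.
rewrite normcME.
have /andP[jn mn] := uphalf_bounds j m; rewrite -/n in jn mn.
have -> : gc n j = gc n (2 * n - j)%N by apply: gc_palindrome; rewrite subnKC.
have [hc _] := hK n (2 * n - j)%N.
apply: (@le_trans _ _ (Kh * (s ^+ 2)^-1 ^+ n * (K * th ^+ (2 * n - j)))).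
  by rewrite ler_pM ?normc_ge0.
have -> : (s ^+ 2)^-1 ^+ n = s^-1 ^+ j * s^-1 ^+ (2 * n - j).
  by rewrite -exprVn -exprM -exprD subnKC.
rewrite [leLHS](_ : _ = Kh * K * s^-1 ^+ j * (th / s) ^+ (2 * n - j)); last first.
  by rewrite exprMn; ring.
rewrite ler_wpM2l ?mulr_ge0 ?exprn_ge0 ?invr_ge0 ?(ltW s_gt0) ?(geo_ge0 hKh)//.
by apply: ler_wiXn2l => //; exact: ltW.
Qed.

(** The Jost function, up to the factor prod a_n: the limit of the g_n. *)
Definition gU (j : nat) : C := one_seq R j +
  csum (fun i => xo i * mulz (gc i) j + xe i * mulz (mulz (gc i)) j).

Lemma s0_sqr_gt1 : 1 < s0 ^+ 2.
Proof. by rewrite exprn_egt1. Qed.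

Lemma gU_dominated j : geometric_dominated (fun i => xo i * mulz (gc i) j + xe i * mulz (mulz (gc i)) j).
Proof.
have z (x : nat -> C) : geometric_dominated (fun i => x i * 0).
  by apply: (@finite_geometric_dominated _ 0) => n _; rewrite mulr0.
apply: geometric_dominatedD.
  case: j => [|j]; first exact: z.
  exact: gS_dominated s0_sqr_gt1 Ho.
case: j => [|[|j]]; [exact: z|exact: z|].
exact: gS_dominated s0_sqr_gt1 He.
Qed.

Lemma gU_shl2 : shl (shl gU) = add (shl (gS xo)) (gS xe).
Proof.
apply/funext => j; rewrite /shl /add /gU add0r csumD//.
- exact: gS_dominated s0_sqr_gt1 Ho.
- exact: gS_dominated s0_sqr_gt1 He.
Qed.

Lemma gU0 : gU 0 = 1.
Proof.
rewrite /gU (_ : (fun i => _) = fun=> 0) ?csum0 ?addr0//.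
by apply/funext => i; rewrite !mulz0 !mulr0 addr0.
Qed.

Lemma gg_gU j : exists K q, [/\ 0 <= q, q < 1 & forall n, normc (gU j - gg n j) <= K * q ^+ n].
Proof.
have [K [q [q0 q1 h]]] := gU_dominated j; exists (K / (1 - q)), q; split=> // n.
rewrite gg_sum /gU opprD addrACA subrr add0r.
exact: csum_tail.
Qed.

(** The limit of c_(n+1) = z^2 c_n + xo_n z c_n + g_n is v = z^2 v + u. *)
Lemma gU_gv : gU = add gv (scal (-1) (mulz (mulz gv))).
Proof.
apply/funext => j; apply/subr0_eq.
have [K1 [q1 [q10 q11 h1]]] := gg_gU j.
have [th [th0 ths0 th1]] := mid_radius ler01 s01.
have [K2 K20 h2] := gc_gv_bound th1 ths0.
have t0 : 0 <= th ^- 2 by rewrite invr_ge0 exprn_ge0// ltW.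
have t1 : th ^- 2 < 1 by rewrite invf_lt1 ?exprn_gt0// exprn_egt1.
have [Ko [qo [qo0 qo1 hKo]]] := radius_gt1_geo s0_sqr_gt1 Ho.
have [K K0 hK] := gc_bound th1 ths0.
pose q := Num.max q1 (Num.max (th ^- 2) qo).
have q0 : 0 <= q by rewrite le_max q10.
have qlt1 : q < 1 by rewrite !gt_max q11 t1 qo1.
have qq1 n : q1 ^+ n <= q ^+ n by rewrite lerXn2r ?nnegrE// le_max lexx.
have qqt n : (th ^- 2) ^+ n <= q ^+ n by rewrite lerXn2r ?nnegrE// !le_max lexx orbT.
have qqo n : qo ^+ n <= q ^+ n by rewrite lerXn2r ?nnegrE// !le_max lexx !orbT.
have mz (c d : nat -> C) x (M : R) : 0 <= M -> (forall i, normc (c i - d i) <= M * th ^+ i) ->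
    normc (mulz c x - mulz d x) <= M * th ^+ x.
  move=> M0 cd; case: x => [|x]; first by rewrite !mulz0 subrr normc0E mulr_ge0// exprn_ge0// ltW.
  rewrite !mulzS (le_trans (cd x))// ler_wpM2l// exprS ler_peMl ?exprn_ge0 ?(ltW th0)//.
  exact: ltW.
have cb (c : nat -> C) x (M : R) : 0 <= M -> (forall i, normc (c i) <= M * th ^+ i) ->
    normc (mulz c x) <= M * th ^+ x.
  move=> M0 cM; have := mz c (mulz (fun=> 0)) x M M0.
  have z i : mulz (fun=> 0) i = 0 :> C by case: i.
  have z' i : mulz (mulz (fun=> 0)) i = 0 :> C by case: i => // i; rewrite mulzS z.
  by rewrite z' subr0; apply=> i; rewrite z subr0.
apply: (@geo_zero _ (K1 + (K2 * th ^+ j + (K2 * th ^+ j + Ko * (K * th ^+ j)))) q) => // n.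
have K10 : 0 <= K1 by have := h1 0%N; rewrite expr0 mulr1; apply: le_trans; exact: normc_ge0.
have Ko0 := geo_ge0 hKo.
have KT : 0 <= K2 * th ^- 2 ^+ n by rewrite mulr_ge0 ?exprn_ge0.
have thj : 0 <= th ^+ j by rewrite exprn_ge0// ltW.
have E : gU j - add gv (scal (-1) (mulz (mulz gv))) j =
   (gU j - gg n j) + ((gc n.+1 j - gv j) - (mulz (mulz (gc n)) j - mulz (mulz gv) j) - xo n * mulz (gc n) j).
  by rewrite gcS /add /scal; ring.
rewrite E (le_trans (normcDle _ _))// mulrDl lerD//.
  by rewrite (le_trans (h1 n))// ler_wpM2l.
have b1 : normc (gc n.+1 j - gv j) <= K2 * th ^+ j * q ^+ n.
  rewrite (le_trans (h2 n.+1 j))// mulrAC ler_wpM2l ?mulr_ge0//.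
  rewrite (le_trans _ (qqt n))// exprS ler_piMl ?exprn_ge0//.
  exact: ltW.
have b2 : normc (mulz (mulz (gc n)) j - mulz (mulz gv) j) <= K2 * th ^+ j * q ^+ n.
  have : normc (mulz (mulz (gc n)) j - mulz (mulz gv) j) <= K2 * th ^- 2 ^+ n * th ^+ j.
    by apply: (mz) => // i; apply: (mz) => // i'; exact: h2.
  by move/le_trans; apply; rewrite mulrAC ler_wpM2l ?mulr_ge0.
have b3 : normc (xo n * mulz (gc n) j) <= Ko * (K * th ^+ j) * q ^+ n.
  rewrite normcME mulrAC ler_pM ?normc_ge0//.
    by rewrite (le_trans (hKo n))// ler_wpM2l.
  by apply: cb => // i; have [] := hK n i.
apply: (@le_trans _ _ ((K2 * th ^+ j * q ^+ n + K2 * th ^+ j * q ^+ n) + Ko * (K * th ^+ j) * q ^+ n)).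
  by rewrite (le_trans (normcBle _ _))// lerD// (le_trans (normcBle _ _))// lerD.
by rewrite le_eqVlt; apply/orP; left; apply/eqP; ring.
Qed.

End GeronimoCaseBounds.

(** * Inverting a power series in the shift *)

Section InvertingPowerSeries.
Variable R : realType.
Local Notation C := R[i].
Implicit Types (h k u v w : nat -> C) (r s t p q : R).

Lemma conv_comm u v : conv u v = conv v u.
Proof.
apply/funext => m; rewrite /conv (reindex_inj rev_ord_inj) /=.
by apply: eq_bigr => i _; rewrite subSS mulrC subKn// -ltnS.
Qed.

Lemma conv_sub_shl l k u : conv (sub_shl l k) u =
  add (shl (conv k u)) (add (scal (- k 0%N) (shl u)) (scal (- l) (conv k u))).
Proof.
apply/funext => m; rewrite /add /shl /scal.
have -> : conv k u m.+1 = k 0%N * u m.+1 + \sum_(i < m.+1) k i.+1 * u (m - i)%N.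
  by rewrite /conv big_ord_recl subn0.
have -> : conv (sub_shl l k) u m =
    \sum_(i < m.+1) k i.+1 * u (m - i)%N + - l * conv k u m.
  rewrite /conv mulr_sumr -big_split /=; apply: eq_bigr => i _.
  by rewrite /sub_shl; ring.
ring.
Qed.

Lemma opT_delta h : opT (fun j => (j == 0%N)%:R) h = h.
Proof.
apply/funext => n; rewrite /opT (@csum_fin _ 1) => [|j]; last by case: j => // j _; rewrite mul0r.
by rewrite big_ord_recl big_ord0 addr0 mul1r addn0.
Qed.

Lemma opT_mulz t s v h : 0 < t -> 0 < s -> 1 < t * s -> radius_ge t v -> radius_ge s h ->
  opT (mulz v) h = opT v (shl h).
Proof.
move=> t0 s0 ts V H; rewrite (opT_recl t0 s0 ts (radius_ge_mulz V) H).
by apply/funext => n; rewrite /add /scal mul0r add0r.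
Qed.

(** 1/u is meromorphic in the unit disc, so that finitely many factors T - l and a
power series in T convergent in a disc |z| < s with s p > 1 invert u(T). *)
Lemma merom_opT_inv u w p q : 1 < p -> p <= q -> radius_ge 1 u -> u 0%N != 0 ->
  radius_ge p w -> merom 0 q (opT u w) -> merom 0 q w.
Proof.
move=> p1 pq U u0 W Huw.
have p0 : 0 < p by exact: lt_trans p1.
have p1' : 1 < 1 * p by rewrite mul1r.
have Ruw : radius_ge p (opT u w) by exact: (radius_ge_opT ltr01 p0 p1' U W).
have Pw : merom p q (opT u w) by exact: merom_prune Ruw Huw.
pose s := (p^-1 + 1) / 2.
have ip1 : p^-1 < 1 by rewrite invf_lt1.
have ip0 : 0 < p^-1 by rewrite invr_gt0.
have s0 : 0 < s by rewrite /s; lra.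
have s1 : s < 1 by rewrite /s; lra.
have sp : 1 < s * p.
  have : p^-1 < s by rewrite /s; lra.
  by rewrite -[X in X < _]mul1r ltr_pdivrMr.
clearbody s.
have [r r0 Hk] := radius_ge_inv_series ltr01 U u0.
have mk : merom 0 s (inv_series u).
  have m0 : 0 < Num.min r 1 by rewrite lt_min r0 ltr01.
  have m1 : Num.min r 1 <= 1 by rewrite ge_min lexx orbT.
  have m2 : Num.min r 1 <= r by rewrite ge_min lexx.
  apply: (@meromorphic_merom _ (fun z : C^o => (ps u z)^-1) 1 (Num.min r 1)) => //.
  - exact: radius_ge_le Hk.
  - move=> z zr; have := ps_conv (radius_ge_le m1 U) (radius_ge_le m2 Hk) zr.
    rewrite (conv_inv_series u0) ps_delta => /esym one.
    have n0 : ps u z != 0.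
      by apply/eqP => n0; move: one; rewrite n0 mul0r => /eqP; rewrite eq_sym oner_eq0.
    by apply: (mulfI n0); rewrite divff.
  - by move=> z z1; exact: meromorphic_at_inv_ps U z1.
suff h k : merom 0 s k -> radius_ge 1 (conv k u) -> merom 0 q (opT (conv k u) w).
  have := h _ mk; rewrite conv_comm (conv_inv_series u0) opT_delta; apply.
  have := @radius_ge_monomial R 1 1 0; congr (radius_ge 1).
  by apply/funext => n; case: (n == 0%N).
elim=> [{}k K _|l {}k _ _ IH V].
  rewrite -(opT_conv s0 p0 sp K _ W); last by apply: radius_ge_le U; exact: ltW.
  by apply: merom_le (merom_opT s0 p0 pq sp K Pw); first exact: ltW.
have V' : radius_ge 1 (conv (sub_shl l k) u).
  rewrite conv_sub_shl; apply: radius_geD; first exact: radius_ge_shl.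
  by apply: radius_geD; [apply: radius_geZ; exact: radius_ge_shl|exact: radius_geZ].
have {}IH := IH V'.
set Y := opT (conv k u) w.
set X := opT (conv (sub_shl l k) u) w in IH.
have RY : radius_ge p Y by exact: (radius_ge_opT ltr01 p0 p1' V W).
have W' := radius_ge_shl W.
(* the power series identity (1 - l z) k u = z ((T - l) k) u + k_0 u, read in T *)
have E : add Y (scal (- l) (shl Y)) = add (shl X) (scal (k 0%N) (opT u w)).
  rewrite /X -opT_shl conv_sub_shl.
  have Vs := radius_ge_shl V; have Us := radius_ge_shl U.
  rewrite (opTDl ltr01 p0 p1' Vs _ W'); last first.
    by apply: radius_geD; exact: radius_geZ.
  rewrite (opTDl ltr01 p0 p1' (radius_geZ _ Us) (radius_geZ _ V) W').
  rewrite (opTZl _ ltr01 p0 p1' Us W') (opTZl _ ltr01 p0 p1' V W').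
  have E1 := opT_recl ltr01 p0 p1' V W; have E2 := opT_recl ltr01 p0 p1' U W.
  have V0 : conv k u 0%N = k 0%N * u 0%N by rewrite /conv big_ord_recl big_ord0 addr0.
  apply/funext => n.
  have E1n := congr1 (fun f => f n) E1; have E2n := congr1 (fun f => f n) E2.
  rewrite /add /scal in E1n E2n *.
  rewrite -/Y V0 in E1n.
  have -> : opT (conv k u) (shl w) n = shl Y n by [].
  rewrite E2n {1}E1n; ring.
have HB : merom 0 q (add (shl X) (scal (k 0%N) (opT u w))).
  by apply: meromD; [exact: merom_shl|exact: meromZ].
rewrite -E in HB.
have [l0|l0] := eqVneq l 0.
  by rewrite (_ : Y = add Y (scal (- l) (shl Y)))//; apply/funext => n; rewrite /add /scal l0 oppr0 mul0r addr0.
apply: (@merom_step _ _ _ l^-1); first by rewrite mulr0.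
rewrite (_ : sub_shl _ _ = scal (- l^-1) (add Y (scal (- l) (shl Y)))); first exact: meromZ.
by apply/funext => n; rewrite /sub_shl /scal /add /shl; field; rewrite l0.
Qed.

(** * Interleaving *)

Definition interleave (yo ye : nat -> C) (n : nat) : C := if odd n then ye n./2 else yo n./2.

Lemma interleave_double yo ye n : interleave yo ye n.*2 = yo n.
Proof. by rewrite /interleave odd_double doubleK. Qed.

Lemma interleave_doubleS yo ye n : interleave yo ye n.*2.+1 = ye n.
Proof. by rewrite /interleave /= odd_double /= uphalf_double. Qed.

Lemma csum_pairs (f : nat -> C) : geometric_dominated f ->
  csum f = csum (fun n => f n.*2 + f n.*2.+1).
Proof.
move=> df; have [K [q [q0 q1 fq]]] := df; have K0 := geo_ge0 fq.
apply/esym; apply: (@csum_unique _ (K / (1 - q)) (q ^+ 2)).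
- exists (K + K), q; split=> // n; rewrite (le_trans (normcDle _ _))// mulrDl.
  by rewrite lerD// (le_trans (fq _))// ler_wpM2l//; apply: ler_wiXn2l => //;
    rewrite ?(ltW q1)// -addnn ?leq_addr// -addnS leq_addr.
- by rewrite exprn_ge0.
- by rewrite exprn_ilt1.
move=> N; rewrite -exprM mul2n.
rewrite (_ : \sum_(i < N) _ = \sum_(i < N.*2) f i); first exact: csum_tail.
elim: N => [|N IH]; first by rewrite !big_ord0.
by rewrite big_ord_recr /= IH doubleS !big_ord_recr /= addrA.
Qed.

Lemma radius_ge_interleave q yo ye : 0 < q -> radius_ge (q ^+ 2) yo -> radius_ge (q ^+ 2) ye ->
  radius_ge q (interleave yo ye).
Proof.
move=> q0 Yo Ye s s0 sq.
have s20 : 0 < s ^+ 2 by rewrite exprn_gt0.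
have sq2 : s ^+ 2 < q ^+ 2 by rewrite ltrXn2r ?nnegrE ?ltW.
have [Ko hKo] := Yo _ s20 sq2; have [Ke hKe] := Ye _ s20 sq2.
have Ko0 := geo_ge0 hKo; have Ke0 := geo_ge0 hKe.
have E n : (s ^+ 2)^-1 ^+ n = s^-1 ^+ n.*2 by rewrite -exprVn -exprM mul2n.
exists (Ko + Ke * s) => n; rewrite -[n]odd_double_half /interleave.
rewrite oddD odd_double addbF oddb halfD odd_double andbF add0n doubleK.
have -> : (odd n : nat)./2 = 0%N by case: (odd n).
rewrite add0n; set m := n./2.
have sm : 0 <= s^-1 ^+ m.*2 by rewrite exprn_ge0// invr_ge0 ltW.
case: (odd n); rewrite ?add0n ?add1n.
  rewrite (le_trans (hKe m))// E exprS mulrA ler_wpM2r// mulrDl mulfK ?gt_eqF// lerDr.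
  by rewrite divr_ge0// ltW.
by rewrite (le_trans (hKo m))// E ler_wpM2r// lerDl mulr_ge0// ltW.
Qed.

Lemma merom_interleave q yo ye : 0 < q -> merom 0 (q ^+ 2) yo -> merom 0 (q ^+ 2) ye ->
  merom 0 q (interleave yo ye).
Proof.
move=> q0 Ho; have sub l a b : (fun n => interleave a b n.+2 - l * interleave a b n) =
    interleave (sub_shl l a) (sub_shl l b).
  by apply/funext => n; rewrite /interleave /= negbK; case: (odd n).
elim: Ho ye => [{}yo Yo|l {}yo _ _ IH] ye He.
  elim: He yo Yo => [{}ye Ye|l {}ye _ _ IH] yo Yo.
    by apply: merom_base; exact: radius_ge_interleave.
  by apply: (@merom_sqr _ _ l); rewrite sub; apply: IH; exact: radius_ge_sub_shl.
by apply: (@merom_sqr _ _ l); rewrite sub; apply: IH; exact: merom_sub_shl.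
Qed.

Lemma radius_ge_double q h : 0 < q -> radius_ge q h -> radius_ge (q ^+ 2) (fun n => h n.*2).
Proof.
move=> q0 H s s0 sq; pose x := Num.sqrt s.
have xs : x ^+ 2 = s by rewrite sqr_sqrtr// ltW.
have x0 : 0 < x by rewrite sqrtr_gt0.
have xq : x < q by rewrite -(ltr_pXn2r (_ : 0 < 2)%N) ?nnegrE ?xs ?ltW.
have [K hK] := H x x0 xq; exists K => n.
by rewrite -xs -exprVn -exprM mul2n; exact: hK.
Qed.

(** On both parts together (T + l) (T - l) = T^2 - l^2 acts as T - l^2. *)
Lemma merom_double q h : 0 < q -> merom 0 q h ->
  merom 0 (q ^+ 2) (fun n => h n.*2) /\ merom 0 (q ^+ 2) (fun n => h n.*2.+1).
Proof.
move=> q0; elim=> [{}h H|l {}h _ _ [IHe IHo]].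
  split; apply: merom_base; first exact: radius_ge_double.
  exact: (radius_ge_double q0 (radius_ge_shl H)).
split; apply: (@merom_step _ _ _ (l ^+ 2)); rewrite ?mulr0//.
  rewrite (_ : sub_shl _ _ = add (fun n => sub_shl l h n.*2.+1) (scal l (fun n => sub_shl l h n.*2))).
    by apply: meromD => //; exact: meromZ.
  by apply/funext => n; rewrite /sub_shl /add /scal doubleS; ring.
rewrite (_ : sub_shl _ _ = add (shl (fun n => sub_shl l h n.*2)) (scal l (fun n => sub_shl l h n.*2.+1))).
  by apply: meromD; [exact: merom_shl|exact: meromZ].
by apply/funext => n; rewrite /sub_shl /add /scal /shl doubleS; ring.
Qed.

End InvertingPowerSeries.

(** The entry of index i of an interleaved sequence is paired with c_m, m = i/2 rounded
down, whose degree is 2 m. *)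
Lemma lt_support_even (i k : nat) : (i < k.+1)%N -> ~~ odd i -> (2 * i./2 < k.+1)%N.
Proof. lia. Qed.
Lemma lt_support_odd (i k : nat) : (i < k.+1)%N -> odd i -> (2 * i./2 < k)%N.
Proof. lia. Qed.
Lemma palindrome_even (j k : nat) : ~~ odd (k.+1 + j) -> (k.+1 + j = 2 * (k.+1 + j)./2)%N.
Proof. lia. Qed.
Lemma palindrome_odd (j k : nat) : odd (k.+1 + j) -> (k + j = 2 * (k.+1 + j)./2)%N.
Proof. lia. Qed.
Lemma half_lower (j k : nat) : (k + j <= 2 * (k.+1 + j)./2)%N.
Proof. lia. Qed.

(** * The Jacobi parameters and the Jost function *)

Section Equivalence.
Variable R : realType.
Local Notation C := R[i].
Variables (xo xe : nat -> C) (s0 : R).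
Hypothesis s01 : 1 < s0.
Hypothesis Ho : radius_ge (s0 ^+ 2) xo.
Hypothesis He : radius_ge (s0 ^+ 2) xe.
Implicit Types (h k : nat -> C) (r s K th p q P : R).

Local Notation gc := (gc xo xe).
Local Notation gS := (gS xo xe).
Local Notation gU := (gU xo xe).
Local Notation gv := (gv xo xe).
Local Notation sg := (s0 ^+ 2).

Let sg1 : 1 < sg. Proof. exact: s0_sqr_gt1. Qed.
Let sg0 : 0 < sg. Proof. exact: lt_trans ltr01 sg1. Qed.

(** Descending induction on m: the quadratic terms of the shift identity decay at
the rate m + 1. *)
Lemma merom_gS P q m h : 1 < q -> sg <= P -> q ^+ 2 <= P * sg ->
  merom sg P xo -> merom sg P xe -> (0 < m)%N -> merom (sg ^+ m) (q ^+ 2) h ->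
  merom 0 q (gS h).
Proof.
move=> q1 sP QP Xo Xe; set Q := q ^+ 2 in QP *.
have q0 : 0 < q by exact: lt_trans q1.
have Q0 : 0 < Q by rewrite exprn_gt0.
have Q1 : 1 < Q by rewrite exprn_egt1.
have P0 : 0 < P by exact: lt_le_trans sP.
have [N QN] : exists N, Q <= sg ^+ N.
  have [||| N] := @geometric_small R sg^-1 Q^-1.
  - by rewrite invr_ge0 ltW.
  - by rewrite invf_lt1.
  - by rewrite invr_gt0.
  have sgN : 0 < sg ^+ N by apply: exprn_gt0; exact: sg0.
  by rewrite exprVn ltf_pV2// => /ltW; exists N.
have base h' : radius_ge Q h' -> merom 0 q (gS h').
  by move=> H; apply: merom_base; exact: (radius_ge_gS s01 Ho He q1 (lexx _) H).
suff claim (k : nat) : forall m h, (0 < m)%N -> (N <= m + k)%N -> merom (sg ^+ m) Q h -> merom 0 q (gS h).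
  by move=> m0; apply: (claim N) => //; rewrite leq_addl.
elim: k => [|k IHk] {}m {}h m0 Nm H.
  apply: (base); apply: (merom_radius Q0 (lexx Q)); apply: merom_le H => //.
  apply: (le_trans QN); apply: ler_weXn2l; first exact: ltW.
  by rewrite addn0 in Nm.
have [Qm|mQ] := leP Q (sg ^+ m).
  by apply: (base); apply: (merom_radius Q0 (lexx Q)); apply: merom_le H.
have m1 : 1 < sg ^+ m by rewrite exprn_egt1// -lt0n.
have sgm0 : 0 < sg ^+ m by exact: lt_trans m1.
have quad x y : merom sg P x -> merom (sg ^+ m) Q y -> merom 0 q (gS (mul x (tau y))).
  move=> X Y; apply: (IHk m.+1) => //; first by rewrite addSnnS.
  rewrite exprS; apply: (merom_mul sg0 sP sgm0 (ltW mQ)) X _.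
  - by rewrite ler_peMl ?(ltW Q0)// ltW.
  - apply: (le_trans QP); rewrite ler_wpM2l ?(ltW P0)//.
    by rewrite -{1}[sg]expr1; apply: ler_weXn2l => //; exact: ltW.
  exact: (merom_tau m1 (ltW mQ)).
elim: H => [{}h H|l {}h ls Hl IHl]; first exact: (base).
have Hh : merom (sg ^+ m) Q h by exact: merom_step Hl.
have Rh := merom_radius sgm0 (ltW mQ) Hh.
apply: (@merom_sqr _ _ l); rewrite (gS_sub_shl s01 Ho He l m1 Rh).
apply: meromD => //; apply: meromD.
  by apply: merom_shl; apply: quad => //; exact: merom_shl.
by apply: quad => //; apply: merom_shl; exact: merom_shl.
Qed.

Lemma merom_gU q : 1 < q -> sg <= q ^+ 2 -> merom sg (q ^+ 2) xo -> merom sg (q ^+ 2) xe ->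
  merom 0 q gU.
Proof.
move=> q1 sq Xo Xe; have q20 : 0 <= q ^+ 2 by rewrite exprn_ge0// ltW// (lt_trans ltr01).
have QP : q ^+ 2 <= q ^+ 2 * sg by rewrite ler_peMr// ltW.
apply: merom_unshl; apply: merom_unshl; rewrite (gU_shl2 s01 Ho He).
apply: meromD; first apply: merom_shl.
  by apply: (merom_gS (m := 1) q1 sq QP) => //; rewrite expr1.
by apply: (merom_gS (m := 1) q1 sq QP) => //; rewrite expr1.
Qed.

(** For parameters without poles the map is a Toeplitz operator: since c_n is its own
reciprocal and close to v = u / (1 - z^2), pairing y with the coefficients of the c_n
is v(T) applied to y, up to a term of higher decay. *)
Lemma gS_toeplitz p yo ye : 1 < p -> radius_ge (p ^+ 2) yo -> radius_ge (p ^+ 2) ye ->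
  radius_ge (p * s0) (fun k : nat => gS yo k.+1 + gS ye k - opT gv (shl (interleave yo ye)) k).
Proof.
move=> p1 Yo Ye; set Z := interleave yo ye.
have p0 : 0 < p by exact: lt_trans p1.
have p21 : 1 < p ^+ 2 by rewrite exprn_egt1.
have HZ : radius_ge p Z by exact: radius_ge_interleave.
have s00 : 0 < s0 by exact: lt_trans s01.
pose e (k i : nat) := gc i./2 (if odd i then k else k.+1).
have dom (k : nat) : geometric_dominated (fun i => Z i * e k i).
  have [K [q [q0 q1 hK]]] := radius_gt1_geo p1 HZ.
  have [th [th0 ths0 th1]] := mid_radius ler01 s01.
  have [K' K'0 hK'] := gc_bound Ho He th1 ths0.
  exists (K * (K' * th ^+ k.+1)), q; split=> // i.
  rewrite normcME mulrAC ler_pM ?normc_ge0//.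
  rewrite /e; case: ifP => _; have [h _] := hK' i./2 k; have [h' _] := hK' i./2 k.+1 => //.
  rewrite (le_trans h)// ler_wpM2l// exprS ler_peMl ?exprn_ge0 ?(ltW th0)//.
  exact: ltW.
have E (k : nat) : gS yo k.+1 + gS ye k = csum (fun j => Z (k.+1 + j)%N * gc (k.+1 + j)./2 j).
  have dyo := gS_dominated s01 Ho He k.+1 p21 Yo.
  have dye := gS_dominated s01 Ho He k p21 Ye.
  transitivity (csum (fun i => Z i * e k i)).
    rewrite csum_pairs// /gS -csumD//; congr csum; apply/funext => n.
    by rewrite /Z interleave_double interleave_doubleS /e /= odd_double doubleK uphalf_double.
  rewrite (csum_split k.+1)// big1 ?add0r => [|i _].
    congr csum; apply/funext => j; congr (_ * _); rewrite /e.
    by case: ifPn => od; apply: gc_palindrome; [exact: palindrome_odd|exact: palindrome_even].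
  rewrite /e; case: ifPn => od; rewrite gc_support ?mulr0//.
    exact: lt_support_odd.
  exact: lt_support_even.
have HsZ := radius_ge_shl HZ.
have p1' : 1 < 1 * p by rewrite mul1r.
move=> s sgt0 sps0.
have p0' := p0.
have [t1 [t2 [[t10 t1p t20 t2s] [t2gt1 t12]]]] := split_radius p0 s00 (ltW sgt0) sps0 s01.
(* the radius of Z is kept above 1, for the sum over j to converge *)
pose t := Num.max t1 ((1 + p) / 2).
have tp : t < p by rewrite gt_max t1p; lra.
have t_gt1 : 1 < t by rewrite lt_max; apply/orP; right; lra.
have t0 : 0 < t by exact: lt_trans t_gt1.
have st : s <= t * t2 by rewrite (le_trans (ltW t12))// ler_wpM2r ?(ltW t20)// le_max lexx.
have [K hK] := HZ t t0 tp; have K0 := geo_ge0 hK.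
have [K' K'0 hK'] := gc_gv_bound Ho He t2gt1 t2s.
have it1 : t^-1 < 1 by rewrite invf_lt1.
have it0 : 0 <= t^-1 by rewrite invr_ge0 ltW.
exists (K * K' / (1 - t^-1)); apply: (@geo_le _ _ (t * t2)) => // k.
have g : geo (K * K' * (t * t2)^-1 ^+ k) t^-1
    (fun j => Z (k.+1 + j)%N * (gc (k.+1 + j)./2 j - gv j)).
  move=> j; rewrite normcME.
  set n := (k.+1 + j)./2.
  have kjn : (k + j <= 2 * n)%N by exact: half_lower.
  have it2 : 0 <= t2^-1 by rewrite invr_ge0 ltW.
  have it21 : t2^-1 <= 1 by rewrite invf_le1// ltW.
  apply: (@le_trans _ _ (K * t^-1 ^+ (k.+1 + j) * (K' * t2 ^- 2 ^+ n * t2 ^+ j))).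
    by rewrite ler_pM ?normc_ge0.
  have e1 : t2 ^- 2 ^+ n * t2 ^+ j <= t2^-1 ^+ k.
    rewrite -exprVn -exprM.
    have -> : t2^-1 ^+ (2 * n) = t2^-1 ^+ k * t2^-1 ^+ j * t2^-1 ^+ (2 * n - (k + j)).
      by rewrite -!exprD subnKC.
    rewrite -!mulrA ler_piMr ?exprn_ge0// mulrCA -exprMn.
    by rewrite mulVf ?gt_eqF// expr1n mulr1 exprn_ile1.
  have e2 : t^-1 ^+ (k.+1 + j) <= t^-1 ^+ k * t^-1 ^+ j.
    by rewrite -exprD; apply: ler_wiXn2l; rewrite ?(ltW it1)// leq_add2r.
  rewrite [leLHS](_ : _ = K * K' * (t^-1 ^+ (k.+1 + j) * (t2 ^- 2 ^+ n * t2 ^+ j))); last by ring.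
  rewrite [leRHS](_ : _ = K * K' * (t^-1 ^+ k * t^-1 ^+ j * t2^-1 ^+ k)); last first.
    by rewrite invfM exprMn; ring.
  rewrite ler_wpM2l ?mulr_ge0// ler_pM ?exprn_ge0// mulr_ge0 ?exprn_ge0//.
    by rewrite invr_ge0 exprn_ge0// ltW.
  exact: ltW.
have := normc_csum it0 it1 g; rewrite mulrAC.
suff -> : gS yo k.+1 + gS ye k - opT gv (shl Z) k =
  csum (fun j => Z (k.+1 + j)%N * (gc (k.+1 + j)./2 j - gv j)) by [].
have dv : geometric_dominated (fun j => gv j * shl Z (k + j)%N).
  exact: (opT_dominated k ltr01 p0 p1' (radius_ge_gv s01 Ho He) HsZ).
rewrite E /opT -csumN// -csumD; last exact: geometric_dominatedN.
  by congr csum; apply/funext => j; rewrite /shl addSn; ring.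
have dg : geometric_dominated (fun j => Z (k.+1 + j)%N * (gc (k.+1 + j)./2 j - gv j)).
  by exists (K * K' * (t * t2)^-1 ^+ k), t^-1.
have := geometric_dominatedD dg dv; congr geometric_dominated.
by apply/funext => j; rewrite /shl addSn; ring.
Qed.

Lemma gU_opT p w : 1 < p -> radius_ge p w ->
  opT gU w = add (opT gv w) (scal (-1) (shl (shl (opT gv w)))).
Proof.
move=> p1 W; have p0 : 0 < p by exact: lt_trans p1.
have p1' : 1 < 1 * p by rewrite mul1r.
have V := radius_ge_gv s01 Ho He.
have Vz := radius_ge_mulz V; have Vzz := radius_ge_mulz Vz.
rewrite (gU_gv s01 Ho He) (opTDl ltr01 p0 p1' V (radius_geZ _ Vzz) W).
rewrite (opTZl _ ltr01 p0 p1' Vzz W) (opT_mulz ltr01 p0 p1' Vz W).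
by rewrite (opT_mulz ltr01 p0 p1' V (radius_ge_shl W)).
Qed.

Lemma radius_ge_gU : radius_ge 1 gU.
Proof.
rewrite (gU_gv s01 Ho He); have V := radius_ge_gv s01 Ho He.
apply: radius_geD => //; apply: radius_geZ.
by apply: radius_ge_mulz; exact: radius_ge_mulz.
Qed.

(** The poles of the arguments are cleared one at a time by the shift identity, whose
quadratic terms are meromorphic up to the larger radius. Once there are none left, the
hypothesis bears on u(T) applied to the interleaved arguments, and u(T) is inverted. *)
Lemma merom_linear_part p ho he : s0 <= p -> merom sg (p ^+ 2) xo -> merom sg (p ^+ 2) xe ->
  merom sg (p ^+ 2) ho -> merom sg (p ^+ 2) he ->
  merom 0 (p * s0) (add (shl (gS ho)) (gS he)) ->
  merom 0 ((p * s0) ^+ 2) ho /\ merom 0 ((p * s0) ^+ 2) he.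
Proof.
move=> sp Xo Xe.
have p1 : 1 < p by exact: lt_le_trans sp.
have p0 : 0 < p by exact: lt_trans p1.
have s00 : 0 < s0 by exact: lt_trans s01.
set q := p * s0.
have q1 : 1 < q by rewrite (lt_le_trans p1)// ler_peMr ?ltW.
have q0 : 0 < q by exact: lt_trans q1.
have pq : p <= q by rewrite ler_peMr ?ltW.
have sP : sg <= p ^+ 2 by rewrite lerXn2r ?nnegrE ?(ltW p0) ?(ltW s00).
have QE : q ^+ 2 = p ^+ 2 * sg by rewrite exprMn.
have QP : q ^+ 2 <= p ^+ 2 * sg by rewrite QE.
have quad x k : merom sg (p ^+ 2) x -> merom sg (p ^+ 2) k -> merom 0 q (gS (mul x (tau k))).
  move=> X Kk; apply: (merom_gS (m := 2) q1 sP QP) => //.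
  rewrite QE [sg ^+ 2]expr2; apply: (merom_mul sg0 sP sg0 sP) X _ => //; first by rewrite mulrC.
  exact: merom_tau.
have stuff l k : merom sg (p ^+ 2) k ->
    merom 0 q (fun j => gS k j.+2 - l * gS k j - gS (sub_shl l k) j).
  move=> Kk; have Rk := merom_radius sg0 sP Kk.
  have E := gS_sub_shl s01 Ho He l sg1 Rk.
  rewrite (_ : (fun j => _) = add (shl (gS (mul xo (tau (shl k))))) (gS (mul xe (tau (shl (shl k)))))).
    apply: meromD; first by apply: merom_shl; apply: quad => //; exact: merom_shl.
    by apply: quad => //; apply: merom_shl; exact: merom_shl.
  apply/funext => j; have := congr1 (fun f => f j) E => /= ->.
  by rewrite /add; ring.
have reduce l ho' he' : merom sg (p ^+ 2) ho' -> merom sg (p ^+ 2) he' ->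
    merom 0 q (add (shl (gS ho')) (gS he')) ->
    merom 0 q (add (shl (gS (sub_shl l ho'))) (gS (sub_shl l he'))).
  move=> Ho' He' H.
  have H1 := merom_shl (merom_shl H).
  have H2 := meromZ (-1) (meromD (meromZ l H) (meromD (merom_shl (stuff l _ Ho')) (stuff l _ He'))).
  have := meromD H1 H2; congr (merom 0 q).
  by apply/funext => j; rewrite /add /scal /shl; ring.
move=> Hho; elim: Hho he => [{}ho Yo|l {}ho ls Hl IH] he Hhe; last first.
  move=> /(reduce l _ _ (merom_step ls Hl) Hhe)/(IH _ (merom_sub_shl l Hhe))[H1 H2].
  by split; apply: (@merom_step _ _ _ l); rewrite ?mulr0.
elim: Hhe ho Yo => [{}he Ye|l {}he ls Hl IH] ho Yo; last first.
  move=> /(reduce l _ _ (merom_base _ Yo) (merom_step ls Hl))/(IH _ (radius_ge_sub_shl l Yo))[H1 H2].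
  by split; apply: (@merom_step _ _ _ l); rewrite ?mulr0.
move=> H; pose Z := interleave ho he.
have HZ : radius_ge p Z by exact: radius_ge_interleave.
have HW := radius_ge_shl HZ.
have T := gS_toeplitz p1 Yo Ye; rewrite -/Z -/q in T.
have Vw : merom 0 q (opT gv (shl Z)).
  have := meromD H (meromZ (-1) (merom_base 0 T)); congr (merom 0 q).
  by apply/funext => j; rewrite /add /scal /shl; ring.
have Uw : merom 0 q (opT gU (shl Z)).
  rewrite (gU_opT p1 HW); apply: meromD => //; apply: meromZ.
  by apply: merom_shl; exact: merom_shl.
have U0 : gU 0 != 0 by rewrite gU0 oner_eq0.
have := merom_opT_inv p1 pq radius_ge_gU U0 HW Uw.
move=> /merom_unshl/(merom_double q0)[].
rewrite (_ : (fun n => Z n.*2) = ho); last by apply/funext => n; exact: interleave_double.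
by rewrite (_ : (fun n => Z n.*2.+1) = he); last by apply/funext => n; exact: interleave_doubleS.
Qed.

(** Each application of the linear part gains a factor s0^2 in the radius up to which
the parameters are known to be meromorphic. *)
Lemma gU_merom : (forall q, merom 0 q gU) -> forall q, merom 0 q xo /\ merom 0 q xe.
Proof.
move=> HU q; have s00 : 0 < s0 by exact: lt_trans s01.
suff claim n : merom sg ((s0 ^+ n.+1) ^+ 2) xo /\ merom sg ((s0 ^+ n.+1) ^+ 2) xe.
  have q10 : 0 < `|q| + 1 by rewrite ltr_wpDl.
  have [||| n] := @geometric_small R s0^-1 (`|q| + 1)^-1.
  - by rewrite invr_ge0 ltW.
  - by rewrite invf_lt1.
  - by rewrite invr_gt0.
  rewrite exprVn ltf_pV2 ?posrE ?exprn_gt0// => qn.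
  have [Xo Xe] := claim n.
  have qs : q <= (s0 ^+ n.+1) ^+ 2.
    apply: (@le_trans _ _ (s0 ^+ n)).
      by rewrite (le_trans (ler_norm q))// (le_trans _ (ltW qn))// lerDl.
    by rewrite -exprM; apply: ler_weXn2l; [exact: ltW|exact: leq_trans (leqnSn n) (leq_pmulr _ _)].
  by split; [apply: merom_le Xo|apply: merom_le Xe] => //; exact: ltW.
elim: n => [|n [Xo Xe]].
  by rewrite expr1; split; exact: merom_base.
have sp : s0 <= s0 ^+ n.+1 by rewrite exprS ler_peMr ?exprn_ege1// ltW.
have H : merom 0 (s0 ^+ n.+1 * s0) (add (shl (gS xo)) (gS xe)).
  by rewrite -(gU_shl2 s01 Ho He); apply: merom_shl; apply: merom_shl; exact: HU.
have [] := merom_linear_part sp Xo Xe Xo Xe H; rewrite -exprSr => H1 H2.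
have sQ : sg <= (s0 ^+ n.+2) ^+ 2.
  by rewrite lerXn2r ?nnegrE ?exprn_ge0 ?(ltW s00)// exprS ler_peMr ?exprn_ege1// ltW.
by split; apply: merom_prune.
Qed.

Lemma merom_gU_iff : (forall q, merom 0 q gU) <->
  (forall q, merom 0 q (interleave xo xe)).
Proof.
have s00 : 0 < s0 by exact: lt_trans s01.
split=> [HU q|HZ q].
  have q10 : 0 < `|q| + 1 by rewrite ltr_wpDl.
  have [Xo Xe] := gU_merom HU ((`|q| + 1) ^+ 2).
  apply: merom_le (merom_interleave q10 Xo Xe) => //.
  by rewrite (le_trans (ler_norm q))// lerDl.
pose r := Num.max s0 q.
have sr : s0 <= r by rewrite le_max lexx.
have r0 : 0 < r by exact: lt_le_trans sr.
have r1 : 1 < r by exact: lt_le_trans sr.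
have sr2 : sg <= r ^+ 2 by rewrite lerXn2r ?nnegrE ?(ltW r0) ?(ltW s00).
have [Xo Xe] := merom_double r0 (HZ r).
apply: (@merom_le _ 0 0 r q) => //; first by rewrite le_max lexx orbT.
apply: merom_gU => //; apply: merom_prune => //.
  by move: Xo; congr (merom 0 _); apply/funext => n; exact: interleave_double.
by move: Xe; congr (merom 0 _); apply/funext => n; exact: interleave_doubleS.
Qed.

End Equivalence.

(** * The perturbation determinant *)

Section Determinant.
Variable R : realType.
Local Notation C := R[i].
Implicit Types (d e : nat -> C) (z : C).

Definition trid d e (i j : nat) : C :=
  if i == j then d i else if j == i.+1 then e i else if i == j.+1 then e j else 0.

Definition tri_mx d e n : 'M[C]_n := \matrix_(i < n, j < n) trid d e i j.

Lemma det_tri_mx d e n : \det (tri_mx d e n.+2) =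
  d n.+1 * \det (tri_mx d e n.+1) - e n ^+ 2 * \det (tri_mx d e n).
Proof.
rewrite (expand_det_row _ ord_max) !big_ord_recr /= big1 ?add0r => [|j _]; last first.
  rewrite mxE /trid /= gtn_eqF ?ltnS 1?ltnW// ltn_eqF ?(ltn_trans (ltn_ord j))//.
  by rewrite eqSS gtn_eqF// mul0r.
rewrite addrC; congr (_ + _).
  rewrite mxE /trid /= eqxx /cofactor addnn -signr_odd odd_double mul1r; congr (_ * \det _).
  by apply/matrixP => i j; rewrite !mxE !lift_max.
rewrite mxE /trid /= gtn_eqF// ltn_eqF// eqxx /cofactor /= addSn addnn.
rewrite exprS -signr_odd odd_double expr0 mulr1 mulN1r mulrN expr2 -mulrA; congr (- (_ * _)).
set B := row' _ _; rewrite (expand_det_col B ord_max) big_ord_recr /= big1 ?add0r => [|i _].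
  rewrite /cofactor addnn -signr_odd odd_double mul1r.
  have -> : B ord_max ord_max = e n.
    by rewrite !mxE /trid lift_max /= /bump leqnn add1n ltn_eqF// eqxx.
  have -> // : row' ord_max (col' ord_max B) = tri_mx d e n.
  apply/matrixP => i j; rewrite !mxE !lift_max /=; congr trid.
  have jn : bump n j = j by rewrite /bump leqNgt ltn_ord.
  by rewrite !jn.
rewrite !mxE /trid lift_max /= /bump leqnn add1n; have i_n := ltn_ord i.
rewrite (ltn_eqF (ltnW _)) ?ltnS// eqSS (gtn_eqF i_n) (ltn_eqF (ltn_trans i_n _)) ?mul0r//.
Qed.

Lemma det_tri_mx1 d e : \det (tri_mx d e 1) = d 0%N.
Proof. by rewrite det_mx11 mxE. Qed.

Lemma tri_mx_eq d d' e n : (forall i, (i < n)%N -> d i = d' i) -> tri_mx d e n = tri_mx d' e n.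
Proof. by move=> dd; apply/matrixP => i j; rewrite !mxE /trid dd. Qed.

Lemma det_tri_mx_last d e n y : \det (tri_mx (fun i => if i == n then d i + y else d i) e n.+1) =
  \det (tri_mx d e n.+1) + y * \det (tri_mx d e n).
Proof.
case: n => [|n]; first by rewrite !det_tri_mx1 /= det_mx00 mulr1.
rewrite !det_tri_mx eqxx.
rewrite (@tri_mx_eq _ d e n.+1) => [|i i_n]; last by rewrite ltn_eqF.
rewrite (@tri_mx_eq _ d e n) => [|i i_n]; last by rewrite (ltn_eqF (leq_trans i_n (leqnSn n))).
by ring.
Qed.

(** * The free resolvent *)

(** This is z^n U_n, with U_n the Chebyshev polynomial of the second kind at
(z + 1/z) / 2; it is c_n for the free Jacobi matrix. *)
Definition free_sol z n : C := \sum_(k < n.+1) z ^+ (2 * k).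

Lemma free_sol0 z : free_sol z 0 = 1.
Proof. by rewrite /free_sol big_ord_recl big_ord0 addr0. Qed.

Lemma free_solS z n : free_sol z n.+1 = 1 + z ^+ 2 * free_sol z n.
Proof.
rewrite /free_sol big_ord_recl mulr_sumr; congr (_ + _).
by apply: eq_bigr => i _; rewrite -exprD lift0 mulnS.
Qed.

Lemma free_solSS z n : free_sol z n.+2 = (1 + z ^+ 2) * free_sol z n.+1 - z ^+ 2 * free_sol z n.
Proof. by rewrite !free_solS; ring. Qed.

Lemma free_sol_geometric z n : free_sol z n * (1 - z ^+ 2) = 1 - z ^+ (2 * n.+1).
Proof.
elim: n => [|n IH]; first by rewrite free_sol0 mul1r muln1.
by rewrite free_solS mulrDl mul1r -mulrA IH [(2 * n.+2)%N]mulnS exprD; ring.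
Qed.

(** The decaying solution z^j of the free recursion times the solution that satisfies the
boundary condition, divided by their Wronskian. *)
Definition free_green z (i j : nat) : C :=
  if (i <= j)%N then - z ^+ (j - i).+1 * free_sol z i else - z ^+ (i - j).+1 * free_sol z j.

Definition free_op z (i j : nat) : C := free_jacobi_mx R i j - (z + z^-1) *+ (i == j).

Lemma jacobi_mx_trid (a b : nat -> R) i j :
  jacobi_mx a b i j = trid (fun k => (b k.+1)%:C) (fun k => (a k.+1)%:C) i j.
Proof. by []. Qed.

Lemma trid_diag d e i : trid d e i i = d i.
Proof. by rewrite /trid eqxx. Qed.

Lemma trid_up d e i : trid d e i i.+1 = e i.
Proof. by rewrite /trid ltn_eqF// eqxx. Qed.

Lemma trid_down d e i : trid d e i.+1 i = e i.
Proof. by rewrite /trid gtn_eqF// (ltn_eqF (leqnSn _)) eqxx. Qed.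

Lemma trid_far d e i j : (j.+1 < i)%N -> trid d e i j = 0.
Proof.
move=> ji; have ji' := ltnW ji.
by rewrite /trid (gtn_eqF ji') (ltn_eqF (leq_trans ji' (leqnSn _))) (gtn_eqF ji).
Qed.

Lemma trid_app d e (v : nat -> C) i : tridiag_app (trid d e) v i =
  (if i is k.+1 then e k * v k else 0) + d i * v i + e i * v i.+1.
Proof.
rewrite /tridiag_app !big_ord_recr /= trid_diag trid_up.
congr (_ + _ + _); case: i => [|i]; first by rewrite big_ord0.
rewrite big_ord_recr /= trid_down big1 ?add0r// => j _.
by rewrite trid_far ?mul0r// ltnS.
Qed.

Lemma free_op_trid z : free_op z = trid (fun=> - (z + z^-1)) (fun=> 1).
Proof.
apply/funext => i; apply/funext => j; rewrite /free_op /free_jacobi_mx /jacobi_mx /trid.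
by case: eqVneq => _; rewrite ?mulr1n ?mulr0n ?subr0 ?sub0r//=; rewrite ?complexr0.
Qed.

Lemma free_greenP z i j : z != 0 -> tridiag_app (free_op z) ((free_green z)^~ j) i = (i == j)%:R.
Proof.
move=> z0; rewrite free_op_trid trid_app !mul1r.
have [ij|ji|->] := ltngtP i j.
- rewrite [RHS](_ : _ = 0)//.
  have E1 : free_green z i j = - z ^+ (j - i).+1 * free_sol z i by rewrite /free_green ltnW.
  have E2 : free_green z i.+1 j = - z ^+ (j - i) * free_sol z i.+1.
    by rewrite /free_green ij subnSK.
  rewrite E1 E2; case: i ij {E1 E2} => [|i] ij.
    rewrite free_solS free_sol0 exprS.
    by field.
  have -> : free_green z i j = - z ^+ (j - i.+1).+2 * free_sol z i.
    by rewrite /free_green (ltnW (ltnW ij)) subnSK// ltnW.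
  rewrite free_solSS !exprS.
  by field.
- rewrite [RHS](_ : _ = 0)//.
  have E1 : free_green z i j = - z ^+ (i - j).+1 * free_sol z j.
    by rewrite /free_green leqNgt ji.
  have E2 : free_green z i.+1 j = - z ^+ (i - j).+2 * free_sol z j.
    by rewrite /free_green leqNgt (ltn_trans ji)// subSn// ltnW.
  rewrite E1 E2; case: i ji {E1 E2} => // i; rewrite ltnS => ji.
  have -> : free_green z i j = - z ^+ (i - j).+1 * free_sol z j.
    rewrite /free_green; case: ifP => // ij; have -> : i = j by apply/eqP; rewrite eqn_leq ij.
    by rewrite subnn.
  rewrite subSn// !exprS.
  by field.
rewrite [RHS](_ : _ = 1)//.
have E1 : free_green z j j = - z * free_sol z j by rewrite /free_green leqnn subnn expr1.
have E2 : free_green z j.+1 j = - z ^+ 2 * free_sol z j.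
  by rewrite /free_green ltnn subSn// subnn.
rewrite E1 E2; case: j {E1 E2} => [|j].
  by rewrite free_sol0; field.
have -> : free_green z j j.+1 = - z ^+ 2 * free_sol z j.
  by rewrite /free_green leqnSn subSn// subnn.
by rewrite free_solS; field.
Qed.

Lemma is_l2_geo K q (v : nat -> C) : 0 <= q -> q < 1 -> geo K q v -> is_l2 v.
Proof.
move=> q0 q1 vK; have K0 := geo_ge0 vK.
apply: (@real_geo_cvg R (K ^+ 2) (q ^+ 2)).
- by rewrite exprn_ge0.
- by rewrite exprn_ilt1.
- by rewrite exprn_ge0.
move=> n; rewrite ger0_norm ?exprn_ge0 ?normc_ge0// -exprM mulnC exprM -exprMn.
by rewrite lerXn2r ?nnegrE ?normc_ge0 ?mulr_ge0 ?exprn_ge0.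
Qed.

Lemma is_l2_bounded (v : nat -> C) : is_l2 v -> exists N, forall n, (N <= n)%N -> normc (v n) <= 1.
Proof.
move=> /cvg_series_cvg_0/cvgrPdist_lt/(_ _ ltr01)[N _ hN]; exists N => n /hN /=.
rewrite sub0r normrN ger0_norm ?exprn_ge0 ?normc_ge0// => h.
rewrite -(@ler_pXn2r _ 2)// ?nnegrE ?normc_ge0// expr1n.
exact: ltW.
Qed.

(** Any solution is v_0 times the sequence U_n, which grows like z^(-n), so that a bounded
one vanishes. *)
Lemma free_op_kernel z (v : nat -> C) N : z != 0 -> normc z < 1 ->
  (forall n, (N <= n)%N -> normc (v n) <= 2) ->
  (forall i, tridiag_app (free_op z) v i = 0) -> forall n, v n = 0.
Proof.
move=> z0 z1 vN v0.
have sol n : v n * z ^+ n = v 0%N * free_sol z n /\ v n.+1 * z ^+ n.+1 = v 0%N * free_sol z n.+1.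
  elim: n => [|n [IH1 IH2]].
    split; first by rewrite expr0 free_sol0.
    have := v0 0%N; rewrite free_op_trid trid_app add0r mul1r => /eqP.
    rewrite addrC addr_eq0 => /eqP ->.
    by rewrite free_solS free_sol0 expr1; field.
  split=> //; have := v0 n.+1; rewrite free_op_trid trid_app !mul1r => /eqP.
  rewrite addrC addr_eq0 => /eqP ->.
  transitivity ((1 + z ^+ 2) * (v n.+1 * z ^+ n.+1) - z ^+ 2 * (v n * z ^+ n)).
    by rewrite !exprS; field.
  by rewrite IH1 IH2 free_solSS; ring.
have vanish : v 0%N = 0.
  have E n : v 0%N = v 0%N * z ^+ (2 * n.+1) + v n * z ^+ n * (1 - z ^+ 2).
    by have [-> _] := sol n; rewrite -mulrA free_sol_geometric; ring.
  apply: (@geo_zero R (normc (v 0%N) + 4) (normc z)) => //; first exact: normc_ge0.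
  move=> n; rewrite {1}(E (N + n)%N).
  have zn m : (n <= m)%N -> normc z ^+ m <= normc z ^+ n.
    by move=> nm; apply: ler_wiXn2l => //; [exact: normc_ge0|exact: ltW].
  have zn0 : 0 <= normc z ^+ n by rewrite exprn_ge0// normc_ge0.
  rewrite (le_trans (normcDle _ _))// mulrDl lerD//.
    rewrite normcME normcXE ler_wpM2l ?normc_ge0// zn//.
    by rewrite mulnS mulnDr; apply: leq_trans (leq_addl _ _); rewrite (leq_trans _ (leq_addl _ _))// leq_pmull.
  rewrite !normcME normcXE [4](_ : _ = 2 * 2); last by rewrite -natrM.
  rewrite -[leRHS]mulrA [2 * _ ^+ n]mulrC mulrA.
  apply: ler_pM; rewrite ?mulr_ge0 ?exprn_ge0 ?normc_ge0//.
    apply: ler_pM; rewrite ?exprn_ge0 ?normc_ge0//; first by apply: vN; exact: leq_addr.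
    by apply: zn; exact: leq_addl.
  rewrite (le_trans (normcBle _ _))// normc1E normcXE (_ : 2 = 1 + 1)// lerD2l.
  by rewrite exprn_ile1// ?normc_ge0// ltW.
move=> n; have [+ _] := sol n; rewrite vanish mul0r => /eqP.
by rewrite mulf_eq0 expf_eq0 (negbTE z0) andbF orbF => /eqP.
Qed.

End Determinant.

Section JostDeterminant.
Variable R : realType.
Local Notation C := R[i].
Implicit Types (d e v : nat -> C) (z : C).

Lemma free_green_succ z n j : (j <= n)%N -> free_green z n.+1 j = z * free_green z n j.
Proof.
move=> jn; have -> : free_green z n j = - z ^+ (n - j).+1 * free_sol z j.
  rewrite /free_green; case: ifP => // nj; have -> : n = j by apply/eqP; rewrite eqn_leq nj.
  by rewrite subnn.
by rewrite /free_green leqNgt ltnS jn /= subSn// [z ^+ _.+2]exprS; ring.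
Qed.

Lemma free_green_l2 z j : z != 0 -> normc z < 1 -> is_l2 ((free_green z)^~ j).
Proof.
move=> z0 z1; have nz0 : 0 < normc z by rewrite normc_gt0.
have iz0 : 0 < (normc z)^-1 by rewrite invr_gt0.
have [|K hK] := @eventually_geo R (normc z * normc (free_sol z j) / normc z ^+ j) (normc z)^-1
    (fun i => free_green z i j) j iz0.
  move=> i ji.
  have -> : free_green z i j = - z ^+ (i - j).+1 * free_sol z j.
    rewrite /free_green; case: ifP => // ij; have -> : i = j by apply/eqP; rewrite eqn_leq ij.
    by rewrite subnn.
  rewrite invrK normcME normcNE normcXE -[X in _ <= _ * _ ^+ X](subnKC ji) exprD exprS.
  rewrite le_eqVlt; apply/orP; left; apply/eqP.
  by field; rewrite expf_neq0// gt_eqF.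
by apply: (@is_l2_geo R K (normc z)); rewrite ?normc_ge0//; rewrite invrK in hK.
Qed.

(** Square summable inverses are unique: the difference of two has bounded columns in the
kernel of the free recursion. *)
Lemma free_resolventE z : z != 0 -> normc z < 1 -> free_resolvent z = free_green z.
Proof.
move=> z0 z1; rewrite /free_resolvent (negbTE z0) /l2_inverse.
apply: (@get_unique (nat -> nat -> C^o)).
  by move=> j; split; [exact: free_green_l2|move=> i; exact: free_greenP].
move=> G HG; apply/funext => i; apply/funext => j; apply/subr0_eq.
have [/is_l2_bounded[N1 h1] G1] := HG j.
have [N2 h2] := is_l2_bounded (free_green_l2 (j := j) z0 z1).
apply: (@free_op_kernel R z (fun i => G i j - free_green z i j) (maxn N1 N2)) => //.
  move=> n; rewrite geq_max => /andP[n1 n2].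
  by rewrite (le_trans (normcBle _ _))// (_ : 2 = 1 + 1)// lerD ?h1 ?h2.
move=> k; have E1 := G1 k; have E2 := free_greenP k j z0.
rewrite -[RHS](subrr ((k == j)%:R : C)) -{1}E1 -E2 /tridiag_app -sumrB.
by apply: eq_bigr => l _; rewrite mulrBr.
Qed.

Lemma trid_far' d e i j : (i.+1 < j)%N -> trid d e i j = 0.
Proof.
move=> ij; have ij' := ltnW ij.
by rewrite /trid (ltn_eqF ij') (gtn_eqF ij) (ltn_eqF (leq_trans ij' (leqnSn _))).
Qed.

(** On vectors continued by v_(n+1) = z v_n the tridiagonal operator, cut after row n,
acts as a finite tridiagonal matrix with a modified last diagonal entry. *)
Lemma trid_cut d e v n i z : (i <= n)%N -> v n.+1 = z * v n ->
  \sum_(k < n.+1) trid (fun k => if k == n then d k + e n * z else d k) e i k * v k =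
  tridiag_app (trid d e) v i.
Proof.
set d' : nat -> C := (fun k => if k == n then d k + e n * z else d k); move=> i_n vz; have [i_lt|] := ltnP i n.
  rewrite /tridiag_app (big_ord_widen n.+1 (fun k => trid d e i k * v k))//.
  rewrite [RHS]big_mkcond /=; apply: eq_bigr => k _.
  case: ifPn => [ki|]; last by rewrite -leqNgt => ki; rewrite trid_far' ?mul0r.
  by rewrite /trid /d' (ltn_eqF i_lt).
move=> n_i; have {n_i i_n} -> : i = n by apply/eqP; rewrite eqn_leq i_n.
rewrite /tridiag_app [RHS]big_ord_recr /= trid_up vz !big_ord_recr /=  !trid_diag /d' eqxx.
rewrite (eq_bigr (fun k : 'I_n => trid d e n k * v k)) => [|k _]; first by ring.
by rewrite /trid gtn_eqF.
Qed.

Variables (a b : nat -> R) (s0 : R).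
Let xo n : C := (- b n.+1)%:C.
Let xe n : C := (1 - a n.+1 ^+ 2)%:C.
Hypothesis s01 : 1 < s0.
Hypothesis Ho : radius_ge (s0 ^+ 2) xo.
Hypothesis He : radius_ge (s0 ^+ 2) xe.
Hypothesis Ha : exists K q, [/\ 0 < q, q < 1 & forall n, `|a n.+1 - 1| <= K * q ^+ n].

Local Notation gc := (gc xo xe).
Local Notation gg := (gg xo xe).
Local Notation gU := (gU xo xe).

(** The three-term recursion of the c_n, as functions; it agrees with the expansion of a
tridiagonal determinant along its last row. *)
Lemma ps_gc_rec z n r : normc z < r -> (forall n, radius_ge r (gc n)) ->
  ps (gc n.+2) z = (1 + z ^+ 2 + xo n.+1 * z) * ps (gc n.+1) z - (a n.+1 ^+ 2)%:C * z ^+ 2 * ps (gc n) z.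
Proof.
move=> zr H.
have -> : gc n.+2 = add (gc n.+1) (add (mulz (mulz (gc n.+1))) (add (scal (xo n.+1) (mulz (gc n.+1)))
    (scal (- (a n.+1 ^+ 2)%:C) (mulz (mulz (gc n)))))).
  apply/funext => j; rewrite gc_three_term /add /scal /xe rmorphB rmorph1; ring.
have M m := radius_ge_mulz (H m); have MM m := radius_ge_mulz (M m).
have Z1 := radius_geZ (xo n.+1) (M n.+1); have Z2 := radius_geZ (- (a n.+1 ^+ 2)%:C) (MM n).
rewrite (psD (H n.+1) (radius_geD (MM n.+1) (radius_geD Z1 Z2)) zr).
rewrite (psD (MM n.+1) (radius_geD Z1 Z2) zr) (psD Z1 Z2 zr).
rewrite (psZ _ (M n.+1) zr) (psZ _ (MM n) zr) (ps_mulz (M n.+1) zr) (ps_mulz (M n) zr).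
rewrite (ps_mulz (H n.+1) zr) (ps_mulz (H n) zr).
by ring.
Qed.

Lemma ps_one z : ps (@one_seq R) z = 1.
Proof. exact: ps_delta. Qed.

Lemma ps_gc1 z r : normc z < r -> (forall n, radius_ge r (gc n)) ->
  ps (gc 1) z = 1 + z ^+ 2 + xo 0 * z.
Proof.
move=> zr H; have -> : gc 1 = add (mulz (mulz (gc 0))) (add (scal (xo 0) (mulz (gc 0))) (gc 0)).
  by apply/funext => j; rewrite gcS /add /scal addrA.
have M := radius_ge_mulz (H 0%N); have MM := radius_ge_mulz M.
have Z := radius_geZ (xo 0) M.
rewrite (psD MM (radius_geD Z (H 0%N)) zr) (psD Z (H 0%N) zr) (psZ _ M zr) (ps_mulz M zr).
rewrite (ps_mulz (H 0%N) zr) ps_one; ring.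
Qed.

Let dz z k : C := (b k.+1)%:C - (z + z^-1).
Let ea k : C := (a k.+1)%:C.

Lemma det_jacobi z n r : z != 0 -> normc z < r -> (forall n, radius_ge r (gc n)) ->
  (- z) ^+ n * \det (tri_mx (dz z) ea n) = ps (gc n) z.
Proof.
move=> z0 zr H.
suff h : (- z) ^+ n * \det (tri_mx (dz z) ea n) = ps (gc n) z /\
    (- z) ^+ n.+1 * \det (tri_mx (dz z) ea n.+1) = ps (gc n.+1) z by case: h.
elim: n => [|n [IH1 IH2]].
  split; first by rewrite expr0 mul1r det_mx00 ps_one.
  rewrite det_tri_mx1 (ps_gc1 zr H) /dz /xo rmorphN.
  by field.
split=> //; rewrite det_tri_mx (ps_gc_rec n zr H) -IH1 -IH2 /dz /ea /xo rmorphN rmorphXn !exprS.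
by field.
Qed.

Lemma det_free z n : z != 0 ->
  (- z) ^+ n * \det (tri_mx (fun=> - (z + z^-1)) (fun=> 1 : C) n) = free_sol z n.
Proof.
move=> z0.
suff h : (- z) ^+ n * \det (tri_mx (fun=> - (z + z^-1)) (fun=> 1 : C) n) = free_sol z n /\
    (- z) ^+ n.+1 * \det (tri_mx (fun=> - (z + z^-1)) (fun=> 1 : C) n.+1) = free_sol z n.+1.
  by case: h.
elim: n => [|n [IH1 IH2]].
  split; first by rewrite expr0 mul1r det_mx00 free_sol0.
  rewrite det_tri_mx1 free_solS free_sol0.
  by field.
split=> //; rewrite det_tri_mx free_solSS -IH1 -IH2 !exprS.
by field.
Qed.

(** Since 1 + dJ (J_0 - E)^-1 = (J - E)(J_0 - E)^-1, its finite sections are quotients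
of two tridiagonal determinants. *)
Lemma det_section z n r : z != 0 -> normc z < 1 -> normc z < r -> (forall n, radius_ge r (gc n)) ->
  \det (1%:M + \matrix_(i < n.+1, j < n.+1) tridiag_mul (delta_jacobi a b) (free_resolvent z) i j) =
  ps (gc n.+1) z - ea n * z ^+ 2 * ps (gc n) z.
Proof.
move=> z0 z1 zr H; rewrite free_resolventE//.
pose G := \matrix_(i < n.+1, j < n.+1) free_green z i j.
pose A := tri_mx (fun k => if k == n then dz z k + ea n * z else dz z k) ea n.+1.
pose A0 := tri_mx (fun k => if k == n then - (z + z^-1) + 1 * z else - (z + z^-1)) (fun=> 1 : C) n.+1.
have E0 : A0 *m G = 1%:M.
  apply/matrixP => i j; rewrite !mxE.
  rewrite (_ : \sum_k _ = tridiag_app (trid (fun=> - (z + z^-1)) (fun=> 1)) ((free_green z)^~ j) i).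
    by rewrite -free_op_trid free_greenP.
  rewrite -(@trid_cut (fun=> - (z + z^-1)) (fun=> 1) _ n i z).
  - by apply: eq_bigr => k _; rewrite !mxE.
  - by rewrite -ltnS.
  - by apply: free_green_succ; rewrite -ltnS.
have E1 : 1%:M + \matrix_(i < n.+1, j < n.+1) tridiag_mul (delta_jacobi a b) (free_green z) i j = A *m G.
  apply/matrixP => i j; rewrite !mxE.
  have -> : ((i == j)%:R : C) = (val i == val j)%:R by [].
  rewrite -(free_greenP i j z0) /tridiag_mul.
  rewrite (_ : \sum_k _ = tridiag_app (trid (dz z) ea) ((free_green z)^~ j) i).
    rewrite /tridiag_app -big_split /=; apply: eq_bigr => k _.
    rewrite -mulrDl; congr (_ * _).
    rewrite /free_op /delta_jacobi addrC addrA subrK jacobi_mx_trid /trid /dz.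
    by case: (_ == _) => //; rewrite mulr0n subr0.
  rewrite -(@trid_cut (dz z) ea _ n i z).
  - by apply: eq_bigr => k _; rewrite !mxE.
  - by rewrite -ltnS.
  - by apply: free_green_succ; rewrite -ltnS.
rewrite E1 det_mulmx.
have D0 : \det A0 * \det G = 1 by rewrite -det_mulmx E0 det1.
have D0' : (- z) ^+ n.+1 * \det A0 = 1.
  rewrite /A0 (det_tri_mx_last (fun=> - (z + z^-1))).
  rewrite mulrDr det_free// mul1r.
  rewrite exprS [X in _ + X](_ : _ = - z ^+ 2 * ((- z) ^+ n * \det (tri_mx (fun=> - (z + z^-1)) (fun=> 1) n))); last by ring.
  by rewrite det_free// free_solS; ring.
have A0n : \det A0 != 0.
  by apply/eqP => A00; move: D0; rewrite A00 mul0r => /eqP; rewrite eq_sym oner_eq0.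
have DG : \det G = (- z) ^+ n.+1.
  by apply: (mulfI A0n); rewrite D0 mulrC D0'.
rewrite DG mulrC /A det_tri_mx_last mulrDr (det_jacobi n.+1 z0 zr H) -(det_jacobi n z0 zr H).
by rewrite exprS; ring.
Qed.

Lemma mulz_le K th (c : nat -> C) j : 0 <= K -> 1 <= th ->
  (forall i, normc (c i) <= K * th ^+ i) -> normc (mulz c j) <= K * th ^+ j.
Proof.
move=> K0 th1 cK; have th0 : 0 <= th by exact: le_trans th1.
case: j => [|j]; first by rewrite mulz0 normc0E mulr_ge0// exprn_ge0.
by rewrite mulzS (le_trans (cK j))// ler_wpM2l// exprS ler_peMl// exprn_ge0.
Qed.

Lemma gg_gU_uniform th : 1 < th -> th < s0 -> exists K q, [/\ 0 <= q, q < 1, 0 <= K &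
  forall n j, normc (gU j - gg n j) <= K * q ^+ n * th ^+ j].
Proof.
move=> th1 ths0; have th0 : 0 < th by exact: lt_trans th1.
have [s [sgt0 ss s1]] := mid_radius ler01 (s0_sqr_gt1 s01).
have [Ko hKo] := Ho sgt0 ss; have [Ke hKe] := He sgt0 ss.
have Ko0 := geo_ge0 hKo; have Ke0 := geo_ge0 hKe.
have [K K0 hK] := gc_bound Ho He th1 ths0.
have q0 : 0 <= s^-1 by rewrite invr_ge0 ltW.
have q1 : s^-1 < 1 by rewrite invf_lt1.
exists ((Ko + Ke) * K / (1 - s^-1)), s^-1; split=> //.
  by rewrite mulr_ge0 ?mulr_ge0 ?addr_ge0// invr_ge0 subr_ge0 ltW.
move=> n j; have g : geo ((Ko + Ke) * K * th ^+ j) s^-1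
    (fun i => xo i * mulz (gc i) j + xe i * mulz (mulz (gc i)) j).
  move=> i; rewrite (le_trans (normcDle _ _))//.
  have ci k : normc (gc i k) <= K * th ^+ k by have [] := hK i k.
  have c1 k := mulz_le k K0 (ltW th1) ci.
  have c2 k := mulz_le k K0 (ltW th1) c1.
  rewrite [leRHS](_ : _ = Ko * s^-1 ^+ i * (K * th ^+ j) + Ke * s^-1 ^+ i * (K * th ^+ j)); last by ring.
  by rewrite lerD// normcME ler_pM ?normc_ge0.
have := csum_tail n q0 q1 g; rewrite gg_sum /gU opprD addrACA subrr add0r.
move/le_trans; apply; rewrite le_eqVlt; apply/orP; left; apply/eqP.
by ring.
Qed.

(** The section of size n + 1 has determinant c_(n+1) - a_(n+1) z^2 c_n. It differs from
g_(n+1) by a_(n+1) (a_(n+1) - 1) z^2 c_n, which tends to 0, and g_n tends to u. *)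
Lemma det_section_cvg z : normc z < 1 ->
  fredholm_det1D (tridiag_mul (delta_jacobi a b) (free_resolvent z)) = ps gU z.
Proof.
move=> z1; rewrite /fredholm_det1D; have [z0|z0] := eqVneq z 0.
  rewrite z0 (ps0 ltr01 (radius_ge_gU s01 Ho He)) gU0.
  rewrite (_ : (fun N => _) = fun=> (1 : C^o)); first exact: lim_cst.
  apply/funext => N; rewrite [X in 1%:M + X](_ : _ = 0) ?addr0 ?det1//.
  apply/matrixP => i j; rewrite !mxE /free_resolvent eqxx /tridiag_mul /tridiag_app.
  by rewrite big1// => k _; rewrite mulr0.
have [th [th1 ths0 zth]] : exists th, [/\ 1 < th, th < s0 & normc z < th^-1].
  have nz0 : 0 < normc z by rewrite normc_gt0.
  have iz1 : 1 < (normc z)^-1 by rewrite invf_gt1.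
  have h : 1 < Num.min s0 (normc z)^-1 by rewrite lt_min s01.
  have m1 : Num.min s0 (normc z)^-1 <= s0 by rewrite ge_min lexx.
  have m2 : Num.min s0 (normc z)^-1 <= (normc z)^-1 by rewrite ge_min lexx orbT.
  exists ((1 + Num.min s0 (normc z)^-1) / 2); split; [lra|lra|].
  have t0 : 0 < (1 + Num.min s0 (normc z)^-1) / 2 by lra.
  by rewrite -[X in X < _]invrK ltf_pV2 ?posrE ?invr_gt0//; lra.
have th0 : 0 < th by exact: lt_trans th1.
have ith0 : 0 < th^-1 by rewrite invr_gt0.
have [K K0 hK] := gc_bound Ho He th1 ths0.
have geoR K' (c : nat -> C) : (forall j, normc (c j) <= K' * th ^+ j) -> geo K' (th^-1)^-1 c.
  by move=> h j; rewrite invrK.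
have Rg K' (c : nat -> C) : geo K' (th^-1)^-1 c -> radius_ge th^-1 c.
  by move=> h s sgt0 sth; exists K'; apply: (@geo_le _ _ th^-1) => //; exact: ltW.
have gcg n : geo K (th^-1)^-1 (gc n) by apply: geoR => j; have [] := hK n j.
have Rgc n : radius_ge th^-1 (gc n) by exact: (Rg K).
pose x := normc z / th^-1.
have x0 : 0 <= x by rewrite divr_ge0 ?normc_ge0// ltW.
have x1 : x < 1 by rewrite ltr_pdivrMr// mul1r.
have ix0 : 0 <= (1 - x)^-1 by rewrite invr_ge0 subr_ge0 ltW.
have psb K' (c : nat -> C) : geo K' (th^-1)^-1 c -> normc (ps c z) <= K' / (1 - x).
  by move=> h; apply: normc_csum => //; exact: ps_geo.
have [K1 [q1 [q10 q11 K10 h1]]] := gg_gU_uniform th1 ths0.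
have [K2 [q2 [q2_gt0 q21 h2]]] := Ha; have q20 := ltW q2_gt0.
have K20 : 0 <= K2 by have := h2 0%N; rewrite expr0 mulr1; apply: le_trans.
pose q := Num.max q1 q2.
have q0 : 0 <= q by rewrite le_max q10.
have qlt1 : q < 1 by rewrite gt_max q11.
have qq1 n : q1 ^+ n <= q ^+ n by rewrite lerXn2r ?nnegrE// le_max lexx.
have qq2 n : q2 ^+ n <= q ^+ n by rewrite lerXn2r ?nnegrE// le_max lexx orbT.
pose L := K1 / (1 - x) + (K2 + 1) * K2 * (K / (1 - x)).
have L0 : 0 <= L by rewrite addr_ge0 ?mulr_ge0 ?addr_ge0.
have bound n : normc (\det (1%:M + \matrix_(i < n.+1, j < n.+1)
    tridiag_mul (delta_jacobi a b) (free_resolvent z) i j) - ps gU z) <= L * q ^+ n.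
  rewrite (det_section n z0 z1 zth Rgc).
  have ggE : ps (gg n.+1) z = ps (gc n.+1) z - ea n ^+ 2 * z ^+ 2 * ps (gc n) z.
    have -> : gg n.+1 = add (gc n.+1) (scal (- ea n ^+ 2) (mulz (mulz (gc n)))).
      apply/funext => j; rewrite ggS gcS /add /scal /xe /ea rmorphB rmorph1 rmorphXn; ring.
    have M := radius_ge_mulz (Rgc n); have MM := radius_ge_mulz M.
    rewrite (psD (Rgc n.+1) (radius_geZ _ MM) zth) (psZ _ MM zth) (ps_mulz M zth) (ps_mulz (Rgc n) zth).
    by ring.
  have -> : ps (gc n.+1) z - ea n * z ^+ 2 * ps (gc n) z - ps gU z =
     (ps (gg n.+1) z - ps gU z) + ea n * (ea n - 1) * z ^+ 2 * ps (gc n) z by rewrite ggE; ring.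
  rewrite (le_trans (normcDle _ _))// /L mulrDl lerD//.
    have gd' : geo (K1 * q1 ^+ n.+1) (th^-1)^-1 (add gU (scal (-1) (gg n.+1))).
      by apply: geoR => j; rewrite /add /scal mulN1r; exact: h1.
    have Rgg : radius_ge th^-1 (gg n.+1).
      have -> : gg n.+1 = add (gc n.+1) (scal (- ea n ^+ 2) (mulz (mulz (gc n)))).
        apply/funext => j; rewrite ggS gcS /add /scal /xe /ea rmorphB rmorph1 rmorphXn; ring.
      by apply: radius_geD => //; apply: radius_geZ; apply: radius_ge_mulz; exact: radius_ge_mulz.
    have RgU : radius_ge th^-1 gU.
      by apply: radius_ge_le (radius_ge_gU s01 Ho He); rewrite invf_le1// ltW.
    have := psb _ _ gd'; rewrite (psD RgU (radius_geZ _ Rgg) zth) (psZ _ Rgg zth) mulN1r.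
    rewrite normc_distC => /le_trans; apply; rewrite [leRHS]mulrAC ler_wpM2r//.
    rewrite ler_wpM2l// (le_trans _ (qq1 n))// exprS ler_piMl ?exprn_ge0//.
    exact: ltW.
  rewrite (normcME _ (ps _ _)) (normcME _ (z ^+ 2)) normcXE (normcME (ea n)).
  have ea1 : normc (ea n - 1) <= K2 * q ^+ n.
    have -> : ea n - 1 = (a n.+1 - 1)%:C by rewrite rmorphB rmorph1.
    by rewrite normc_real (le_trans (h2 n))// ler_wpM2l.
  have ea2 : normc (ea n) <= K2 + 1.
    have -> : ea n = (ea n - 1) + 1 by rewrite subrK.
    rewrite (le_trans (normcDle _ _))// normc1E lerD2r (le_trans ea1)// ler_piMr//.
    by rewrite exprn_ile1// ltW.
  have z21 : normc z ^+ 2 <= 1 by rewrite exprn_ile1 ?normc_ge0// ltW.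
  have cn := psb _ _ (gcg n).
  rewrite [leRHS](_ : _ = (K2 + 1) * (K2 * q ^+ n) * 1 * (K / (1 - x))); last by ring.
  by rewrite !ler_pM ?mulr_ge0 ?normc_ge0 ?exprn_ge0 ?normc_ge0.
apply: cvg_lim => //; apply/cvgCP => eps eps0.
have [||| N hN] := @geometric_small R q (eps / (L + 1)) => //.
  by rewrite divr_gt0// ltr_wpDl.
exists N.+1 => -[//|n]; rewrite ltnS => Nn.
rewrite (le_lt_trans (bound n))//.
apply: (@le_lt_trans _ _ ((L + 1) * q ^+ N)).
  apply: ler_pM => //; rewrite ?exprn_ge0// ?lerDl//.
  by apply: ler_wiXn2l => //; exact: ltW.
by rewrite mulrC -ltr_pdivlMr// ltr_wpDl.
Qed.

(** The logarithms of the a_n are summable, since |ln a| <= 2 |a - 1| when |a - 1| <= 1/2. *)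
Lemma prod_a_cvg : (forall n, (0 < n)%N -> 0 < a n) ->
  limn (fun N : nat => \prod_(j < N) a j.+1) != 0.
Proof.
move=> a0; have [K [q [q_gt0 q1 h]]] := Ha; have q0 := ltW q_gt0.
have K0 : 0 <= K by have := h 0%N; rewrite expr0 mulr1; apply: le_trans.
have [||| N hN] := @geometric_small R q ((2 * (K + 1))^-1) => //.
  by rewrite invr_gt0 mulr_gt0// ltr_wpDl.
have small n : (N <= n)%N -> `|a n.+1 - 1| <= 1 / 2.
  move=> Nn; rewrite (le_trans (h n))//.
  apply: (@le_trans _ _ ((K + 1) * (2 * (K + 1))^-1)).
    apply: ler_pM => //; rewrite ?exprn_ge0// ?lerDl//.
    by rewrite (le_trans _ (ltW hN))//; apply: ler_wiXn2l => //; exact: ltW.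
  by rewrite invfM mulrCA mulfV ?gt_eqF ?ltr_wpDl// mulr1 mul1r.
have lnb n : (N <= n)%N -> `|ln (a n.+1)| <= 2 * K * q ^+ n.
  move=> Nn; have an0 : 0 < a n.+1 by exact: a0.
  have := small n Nn; rewrite ler_norml => /andP[s1 s2].
  apply: (@le_trans _ _ (2 * `|a n.+1 - 1|)); last first.
    by rewrite -mulrA ler_wpM2l.
  have l1 : ln (a n.+1) <= a n.+1 - 1.
    have := @le_ln1Dx R (a n.+1 - 1); rewrite [1 + _]addrC subrK; apply.
    by rewrite ltrBrDr addNr.
  have l2 : - ln (a n.+1) <= (a n.+1)^-1 - 1.
    rewrite -lnV ?posrE//; have := @le_ln1Dx R ((a n.+1)^-1 - 1); rewrite [1 + _]addrC subrK; apply.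
    by rewrite ltrBrDr addNr invr_gt0.
  have l3 : (a n.+1)^-1 - 1 <= 2 * `|a n.+1 - 1|.
    have -> : (a n.+1)^-1 - 1 = (1 - a n.+1) * (a n.+1)^-1 by rewrite mulrBl mul1r mulfV// gt_eqF.
    rewrite [leRHS]mulrC distrC; apply: (@le_trans _ _ (`|1 - a n.+1| * (a n.+1)^-1)).
      by rewrite ler_wpM2r ?invr_ge0 ?ler_norm// ltW.
    by rewrite ler_wpM2l// -[leRHS]invrK lef_pV2 ?posrE ?invr_gt0//; lra.
  rewrite ler_norml; apply/andP; split; first by lra.
  by have := ler_norm (a n.+1 - 1); have := normr_ge0 (a n.+1 - 1); lra.
have [K' hK'] : exists K', geo K' q (fun n => (ln (a n.+1))%:C).
  have qp : 0 < q^-1 by rewrite invr_gt0.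
  have [|K' hK'] := @eventually_geo R (2 * K) q^-1 (fun n => (ln (a n.+1))%:C) N qp.
    by move=> n Nn; rewrite invrK normc_real lnb.
  by exists K'; rewrite invrK in hK'.
have cl : cvgn (series (fun n => ln (a n.+1))).
  apply: (@real_geo_cvg R K' q) => //; first exact: geo_ge0 hK'.
  by move=> n; have := hK' n; rewrite normc_real.
have E N' : \prod_(j < N') a j.+1 = expR (series (fun n => ln (a n.+1)) N').
  rewrite /series /= big_mkord expR_sum; apply: eq_bigr => j _.
  by rewrite lnK// posrE a0.
have cv : ((fun N' : nat => \prod_(j < N') a j.+1) @ \oo -->
    expR (limn (series (fun n => ln (a n.+1)))))%classic.
  rewrite (_ : (fun N' : nat => _) = expR \o series (fun n => ln (a n.+1))); last exact/funext.
  by apply: continuous_cvg => //; exact: continuous_expR.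
by rewrite (cvg_lim _ cv)// gt_eqF// expR_gt0.
Qed.

End JostDeterminant.

(** * The Jost function and the generating function of the parameters *)

Section Assembly.
Variable R : realType.
Local Notation C := R[i].
Variables a b : nat -> R.
Let xo n : C := (- b n.+1)%:C.
Let xe n : C := (1 - a n.+1 ^+ 2)%:C.

Lemma shl_jacobi_seq : shl (jacobi_seq a b) = interleave xo xe.
Proof.
apply/funext => n; rewrite /shl /jacobi_seq /interleave /xo /xe /=.
by rewrite uphalf_half; case: (odd n).
Qed.

Section Radius.
Variable s0 : R.
Hypothesis s01 : 1 < s0.
Hypothesis Ho : radius_ge (s0 ^+ 2) xo.
Hypothesis He : radius_ge (s0 ^+ 2) xe.

Lemma radius_ge_jacobi_seq : radius_ge s0 (jacobi_seq a b).
Proof.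
apply: radius_ge_unshl; rewrite shl_jacobi_seq; apply: radius_ge_interleave => //.
exact: lt_trans s01.
Qed.

(** Each summand of B collects an odd and the following even Taylor coefficient. *)
Lemma jacobi_B_ps z : normc z < 1 -> jacobi_B a b z = ps (jacobi_seq a b) z.
Proof.
move=> z1; have zs : normc z < s0 by exact: lt_trans s01.
have J := radius_ge_jacobi_seq.
have Z : radius_ge s0 (interleave xo xe) by rewrite -shl_jacobi_seq; exact: radius_ge_shl.
have D := ps_dominated Z zs.
rewrite (ps_recl J zs) shl_jacobi_seq /jacobi_B; congr (_ + _).
rewrite -[RHS]opprK -mulNr /ps -csumZ// csum_pairs; last exact: geometric_dominatedZ.
congr (- csum _); apply/funext => n.
rewrite interleave_double interleave_doubleS /xo /xe !rmorphB !rmorphN rmorph1.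
by rewrite -muln2 mulnC addn1 addn2 !exprS; ring.
Qed.

(** Poles inside the unit circle, or on it, are excluded by the decay of the parameters;
this is the condition 1 < |mu_j|. *)
Lemma complete_asymptotic_series_merom :
  complete_asymptotic_series (jacobi_seq a b) <-> forall q, merom 0 q (interleave xo xe).
Proof.
rewrite -shl_jacobi_seq; split=> H q.
  have r1 : 1 < Num.max q 2 by rewrite lt_max ltr1n orbT.
  apply: merom_shl; apply: (@merom_le _ 0 _ (Num.max q 2)); rewrite ?le_max ?lexx//.
  by apply: asymptotic_merom; [exact: lt_trans r1|exact: H].
move=> q1; have q0 := lt_trans ltr01 q1.
have s1 : 1 < Num.min s0 q by rewrite lt_min s01.
apply: (merom_asymptotic s1) => //; apply: merom_prune.
- exact: lt_trans s1.
- by rewrite ge_min lexx orbT.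
- by apply: radius_ge_le radius_ge_jacobi_seq; rewrite ge_min lexx.
- exact: merom_unshl.
Qed.

Lemma jacobi_B_merom :
  entire_meromorphic (jacobi_B a b) <-> forall q, merom 0 q (interleave xo xe).
Proof.
have J : radius_ge 1 (jacobi_seq a b) by apply: radius_ge_le radius_ge_jacobi_seq; exact: ltW.
rewrite -shl_jacobi_seq; split=> H.
  by move=> q; apply: merom_shl; exact: (entire_meromorphic_merom J jacobi_B_ps H).
by apply: (merom_entire_meromorphic J jacobi_B_ps) => q; exact: merom_unshl.
Qed.

Hypothesis Ha : exists K q, [/\ 0 < q, q < 1 & forall n, `|a n.+1 - 1| <= K * q ^+ n].
Hypothesis a_gt0 : forall n, (0 < n)%N -> 0 < a n.

Lemma jost_merom : entire_meromorphic (jost a b) <-> forall q, merom 0 q (gU xo xe).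
Proof.
have U := radius_ge_gU s01 Ho He.
pose kappa : C := ((limn (fun N : nat => \prod_(j < N) a j.+1))^-1)%:C.
have k0 : kappa != 0.
  by rewrite -normc_eq0 normc_real normr_eq0 invr_eq0; exact: (prod_a_cvg Ha a_gt0).
have jE z : normc z < 1 -> jost a b z = ps (scal kappa (gU xo xe)) z.
  by move=> z1; rewrite (psZ _ U z1) /jost (det_section_cvg s01 Ho He Ha z1).
have kU : radius_ge 1 (scal kappa (gU xo xe)) by exact: radius_geZ.
split=> H.
  move=> q; have := meromZ kappa^-1 (entire_meromorphic_merom kU jE H q).
  congr merom; apply/funext => n; by rewrite /scal mulKf.
by apply: (merom_entire_meromorphic kU jE) => q; exact: meromZ.
Qed.

End Radius.

Lemma geometric_parameters :
  (limn_esup (fun n : nat => ((`|b n| + `|a n - 1|) `^ (n%:R^-1))%:E) < 1)%E ->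
  exists s0, [/\ 1 < s0, radius_ge (s0 ^+ 2) xo, radius_ge (s0 ^+ 2) xe &
    exists K q, [/\ 0 < q, q < 1 & forall n, `|a n.+1 - 1| <= K * q ^+ n]].
Proof.
move=> /(@limn_esup_lt_geometric R (fun n => `|b n| + `|a n - 1|) 1).
case=> [n|q [N [q0 q1 h]]]; first by rewrite addr_ge0.
have iq0 : 0 < q^-1 by rewrite invr_gt0.
have s2 : Num.sqrt q^-1 ^+ 2 = q^-1 by rewrite sqr_sqrtr// ltW.
have s1 : 1 < Num.sqrt q^-1 by rewrite -[ltLHS]sqrtr1 ltr_sqrt// invf_gt1.
have hS n : (N <= n)%N -> `|b n.+1| <= q ^+ n /\ `|a n.+1 - 1| <= q ^+ n.
  move=> Nn; have := h n.+1 (leqW Nn).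
  have qq : q ^+ n.+1 <= q ^+ n by rewrite exprS ler_piMl ?exprn_ge0// ltW.
  move: (normr_ge0 (b n.+1)) (normr_ge0 (a n.+1 - 1)); lra.
have radius (f : nat -> C) K : (forall n, (N <= n)%N -> normc (f n) <= K * q ^+ n) ->
    radius_ge q^-1 f.
  move=> hf; have [|K' hK'] := @eventually_geo R K q^-1 f N iq0; first by rewrite invrK.
  by move=> s sgt0 sq; exists K'; apply: geo_le hK' => //; exact: ltW.
exists (Num.sqrt q^-1); rewrite s2; split=> //.
- apply: (radius _ 1) => n Nn; rewrite mul1r normc_real normrN.
  by have [] := hS n Nn.
- apply: (radius _ 3) => n Nn; have [_ h1] := hS n Nn.
  rewrite normc_real (_ : 1 - a n.+1 ^+ 2 = - ((a n.+1 - 1) + 2) * (a n.+1 - 1)); last by ring.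
  rewrite normrM normrN ler_pM// (le_trans (ler_normD _ _))// (_ : 3 = 1 + 2)//.
  by rewrite lerD ?normr_nat// (le_trans h1)// exprn_ile1// ltW.
- have [|K hK] := @eventually_geo R 1 q^-1 (fun n => (a n.+1 - 1)%:C) N iq0.
    by move=> n Nn; rewrite invrK mul1r normc_real; have [] := hS n Nn.
  by exists K, q; split=> // n; have := hK n; rewrite invrK normc_real.
Qed.

End Assembly.

Theorem theorem1p2 (R : realType) (a b : nat -> R)
  (a_gt0 : forall n : nat, (0 < n)%N -> 0 < a n)
  (decay : (limn_esup (fun n : nat =>
     ((`|b n| + `|a n - 1|) `^ (n%:R^-1))%:E) < 1)%E) :
  (complete_asymptotic_series (jacobi_seq a b) <->
     entire_meromorphic (jost a b)) /\
  (entire_meromorphic (jacobi_B a b) <-> entire_meromorphic (jost a b)).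
Proof.
have [s0 [s01 Ho He Ha]] := geometric_parameters decay.
rewrite (complete_asymptotic_series_merom s01 Ho He) (jacobi_B_merom s01 Ho He).
by rewrite (jost_merom s01 Ho He Ha a_gt0) (merom_gU_iff s01 Ho He).
Qed.
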